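(* Let $(M,J,\theta)$ be a closed pseudohermitian $(2n+1)$-manifold such that $$(2\,Ric-(n-2)\,Tor)(Z,Z)\ \geq\ -k\,\langle Z,Z\rangle\qquad\text{for all } Z\in\Gamma(T_{1,0}M),$$ with $k\ge0$, and $$\max_{i,j\in\{1,\dots,n\}}|A_{ij}|\le \overline{A},\qquad \max_{i,j\in\{1,\dots,n\}}|A_{ij,\overline{i}}|\le\overline{B}$$ for nonnegative constants $\overline{A},\overline{B}$. Let $1<m<+\infty$, $0<\varepsilon_1<+\infty$, and let $N>0$ be small enough that $$\frac{2n}{m}-\frac{2n^2N}{\varepsilon_1}-\frac{2mn^2N^2\overline{A}^2}{m-1}>0.$$ Then $M$ satisfies the curvature-dimension inequality $$CD\Big(-k-2nN\varepsilon_1\overline{B}^2,\ \frac{2n}{m}-\frac{2n^2N}{\varepsilon_1}-\frac{2mn^2N^2\overline{A}^2}{m-1},\ 4,\ 2mn\Big)\quad\text{for } 0<\nu\le N;$$ that is, for every $f\in C^\infty(M)$ and every $0<\nu\le N$, $$\frac{1}{2mn}(Lf)^2+\Big(-k-2nN\varepsilon_1\overline{B}^2-\frac4\nu\Big)\Gamma(f,f)+\Big(\frac{2n}{m}-\frac{2n^2N}{\varepsilon_1}-\frac{2mn^2N^2\overline{A}^2}{m-1}\Big)\Gamma^Z(f,f)\le\Gamma_2(f,f)+\nu\,\Gamma_2^Z(f,f).$$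
   Context: A pseudohermitian $(2n+1)$-manifold $(M,J,\theta)$ is a strictly pseudoconvex CR manifold: a $(2n+1)$-dimensional orientable manifold with contact form $\theta$, contact bundle $\xi=\ker\theta$, and an integrable complex structure $J$ on $\xi$ with positive definite Levi form. $\mathbf{T}$ is the characteristic (Reeb) vector field, and $T_{1,0}M$, $T_{0,1}M$ are the $\pm i$-eigenspaces of $J$ on $\mathbb{C}\otimes\xi$. For a local frame $Z_\alpha$ of $T_{1,0}M$, $Z_{\bar\alpha}=\overline{Z_\alpha}$, with dual coframe $\{\theta,\theta^\alpha,\theta^{\bar\alpha}\}$, one has $d\theta=i h_{\alpha\bar\beta}\theta^\alpha\wedge\theta^{\bar\beta}$ with $(h_{\alpha\bar\beta})$ positive definite Hermitian. The Levi form is $\langle Z,W\rangle=-i\,d\theta(Z,\overline W)=h_{\alpha\bar\beta}Z^\alpha \overline{W^{\beta}}$ on $T_{1,0}M$, extended to $T_{0,1}M$ by conjugation. Components below are taken in frames with $h_{\alpha\bar\beta}=\delta_{\alpha\beta}$. The Tanaka–Webster (pseudohermitian) connection $\nabla$ is given by $\nabla Z_\alpha=\omega_\alpha{}^\beta\otimes Z_\beta$, $\nabla Z_{\bar\alpha}=\omega_{\bar\alpha}{}^{\bar\beta}\otimes Z_{\bar\beta}$, $\nabla \mathbf{T}=0$, where $d\theta^\beta=\theta^\alpha\wedge\omega_\alpha{}^\beta+\theta\wedge\tau^\beta$, $\tau_\alpha\wedge\theta^\alpha=0$, $\omega_\alpha{}^\beta+\omega_{\bar\beta}{}^{\bar\alpha}=0$.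 The torsion is $A_{\alpha\gamma}=A_{\gamma\alpha}$ with $\tau_\alpha=A_{\alpha\gamma}\theta^\gamma$, and $A_{\bar\alpha\bar\gamma}=\overline{A_{\alpha\gamma}}$. Indices after a comma denote covariant derivatives, so $A_{ij,\bar i}$ is a component of the covariant derivative of the torsion in direction $Z_{\bar i}$ (no summation). The curvature form has the structure $d\omega_\beta{}^\alpha-\omega_\beta{}^\gamma\wedge\omega_\gamma{}^\alpha=R_\beta{}^\alpha{}_{\rho\bar\sigma}\theta^\rho\wedge\theta^{\bar\sigma}+W_\beta{}^\alpha{}_\rho\theta^\rho\wedge\theta-W^\alpha{}_{\beta\bar\rho}\theta^{\bar\rho}\wedge\theta+i\theta_\beta\wedge\tau^\alpha-i\tau_\beta\wedge\theta^\alpha$. The pseudohermitian Ricci tensor is $R_{\alpha\bar\beta}=R_\gamma{}^\gamma{}_{\alpha\bar\beta}$, $Ric(Z,Z)=R_{\alpha\bar\beta}Z^\alpha Z^{\bar\beta}$, and $Tor(Z,Z)=i(A_{\bar\alpha\bar\rho}Z^{\bar\rho}Z^{\bar\alpha}-A_{\alpha\rho}Z^\rho Z^\alpha)$ for $Z=Z^\alpha Z_\alpha$. For a function $u$: $u_\alpha=Z_\alpha u$, $u_{\alpha\bar\beta}=Z_{\bar\beta}Z_\alpha u-\omega_\alpha{}^\gamma(Z_{\bar\beta})Z_\gamma u$, $|\nabla_b u|^2=2\sum_\alpha u_\alpha u_{\bar\alpha}$, and $\Delta_b u=\sum_\alpha(u_{\alpha\bar\alpha}+u_{\bar\alpha\alpha})$.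 Write $Z_j=\frac12(e_j-ie_{n+j})$ with real $e_1,\dots,e_{2n}$. The curvature-dimension inequality is with respect to the operator $L=2\Delta_b$ (written in the paper as $\sum_{j=1}^{2n}e_j^2$), with $d=2n$ horizontal fields $e_j$ and the single extra field $Y_1=\mathbf{T}$. Here $$\Gamma(f,g)=\sum_{j=1}^{2n}(e_jf)(e_jg)\ \ (\text{so }\Gamma(f,f)=2|\nabla_bf|^2),\qquad \Gamma^Z(f,g)=(\mathbf{T}f)(\mathbf{T}g),$$ $$\Gamma_2(f,f)=\tfrac12\big[L(\Gamma(f,f))-2\Gamma(f,Lf)\big],\qquad \Gamma_2^Z(f,f)=\tfrac12\big[L(\Gamma^Z(f,f))-2\Gamma^Z(f,Lf)\big].$$ In general $CD(\rho_1,\rho_2,\kappa,m')$ refers to the inequality $\frac1{m'}(Lf)^2+(\rho_1-\frac\kappa\nu)\Gamma(f,f)+\rho_2\Gamma^Z(f,f)\le\Gamma_2(f,f)+\nu\Gamma_2^Z(f,f)$ for all smooth $f$. *)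

(* Defs.v *)
From HB Require Import structures.
From mathcomp Require Import all_boot all_order all_algebra.
From mathcomp Require Import all_classical all_reals all_analysis.
From mathcomp Require Import complex.

Set Implicit Arguments.
Unset Strict Implicit.
Unset Printing Implicit Defensive.

Import Order.TTheory GRing.Theory Num.Theory.
Import numFieldNormedType.Exports.

Local Open Scope classical_set_scope.
Local Open Scope complex_scope.
Local Open Scope ring_scope.

(** * Smooth manifolds *)

(* [V] is meant to be open; [delta_mx 0 i] is the i-th vector of the
   canonical basis of R^d. *)
Fixpoint Ck (R : realType) (d k : nat) (V : set 'rV[R]_d)
    (g : 'rV[R]_d -> R) : Prop :=
  (forall x, V x -> {for x, continuous g}) /\
  match k with
  | 0%N => True
  | k'.+1 => forall i : 'I_d,
      (forall x, V x -> derivable g x (delta_mx 0 i)) /\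
      Ck k' V (fun x => 'D_(delta_mx 0 i) g x)
  end.

Definition Cinfty (R : realType) (d : nat) (V : set 'rV[R]_d)
    (g : 'rV[R]_d -> R) : Prop := forall k, Ck k V g.

(* [chart_inv i] is the inverse of [chart_map i] on the image of
   [chart_dom i]; the values of both maps elsewhere are irrelevant. *)
Record smooth_atlas (R : realType) (d : nat) (M : topologicalType) := SmoothAtlas {
  chart_index : Type ;
  chart_dom : chart_index -> set M ;
  chart_map : chart_index -> M -> 'rV[R]_d ;
  chart_inv : chart_index -> 'rV[R]_d -> M ;
  chart_dom_open : forall i, open (chart_dom i) ;
  chart_cover : forall p, exists i, chart_dom i p ;
  chart_img_open : forall i, open (chart_map i @` chart_dom i) ;
  chart_mapK : forall i p, chart_dom i p -> chart_inv i (chart_map i p) = p ;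
  chart_map_cont : forall i p, chart_dom i p -> {for p, continuous (chart_map i)} ;
  chart_inv_cont : forall i y, (chart_map i @` chart_dom i) y ->
    {for y, continuous (chart_inv i)} ;
  chart_transition : forall i j (k : 'I_d),
    Cinfty (chart_map i @` (chart_dom i `&` chart_dom j))
           (fun y => chart_map j (chart_inv i y) 0 k) }.

Definition closed_manifold (M : topologicalType) : Prop :=
  [/\ hausdorff_space M, @second_countable M & compact [set: M]].

(* Functions smooth on an open set [W] are represented by total functions whose
   values outside [W] are irrelevant. *)
Definition smooth_on (R : realType) (d : nat) (M : topologicalType)
    (A : smooth_atlas R d M) (W : set M) (f : M -> R) : Prop :=
  forall i : chart_index A,
    Cinfty (chart_map i @` (chart_dom i `&` W)) (fun y => f (chart_inv i y)).

Definition csmooth_on (R : realType) (d : nat) (M : topologicalType)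
    (A : smooth_atlas R d M) (W : set M) (f : M -> R[i]) : Prop :=
  smooth_on A W (fun p => complex.Re (f p)) /\
  smooth_on A W (fun p => complex.Im (f p)).

Definition csmooth_near (R : realType) (d : nat) (M : topologicalType)
    (A : smooth_atlas R d M) (p : M) (f : M -> R[i]) : Prop :=
  exists W : set M, [/\ open W, W p & csmooth_on A W f].

(** * Complexified tangent vectors, vector fields and forms *)

Definition cvec (R : realType) (M : Type) := (M -> R[i]) -> R[i].
Definition cfield (R : realType) (M : Type) := M -> cvec R M.
Definition cform (R : realType) (M : Type) := M -> cvec R M -> R[i].

(* a v + w *)
Definition vlin (R : realType) (M : Type) (a : R[i]) (v w : cvec R M) : cvec R M :=
  fun f => a * v f + w f.

Definition vzero (R : realType) (M : Type) : cvec R M := fun _ => 0.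

Definition conjv (R : realType) (M : Type) (v : cvec R M) : cvec R M :=
  fun f => (v (fun p => (f p)^*))^*.

Definition conjF (R : realType) (M : Type) (X : cfield R M) : cfield R M :=
  fun p => conjv (X p).

Definition conjform (R : realType) (M : Type) (eta : cform R M) : cform R M :=
  fun p v => (eta p (conjv v))^*.

(* C (x) T_pM as the space of C-linear derivations at [p] of germs of smooth
   complex functions.  The last clause fixes the junk value on functions that
   are not smooth near [p], so that Leibniz equality of [cvec]s is equality of
   tangent vectors. *)
Definition tangent (R : realType) (d : nat) (M : topologicalType)
    (A : smooth_atlas R d M) (p : M) (v : cvec R M) : Prop :=
  [/\ (forall (a : R[i]) f g, csmooth_near A p f -> csmooth_near A p g ->
         v (fun q => a * f q + g q) = a * v f + v g),
      (forall f g, csmooth_near A p f -> csmooth_near A p g ->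
         v (fun q => f q * g q) = f p * v g + g p * v f),
      (forall f g, csmooth_near A p f -> csmooth_near A p g ->
         (\forall q \near p, f q = g q) -> v f = v g) &
      (forall f, ~ csmooth_near A p f -> v f = 0)].

Definition vfield_on (R : realType) (d : nat) (M : topologicalType)
    (A : smooth_atlas R d M) (U : set M) (X : cfield R M) : Prop :=
  (forall p, U p -> tangent A p (X p)) /\
  (forall (W : set M) f, open W -> W `<=` U -> csmooth_on A W f ->
     csmooth_on A W (fun p => X p f)).

Definition bracket (R : realType) (d : nat) (M : topologicalType)
    (A : smooth_atlas R d M) (X Y : cfield R M) : cfield R M :=
  fun p f => if `[< csmooth_near A p f >]
             then X p (fun q => Y q f) - Y p (fun q => X q f) else 0.

Definition form_on (R : realType) (d : nat) (M : topologicalType)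
    (A : smooth_atlas R d M) (U : set M) (eta : cform R M) : Prop :=
  (forall p (a : R[i]) v w, U p -> tangent A p v -> tangent A p w ->
     eta p (vlin a v w) = a * eta p v + eta p w) /\
  (forall (W : set M) X, open W -> W `<=` U -> vfield_on A W X ->
     csmooth_on A W (fun p => eta p (X p))).

(* Two-forms are given by their values on pairs of vector fields.  No factor
   1/2 in [wedge] and [extd]: d eta(X,Y) = X eta(Y) - Y eta(X) - eta([X,Y]). *)
Definition wedge (R : realType) (M : Type) (eta zeta : cform R M)
    (X Y : cfield R M) (p : M) : R[i] :=
  eta p (X p) * zeta p (Y p) - eta p (Y p) * zeta p (X p).

Definition extd (R : realType) (d : nat) (M : topologicalType)
    (A : smooth_atlas R d M) (eta : cform R M) (X Y : cfield R M) (p : M) : R[i] :=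
  X p (fun q => eta q (Y q)) - Y p (fun q => eta q (X q))
  - eta p (bracket A X Y p).

(** * Pseudohermitian structures *)

Definition in_xi (R : realType) (d : nat) (M : topologicalType)
    (A : smooth_atlas R d M) (theta : cform R M) (p : M) (v : cvec R M) : Prop :=
  tangent A p v /\ theta p v = 0.

Definition xi_section (R : realType) (d : nat) (M : topologicalType)
    (A : smooth_atlas R d M) (theta : cform R M) (W : set M) (X : cfield R M) :=
  vfield_on A W X /\ (forall p, W p -> in_xi A theta p (X p)).

(* The last clause says that d theta is nondegenerate on ker theta. *)
Definition contact_form (R : realType) (d : nat) (M : topologicalType)
    (A : smooth_atlas R d M) (theta : cform R M) : Prop :=
  [/\ form_on A [set: M] theta,
      (forall p v, tangent A p v -> theta p (conjv v) = (theta p v)^*),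
      (forall p, exists2 v, tangent A p v & theta p v != 0) &
      (forall (W : set M) X p, open W -> xi_section A theta W X -> W p ->
         (forall (W' : set M) Y, open W' -> W' p -> W' `<=` W ->
            xi_section A theta W' Y -> extd A theta X Y p = 0) ->
         X p = @vzero R M)].

(* [J] is extended C-linearly to C (x) xi. *)
Definition almost_complex (R : realType) (d : nat) (M : topologicalType)
    (A : smooth_atlas R d M) (theta : cform R M)
    (J : M -> cvec R M -> cvec R M) : Prop :=
  [/\ (forall p v, in_xi A theta p v -> in_xi A theta p (J p v)),
      (forall p a v w, in_xi A theta p v -> in_xi A theta p w ->
         J p (vlin a v w) = vlin a (J p v) (J p w)),
      (forall p v, in_xi A theta p v -> J p (conjv v) = conjv (J p v)),
      (forall p v, in_xi A theta p v -> J p (J p v) = vlin (-1) v (@vzero R M)) &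
      (forall (W : set M) X, open W -> xi_section A theta W X ->
         vfield_on A W (fun p => J p (X p)))].

Definition in_T10 (R : realType) (d : nat) (M : topologicalType)
    (A : smooth_atlas R d M) (theta : cform R M)
    (J : M -> cvec R M -> cvec R M) (p : M) (v : cvec R M) : Prop :=
  in_xi A theta p v /\ J p v = vlin 'i v (@vzero R M).

Definition T10_section (R : realType) (d : nat) (M : topologicalType)
    (A : smooth_atlas R d M) (theta : cform R M)
    (J : M -> cvec R M -> cvec R M) (W : set M) (X : cfield R M) : Prop :=
  vfield_on A W X /\ (forall p, W p -> in_T10 A theta J p (X p)).

Definition levi (R : realType) (d : nat) (M : topologicalType)
    (A : smooth_atlas R d M) (theta : cform R M) (Z W : cfield R M) (p : M) : R[i] :=
  - 'i * extd A theta Z (conjF W) p.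

(* Orientability is automatic: theta /\ (d theta)^n is a volume form. In the
   order of R[i], [0 < z] means that z is real and positive. *)
Record pseudohermitian (R : realType) (n : nat) (M : topologicalType) :=
  Pseudohermitian {
  ph_atlas :> smooth_atlas R n.*2.+1 M ;
  ph_theta : cform R M ;
  ph_J : M -> cvec R M -> cvec R M ;
  ph_contact : contact_form ph_atlas ph_theta ;
  ph_almost_complex : almost_complex ph_atlas ph_theta ph_J ;
  ph_integrable : forall (W : set M) X Y, open W ->
    T10_section ph_atlas ph_theta ph_J W X ->
    T10_section ph_atlas ph_theta ph_J W Y ->
    T10_section ph_atlas ph_theta ph_J W (bracket ph_atlas X Y) ;
  ph_levi_pos : forall (W : set M) Z p, open W ->
    T10_section ph_atlas ph_theta ph_J W Z -> W p -> Z p <> @vzero R M ->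
    0 < levi ph_atlas ph_theta Z Z p }.

Definition is_reeb (R : realType) (n : nat) (M : topologicalType)
    (P : pseudohermitian R n M) (T : cfield R M) : Prop :=
  [/\ vfield_on P [set: M] T,
      (forall p, conjv (T p) = T p),
      (forall p, ph_theta P p (T p) = 1) &
      (forall (W : set M) X p, open W -> vfield_on P W X -> W p ->
         extd P (ph_theta P) T X p = 0)].

(** * The Tanaka-Webster connection in local unitary frames *)

(* Local frame [Z_a] of T_{1,0}, dual coframe [theta^a], connection forms
   [fr_om a b] = omega_a^b and torsion forms [fr_tau b] = tau^b. *)
Record tw_data (R : realType) (n : nat) (M : topologicalType) := TWData {
  fr_dom : set M ;
  fr_Z : 'I_n -> cfield R M ;
  fr_co : 'I_n -> cform R M ;
  fr_om : 'I_n -> 'I_n -> cform R M ;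
  fr_tau : 'I_n -> cform R M }.

(* tau_a = h_{a bbar} tau^bbar = conjugate of tau^a, as h is the identity *)
Definition tau_low (R : realType) (n : nat) (M : topologicalType)
    (F : tw_data R n M) (a : 'I_n) : cform R M := conjform (fr_tau F a).

(* By Webster's theorem, every local unitary frame has exactly one completion to
   a solution (theta^a, omega, tau), and unitary frames exist near every point. *)
Record tw_frame (R : realType) (n : nat) (M : topologicalType)
    (P : pseudohermitian R n M) (T : cfield R M) (F : tw_data R n M) : Prop := {
  tw_open : open (fr_dom F) ;
  tw_section : forall a, T10_section P (ph_theta P) (ph_J P) (fr_dom F) (fr_Z F a) ;
  tw_span : forall p v, fr_dom F p -> in_T10 P (ph_theta P) (ph_J P) p v ->
    exists c : 'I_n -> R[i], v = (fun f => \sum_a c a * fr_Z F a p f) ;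
  tw_unitary : forall a b p, fr_dom F p ->
    levi P (ph_theta P) (fr_Z F a) (fr_Z F b) p = (a == b)%:R ;
  tw_co_form : forall a, form_on P (fr_dom F) (fr_co F a) ;
  tw_co_Z : forall a b p, fr_dom F p -> fr_co F a p (fr_Z F b p) = (a == b)%:R ;
  tw_co_Zbar : forall a b p, fr_dom F p -> fr_co F a p (conjv (fr_Z F b p)) = 0 ;
  tw_co_T : forall a p, fr_dom F p -> fr_co F a p (T p) = 0 ;
  tw_om_form : forall a b, form_on P (fr_dom F) (fr_om F a b) ;
  tw_tau_form : forall a, form_on P (fr_dom F) (fr_tau F a) ;
  tw_structure : forall b (W : set M) X Y p, open W -> W `<=` fr_dom F ->
    vfield_on P W X -> vfield_on P W Y -> W p ->
    extd P (fr_co F b) X Y p =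
      \sum_a wedge (fr_co F a) (fr_om F a b) X Y p
      + wedge (ph_theta P) (fr_tau F b) X Y p ;
  tw_torsion : forall (W : set M) X Y p, open W -> W `<=` fr_dom F ->
    vfield_on P W X -> vfield_on P W Y -> W p ->
    \sum_a wedge (tau_low F a) (fr_co F a) X Y p = 0 ;
  tw_skew : forall a b p v, fr_dom F p -> tangent P p v ->
    fr_om F a b p v + conjform (fr_om F b a) p v = 0 }.

(* A_{ac}, from tau_a = A_{ac} theta^c *)
Definition tors (R : realType) (n : nat) (M : topologicalType)
    (F : tw_data R n M) (a c : 'I_n) (p : M) : R[i] :=
  tau_low F a p (fr_Z F c p).

(* A_{ac,sbar} *)
Definition tors_cov (R : realType) (n : nat) (M : topologicalType)
    (F : tw_data R n M) (a c s : 'I_n) (p : M) : R[i] :=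
  let Zs := conjv (fr_Z F s p) in
  Zs (tors F a c) - \sum_b fr_om F a b p Zs * tors F b c p
                  - \sum_b fr_om F c b p Zs * tors F a b p.

(* R_b^a_{r sbar}.  It is the value of the curvature form on (Z_r, Z_sbar): the
   other terms of the structure equation of the curvature either contain theta
   or are of type (0,2) or (2,0), since tau_a = A_{ac} theta^c. *)
Definition tw_curv (R : realType) (n : nat) (M : topologicalType)
    (P : pseudohermitian R n M) (F : tw_data R n M) (b a r s : 'I_n) (p : M) : R[i] :=
  let X := fr_Z F r in
  let Y := conjF (fr_Z F s) in
  extd P (fr_om F b a) X Y p - \sum_c wedge (fr_om F b c) (fr_om F c a) X Y p.

(* R_{a bbar} *)
Definition tw_ricci (R : realType) (n : nat) (M : topologicalType)
    (P : pseudohermitian R n M) (F : tw_data R n M) (a b : 'I_n) (p : M) : R[i] :=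
  \sum_c tw_curv P F c c a b p.

Definition Ric (R : realType) (n : nat) (M : topologicalType)
    (P : pseudohermitian R n M) (F : tw_data R n M) (Z : cfield R M) (p : M) : R[i] :=
  \sum_a \sum_b tw_ricci P F a b p * fr_co F a p (Z p) * (fr_co F b p (Z p))^*.

Definition Tor (R : realType) (n : nat) (M : topologicalType)
    (F : tw_data R n M) (Z : cfield R M) (p : M) : R[i] :=
  let z a := fr_co F a p (Z p) in
  'i * \sum_a \sum_r ((tors F a r p)^* * (z r)^* * (z a)^* - tors F a r p * z r * z a).

(** * Operators on real functions *)

(* [Re] below only casts: the complex numbers to which it is applied are real
   when the vector is real, resp. are of the form z + conjugate of z. *)
Definition act (R : realType) (M : Type) (X : cfield R M) (f : M -> R) (p : M) : R :=
  complex.Re (X p (fun q => (f q)%:C)).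

(* the real fields e_1, ..., e_{2n} with Z_j = (e_j - i e_{n+j})/2 *)
Definition real_frame (R : realType) (n : nat) (M : topologicalType)
    (F : tw_data R n M) (j : 'I_(n + n)) : cfield R M :=
  match fintype.split j with
  | inl a => fun p f => fr_Z F a p f + conjv (fr_Z F a p) f
  | inr a => fun p f => 'i * (fr_Z F a p f - conjv (fr_Z F a p) f)
  end.

(* u_{a bbar} *)
Definition hess_zzbar (R : realType) (n : nat) (M : topologicalType)
    (F : tw_data R n M) (u : M -> R[i]) (a b : 'I_n) (p : M) : R[i] :=
  let Zb := conjv (fr_Z F b p) in
  Zb (fun q => fr_Z F a q u) - \sum_c fr_om F a c p Zb * fr_Z F c p u.

(* u_{abar b} *)
Definition hess_zbarz (R : realType) (n : nat) (M : topologicalType)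
    (F : tw_data R n M) (u : M -> R[i]) (a b : 'I_n) (p : M) : R[i] :=
  let Zb := fr_Z F b p in
  Zb (fun q => conjv (fr_Z F a q) u)
  - \sum_c conjform (fr_om F a c) p Zb * conjv (fr_Z F c p) u.

Definition sublaplacian (R : realType) (n : nat) (M : topologicalType)
    (F : tw_data R n M) (u : M -> R) (p : M) : R :=
  let uC q := (u q)%:C in
  complex.Re (\sum_a (hess_zzbar F uC a a p + hess_zbarz F uC a a p)).

Definition cd_L (R : realType) (n : nat) (M : topologicalType)
    (F : tw_data R n M) (u : M -> R) (p : M) : R := 2 * sublaplacian F u p.

Definition cd_Gamma (R : realType) (n : nat) (M : topologicalType)
    (F : tw_data R n M) (f g : M -> R) (p : M) : R :=
  \sum_(j < n + n) act (real_frame F j) f p * act (real_frame F j) g p.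

Definition cd_GammaZ (R : realType) (M : Type)
    (T : cfield R M) (f g : M -> R) (p : M) : R := act T f p * act T g p.

Definition Gamma2 (R : realType) (M : Type) (L : (M -> R) -> M -> R)
    (G : (M -> R) -> (M -> R) -> M -> R) (f : M -> R) (p : M) : R :=
  2^-1 * (L (G f f) p - 2 * G f (L f) p).

(* CD(rho1, rho2, kappa, m') for 0 < nu <= N, on the domain of the frame [F] in
   which L and Gamma are expressed, for f in C^oo(M) *)
Definition CD_on (R : realType) (n : nat) (M : topologicalType)
    (P : pseudohermitian R n M) (T : cfield R M) (F : tw_data R n M)
    (rho1 rho2 kappa m' N : R) : Prop :=
  let L := @cd_L R n M F in
  let G := @cd_Gamma R n M F in
  let GZ := cd_GammaZ T in
  forall f : M -> R, smooth_on P [set: M] f ->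
  forall nu : R, 0 < nu -> nu <= N ->
  forall p : M, fr_dom F p ->
    m'^-1 * (L f p) ^+ 2 + (rho1 - kappa / nu) * G f f p + rho2 * GZ f f p
    <= Gamma2 L G f p + nu * Gamma2 L GZ f p.

(* Main.v *)
(* Write f_a = Z_a f and f_0 = T f, with covariant derivatives in a unitary frame,
   so that Gamma(f,f) = 4 sum |f_a|^2.  The first Bianchi identity (d d theta^b = 0)
   gives the symmetries of the curvature and its torsion components; commuting
   covariant derivatives then yields the CR Bochner formula
     Gamma_2(f,f) = 8 sum (|f_ab|^2 + |f_{a bbar}|^2) + 4 (2 Ric - (n-2) Tor)(grad f)
                    + 8 i sum (f_abar f_{0a} - f_a f_{0abar})
   and, from the commutator of the sublaplacian with T,
     Gamma_2^Z(f,f) = 4 sum |f_{0a}|^2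
                    + 8 f_0 Re sum (A_ac f_{abar cbar} + A_{ac,cbar} f_abar).
   Completing squares: the terms f_abar f_{0a} go into nu |f_{0a}|^2 at the price of
   (4/nu) Gamma(f,f); the terms nu f_0 A_ac f_{abar cbar} go into the fraction
   (m-1)/m of |f_ac|^2; the terms with the divergence of A are split with weight
   eps1.  The mixed Hessian gives the rest: the diagonal entry f_{a abar} has
   imaginary part f_0 / 2, and the real parts add up to half the sublaplacian. *)

Require Import Defs.
From HB Require Import structures.
From mathcomp Require Import all_boot all_order all_algebra.
From mathcomp Require Import all_classical all_reals all_analysis.
From mathcomp Require Import complex ring lra.
Import Order.TTheory GRing.Theory Num.Theory.
Import numFieldNormedType.Exports.
Set Implicit Arguments.
Unset Strict Implicit.
Unset Printing Implicit Defensive.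
Local Open Scope classical_set_scope.
Local Open Scope complex_scope.
Local Open Scope ring_scope.

(** * Smooth functions in charts *)

(** The formulas above are polynomial identities between iterated derivatives, whereas vector fields
    here are functionals with conventional values on non-smooth functions. Algebra is therefore
    separated from analysis: [crFrame] axiomatizes a ring of functions with derivations, a
    conjugation and the structure equations, and all commutation formulas are derived there. The
    manifold provides the instance [frame_of], whose ring consists of functions smooth on the frame
    domain and 0 outside, so that equality in the ring is equality on the domain. Evaluation at a
    point is a ring morphism to [R[i]], and inequalities appear only after it. The coefficient n - 2
    of the torsion is (n - 1) - 1: the trace of the (2,0) curvature, minus the torsion paid for
    exchanging f_{a0} with f_{0a}. The squares are completed with the given nu; the constants of the
    statement, written with N, follow from nu <= N. The hypothesis on Ric and Tor is tested on
    sections, so the gradient at the point is extended with constant coefficients in the frame. *)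

Lemma near_eq_continuous (T U : topologicalType) (g h : T -> U) (x : T) :
  (\near x, g x = h x) -> {for x, continuous g} -> {for x, continuous h}.
Proof.
move=> gh cg; rewrite /prop_for /continuous_at -(nbhs_singleton gh).
by apply: cvg_trans cg; exact: (near_eq_cvg gh).
Qed.

Lemma Ck_subset (R : realType) (d k : nat) (V V' : set 'rV[R]_d) g :
  V' `<=` V -> Ck k V g -> Ck k V' g.
Proof.
move=> sV; elim: k g => [|k IH] g [cg dg]; split=> //.
- by move=> x /sV; exact: cg.
- by move=> x /sV; exact: cg.
- move=> i; have [dgi ck] := dg i; split; last exact: IH.
  by move=> x /sV; exact: dgi.
Qed.

(** Openness of [V] turns equality on [V] into equality near each of its points, which is what
    continuity and directional derivatives depend on. *)
Lemma Ck_eq (R : realType) (d k : nat) (V : set 'rV[R]_d) g h :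
  open V -> (forall x, V x -> g x = h x) -> Ck k V g -> Ck k V h.
Proof.
move=> oV gh.
have nx (g' h' : 'rV[R]_d -> R) : (forall y, V y -> g' y = h' y) ->
    forall x, V x -> \near x, g' x = h' x.
  by move=> gh' x Vx; apply: filterS (open_nbhs_nbhs (conj oV Vx)) => y /gh'.
elim: k g h gh => [|k IH] g h gh [cg dg]; split=> //.
- by move=> x Vx; apply: near_eq_continuous (cg _ Vx); exact: nx.
- by move=> x Vx; apply: near_eq_continuous (cg _ Vx); exact: nx.
move=> i; have [dgi ck] := dg i; split=> [x Vx|].
  by apply: near_eq_derivable (dgi _ Vx); exact: nx.
by apply: IH ck => x Vx; apply: near_eq_derive; exact: nx.
Qed.

(** The product rule in [CkM] multiplies a derivative of class [k] by an undifferentiated factor of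
    class [k.+1], which has to be brought down to the same class. *)
Lemma CkW (R : realType) (d k : nat) (V : set 'rV[R]_d) g :
  Ck k.+1 V g -> Ck k V g.
Proof.
elim: k g => [|k IH] g [cg dg]; split=> // i.
by have [dgi ck] := dg i; split=> //; exact: IH.
Qed.

Lemma Ck_cst (R : realType) (d k : nat) (V : set 'rV[R]_d) (c : R) :
  Ck k V (fun=> c).
Proof.
elim: k c => [|k IH] c; (split; first by move=> x _; exact: cst_continuous) => //.
move=> i; split; first by move=> x _; exact: derivable_cst.
rewrite (_ : (fun x : 'rV[R]_d => _) = (fun=> 0 : R)); last first.
  by apply: funext => x; rewrite derive_cst.
exact: (IH (0 : R)).
Qed.

Lemma CkD (R : realType) (d k : nat) (V : set 'rV[R]_d) g h :
  open V -> Ck k V g -> Ck k V h -> Ck k V (fun x => g x + h x).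
Proof.
move=> oV; elim: k g h => [|k IH] g h [cg dg] [ch dh]; split=> //.
- by move=> x Vx; exact: (cvgD (cg _ Vx) (ch _ Vx)).
- by move=> x Vx; exact: (cvgD (cg _ Vx) (ch _ Vx)).
- move=> i; have [dgi ckg] := dg i; have [dhi ckh] := dh i; split.
    by move=> x Vx; apply: derivableD; [exact: dgi|exact: dhi].
  apply: (Ck_eq oV _ (IH _ _ ckg ckh)) => x Vx.
  by rewrite -deriveD //; [exact: dgi|exact: dhi].
Qed.

Lemma CkM (R : realType) (d k : nat) (V : set 'rV[R]_d) g h :
  open V -> Ck k V g -> Ck k V h -> Ck k V (fun x => g x * h x).
Proof.
move=> oV; elim: k g h => [|k IH] g h Cg Ch; split=> //.
- by move=> x Vx; exact: (cvgM (Cg.1 _ Vx) (Ch.1 _ Vx)).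
- by move=> x Vx; exact: (cvgM (Cg.1 _ Vx) (Ch.1 _ Vx)).
- move=> i; have [dgi ckg] := Cg.2 i; have [dhi ckh] := Ch.2 i; split.
    by move=> x Vx; apply: derivableM; [exact: dgi|exact: dhi].
  apply: (Ck_eq oV _ (CkD oV (IH _ _ (CkW Cg) ckh) (IH _ _ (CkW Ch) ckg))) => x Vx.
  by rewrite (deriveM (dgi _ Vx) (dhi _ Vx)).
Qed.

Section ComplexFunctions.
Variables (R : realType) (d : nat) (M : topologicalType) (A : smooth_atlas R d M).
Implicit Types (W : set M) (f g : M -> R[i]).

(** Inside the open image of the chart, this set is the preimage of [W] under the continuous inverse
    chart. *)
Lemma chart_img_openI (W : set M) (i : chart_index A) : open W ->
  open (chart_map i @` (chart_dom i `&` W)).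
Proof.
move=> oW; rewrite openE => y [p [Dp Wp] <-].
have Vp : (chart_map i @` chart_dom i) (chart_map i p) by exists p.
have nV := open_nbhs_nbhs (conj (@chart_img_open _ _ _ A i) Vp).
have nW : nbhs (chart_inv i (chart_map i p)) W.
  by rewrite chart_mapK //; exact: open_nbhs_nbhs.
apply: filterS2 nV (chart_inv_cont Vp nW) => z [q Dq <-] Wq.
by exists q => //; split=> //; rewrite -(chart_mapK Dq).
Qed.

Lemma smooth_onS W W' (f : M -> R) :
  W' `<=` W -> smooth_on A W f -> smooth_on A W' f.
Proof.
move=> sW sf i k; apply: Ck_subset (sf i k).
by apply: image_subset => p [Dp Wp]; split=> //; exact: sW.
Qed.

Lemma smooth_on_eq W (f g : M -> R) : open W ->
  (forall p, W p -> f p = g p) -> smooth_on A W f -> smooth_on A W g.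
Proof.
move=> oW fg sf i k; apply: Ck_eq (sf i k); first exact: chart_img_openI.
by move=> x [p [Dp Wp] <-]; rewrite chart_mapK // fg.
Qed.

Lemma smooth_on_cst W (c : R) : smooth_on A W (fun=> c).
Proof. by move=> i k; exact: Ck_cst. Qed.

Lemma smooth_onD W (f g : M -> R) : open W ->
  smooth_on A W f -> smooth_on A W g -> smooth_on A W (fun p => f p + g p).
Proof. by move=> oW sf sg i k; exact: (CkD (chart_img_openI oW) (sf i k) (sg i k)). Qed.

Lemma smooth_onM W (f g : M -> R) : open W ->
  smooth_on A W f -> smooth_on A W g -> smooth_on A W (fun p => f p * g p).
Proof. by move=> oW sf sg i k; exact: (CkM (chart_img_openI oW) (sf i k) (sg i k)). Qed.

Lemma smooth_onN W (f : M -> R) : open W ->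
  smooth_on A W f -> smooth_on A W (fun p => - f p).
Proof.
move=> oW sf; apply: (smooth_on_eq oW _ (smooth_onM oW (smooth_on_cst W (-1)) sf)).
by move=> p _; rewrite mulN1r.
Qed.

Lemma csmooth_onS W W' f : W' `<=` W -> csmooth_on A W f -> csmooth_on A W' f.
Proof. by move=> sW [s1 s2]; split; exact: (smooth_onS sW). Qed.

Lemma csmooth_on_eq W f g : open W ->
  (forall p, W p -> f p = g p) -> csmooth_on A W f -> csmooth_on A W g.
Proof. by move=> oW fg [s1 s2]; split; [move: s1|move: s2]; apply: smooth_on_eq => // p /fg ->. Qed.

Lemma csmooth_on_cst W (c : R[i]) : csmooth_on A W (fun=> c).
Proof. by split; exact: smooth_on_cst. Qed.

Lemma csmooth_on_real W (f : M -> R) : smooth_on A W f -> csmooth_on A W (fun p => (f p)%:C).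
Proof. by move=> sf; split=> //; exact: smooth_on_cst. Qed.

Lemma csmooth_onD W f g : open W ->
  csmooth_on A W f -> csmooth_on A W g -> csmooth_on A W (fun p => f p + g p).
Proof.
move=> oW [f1 f2] [g1 g2]; split.
- apply: (smooth_on_eq oW _ (smooth_onD oW f1 g1)) => p _.
  by case: (f p) (g p) => a b [].
- apply: (smooth_on_eq oW _ (smooth_onD oW f2 g2)) => p _.
  by case: (f p) (g p) => a b [].
Qed.

Lemma csmooth_onM W f g : open W ->
  csmooth_on A W f -> csmooth_on A W g -> csmooth_on A W (fun p => f p * g p).
Proof.
move=> oW [f1 f2] [g1 g2]; split.
- apply: (smooth_on_eq oW _ (smooth_onD oW (smooth_onM oW f1 g1)
    (smooth_onN oW (smooth_onM oW f2 g2)))) => p _.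
  by case: (f p) (g p) => a b [].
- apply: (smooth_on_eq oW _ (smooth_onD oW (smooth_onM oW f1 g2)
    (smooth_onM oW f2 g1))) => p _.
  by case: (f p) (g p) => a b [].
Qed.

Lemma csmooth_onN W f : open W ->
  csmooth_on A W f -> csmooth_on A W (fun p => - f p).
Proof.
move=> oW sf; apply: (csmooth_on_eq oW _ (csmooth_onM oW (csmooth_on_cst W (-1)) sf)).
by move=> p _; rewrite mulN1r.
Qed.

Lemma conj_complexE (z : R[i]) : z^* = complex.Re z -i* complex.Im z.
Proof. by case: z. Qed.

Lemma csmooth_on_conj W f : open W ->
  csmooth_on A W f -> csmooth_on A W (fun p => (f p)^*).
Proof.
move=> oW [f1 f2]; split.
  by apply: smooth_on_eq f1 => // p _; rewrite conj_complexE.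
by apply: (smooth_on_eq oW _ (smooth_onN oW f2)) => p _; rewrite conj_complexE.
Qed.

End ComplexFunctions.

(** * Tangent vectors, vector fields and brackets *)

Section TangentVectors.
Variables (R : realType) (d : nat) (M : topologicalType) (A : smooth_atlas R d M).
Implicit Types (p : M) (f g : M -> R[i]) (v w : cvec R M).

Lemma csmooth_near_cst p (c : R[i]) : csmooth_near A p (fun=> c).
Proof.
by exists [set: M]; split=> //; [exact: openT|exact: csmooth_on_cst].
Qed.

Lemma csmooth_nearD p f g : csmooth_near A p f -> csmooth_near A p g ->
  csmooth_near A p (fun q => f q + g q).
Proof.
move=> [V [oV Vp sf]] [W [oW Wp sg]]; exists (V `&` W).
have oVW : open (V `&` W) by exact: openI.
split=> //; apply: csmooth_onD => //.
  by apply: csmooth_onS sf; exact: subIsetl.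
by apply: csmooth_onS sg; exact: subIsetr.
Qed.

Lemma csmooth_nearM p f g : csmooth_near A p f -> csmooth_near A p g ->
  csmooth_near A p (fun q => f q * g q).
Proof.
move=> [V [oV Vp sf]] [W [oW Wp sg]]; exists (V `&` W).
have oVW : open (V `&` W) by exact: openI.
split=> //; apply: csmooth_onM => //.
  by apply: csmooth_onS sf; exact: subIsetl.
by apply: csmooth_onS sg; exact: subIsetr.
Qed.

Lemma csmooth_near_conj p f : csmooth_near A p f ->
  csmooth_near A p (fun q => (f q)^*).
Proof. by move=> [V [oV Vp sf]]; exists V; split=> //; exact: csmooth_on_conj. Qed.

(** Contraposed: conjugation keeps non-smooth functions non-smooth, so the conventional value 0 in
    [tangent] and in [bracket] survives conjugation. *)
Lemma csmooth_near_conjE p f :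
  csmooth_near A p (fun q => (f q)^*) -> csmooth_near A p f.
Proof.
move=> /csmooth_near_conj; congr csmooth_near.
by apply: funext => q; rewrite conjCK.
Qed.

Lemma csmooth_nearZ p (a : R[i]) f g : csmooth_near A p f -> csmooth_near A p g ->
  csmooth_near A p (fun q => a * f q + g q).
Proof.
by move=> sf sg; apply: csmooth_nearD => //; apply: csmooth_nearM => //; exact: csmooth_near_cst.
Qed.

Lemma csmooth_near_eq p f g : (\forall q \near p, f q = g q) ->
  csmooth_near A p f -> csmooth_near A p g.
Proof.
move=> nfg [W [oW Wp sf]].
have [V [oV Vp] fg] : exists2 V, open_nbhs p V & V `<=` [set q | f q = g q].
  by move: (nfg : nbhs p [set q | f q = g q]); rewrite nbhsE.
have oVW : open (V `&` W) by exact: openI.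
exists (V `&` W); split=> //; apply: (csmooth_on_eq oVW _ (csmooth_onS _ sf)).
  by move=> q [Vq _]; exact: fg.
exact: subIsetr.
Qed.

Lemma tangent0 p v : tangent A p v -> v (fun=> 0) = 0.
Proof.
move=> [lin _ _ _]; have s0 := csmooth_near_cst p 0.
have := lin 1 _ _ s0 s0.
rewrite (_ : (fun _ => 1 * 0 + 0) = (fun=> 0 : R[i])); last first.
  by apply: funext => q; rewrite mulr0 addr0.
by rewrite mul1r => /(canLR (addrK _)); rewrite subrr.
Qed.

Lemma tangentD p v f g : tangent A p v -> csmooth_near A p f -> csmooth_near A p g ->
  v (fun q => f q + g q) = v f + v g.
Proof.
move=> [lin _ _ _] sf sg; have := lin 1 _ _ sf sg; rewrite mul1r => <-.
by congr v; apply: funext => q; rewrite mul1r.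
Qed.

Lemma tangentZ p v (a : R[i]) f : tangent A p v -> csmooth_near A p f ->
  v (fun q => a * f q) = a * v f.
Proof.
move=> tv sf; have [lin _ _ _] := tv.
have := lin a _ _ sf (csmooth_near_cst p 0); rewrite (tangent0 tv) addr0 => <-.
by congr v; apply: funext => q; rewrite addr0.
Qed.

Lemma tangentB p v f g : tangent A p v -> csmooth_near A p f -> csmooth_near A p g ->
  v (fun q => f q - g q) = v f - v g.
Proof.
move=> tv sf sg; have [lin _ _ _] := tv; have := lin (-1) _ _ sg sf.
rewrite mulN1r addrC => <-.
by congr v; apply: funext => q; rewrite mulN1r addrC.
Qed.

Lemma tangent_cst p v (c : R[i]) : tangent A p v -> v (fun=> c) = 0.
Proof.
move=> tv; have [_ leib _ _] := tv; have s1 := csmooth_near_cst p 1.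
have v1 : v (fun=> 1) = 0.
  have := leib _ _ s1 s1.
  rewrite (_ : (fun _ => 1 * 1) = (fun=> 1 : R[i])); last first.
    by apply: funext => q; rewrite mulr1.
  by rewrite mul1r => /(canLR (addrK _)); rewrite subrr.
have := tangentZ c tv s1; rewrite v1 mulr0 => <-.
by congr v; apply: funext => q; rewrite mulr1.
Qed.

Lemma tangent_vzero p : tangent A p (@vzero R M).
Proof.
by split=> *; rewrite /vzero ?mulr0 ?addr0.
Qed.

Lemma tangent_vlin p (a : R[i]) v w :
  tangent A p v -> tangent A p w -> tangent A p (vlin a v w).
Proof.
move=> [l1 m1 e1 z1] [l2 m2 e2 z2]; split; rewrite /vlin.
- by move=> b f g sf sg; rewrite l1 // l2 //; ring.
- by move=> f g sf sg; rewrite m1 // m2 //; ring.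
- by move=> f g sf sg fg; rewrite (e1 _ _ sf sg fg) (e2 _ _ sf sg fg).
- by move=> f sf; rewrite z1 // z2 // mulr0 addr0.
Qed.

Lemma tangent_conj p v : tangent A p v -> tangent A p (conjv v).
Proof.
move=> [l1 m1 e1 z1]; split; rewrite /conjv.
- move=> b f g sf sg.
  rewrite (_ : (fun _ => _) = (fun q => b^* * (f q)^* + (g q)^*)); last first.
    by apply: funext => q; rewrite rmorphD rmorphM.
  by rewrite l1 ?rmorphD /= ?rmorphM /= ?conjCK //; exact: csmooth_near_conj.
- move=> f g sf sg.
  rewrite (_ : (fun _ => _) = (fun q => (f q)^* * (g q)^*)); last first.
    by apply: funext => q; rewrite rmorphM.
  by rewrite m1 ?rmorphD ?rmorphM /= ?rmorphM /= ?conjCK //; exact: csmooth_near_conj.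
- move=> f g sf sg fg; rewrite (e1 _ (fun q => (g q)^*)) //; try exact: csmooth_near_conj.
  by apply: filterS fg => q ->.
- move=> f sf; rewrite z1 ?rmorph0 // => /csmooth_near_conjE; exact: sf.
Qed.

Lemma conjvK : involutive (@conjv R M).
Proof.
move=> v; apply: funext => f; rewrite /conjv conjCK; congr v.
by apply: funext => q; rewrite conjCK.
Qed.

Lemma vfield_on_conj (U : set M) X : vfield_on A U X -> vfield_on A U (conjF X).
Proof.
move=> [tX sX]; split=> [p Up|W f oW WU sf]; first exact/tangent_conj/tX.
by apply: csmooth_on_conj => //; apply: sX => //; exact: csmooth_on_conj.
Qed.

Lemma vfield_on_vlin (U : set M) (a : R[i]) X Y : vfield_on A U X -> vfield_on A U Y ->
  vfield_on A U (fun p => vlin a (X p) (Y p)).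
Proof.
move=> [tX sX] [tY sY]; split=> [p Up|W f oW WU sf].
  by apply: tangent_vlin; [exact: tX|exact: tY].
apply: csmooth_onD => //; last exact: sY.
by apply: csmooth_onM => //; [exact: csmooth_on_cst|exact: sX].
Qed.

Lemma vfield_onS (U W : set M) X : W `<=` U -> vfield_on A U X -> vfield_on A W X.
Proof.
move=> sW [tX sX]; split=> [p /sW|W' f oW WU sf]; first exact: tX.
by apply: sX => //; exact: subset_trans sW.
Qed.

Lemma form_onS (U W : set M) eta : W `<=` U -> form_on A U eta -> form_on A W eta.
Proof.
move=> sW [lin sm]; split=> [p a v w /sW|W' X oW' sW' vX]; first exact: lin.
by apply: sm => //; exact: subset_trans sW.
Qed.

Lemma form_on_conj (U : set M) eta : form_on A U eta -> form_on A U (conjform eta).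
Proof.
move=> [lin sm]; split=> [p a v w Up tv tw|W X oW sW vX]; rewrite /conjform.
  have -> : conjv (vlin a v w) = vlin a^* (conjv v) (conjv w).
    by apply: funext => f; rewrite /conjv /vlin rmorphD rmorphM.
  by rewrite lin ?rmorphD /= ?rmorphM /= ?conjCK //; exact: tangent_conj.
by apply: csmooth_on_conj => //; apply: sm => //; exact: vfield_on_conj.
Qed.

End TangentVectors.

Section Bracket.
Variables (R : realType) (d : nat) (M : topologicalType) (A : smooth_atlas R d M).
Variables (U : set M) (oU : open U).
Implicit Types (p : M) (f g : M -> R[i]) (X Y Z : cfield R M).

Lemma csmooth_near_vfield X p f : vfield_on A U X -> U p ->
  csmooth_near A p f -> csmooth_near A p (fun q => X q f).
Proof.
move=> [tX sX] Up [W [oW Wp sf]].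
have oUW : open (U `&` W) by exact: openI.
exists (U `&` W); split=> //; apply: (sX _ _ oUW (@subIsetl _ _ _)).
by apply: csmooth_onS sf; exact: subIsetr.
Qed.

Lemma bracketE X Y p f : csmooth_near A p f ->
  bracket A X Y p f = X p (fun q => Y q f) - Y p (fun q => X q f).
Proof. by move=> sf; rewrite /bracket asboolT. Qed.

Lemma near_csmooth p f : csmooth_near A p f -> \forall q \near p, csmooth_near A q f.
Proof.
move=> [W [oW Wp sf]]; apply: filterS (open_nbhs_nbhs (conj oW Wp)) => q Wq.
by exists W.
Qed.

Lemma near_U p : U p -> \forall q \near p, U q.
Proof. by move=> Up; exact: open_nbhs_nbhs. Qed.

(** Equality near [p] is also equality near every [q] close to [p] ([near_join]), so functions with
    the same germ have derivatives with the same germ. This is why a bracket only sees germs. *)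
Lemma near_vfield_eq X p f g : vfield_on A U X -> U p ->
  csmooth_near A p f -> csmooth_near A p g -> (\forall q \near p, f q = g q) ->
  \forall q \near p, X q f = X q g.
Proof.
move=> [tX sX] Up sf sg /near_join fg.
apply: filterS2 (filterI (near_U Up) (near_csmooth sf)) (filterI (near_csmooth sg) fg).
by move=> q [Uq sfq] [sgq fgq]; have [_ _ e _] := tX q Uq; exact: e.
Qed.

Lemma csmooth_near_bracket X Y p f : vfield_on A U X -> vfield_on A U Y -> U p ->
  csmooth_near A p f -> csmooth_near A p (fun q => bracket A X Y q f).
Proof.
move=> vX vY Up sf.
apply: (@csmooth_near_eq _ _ _ _ _ (fun q => X q (fun q => Y q f) - Y q (fun q => X q f))).
  by apply: filterS (near_csmooth sf) => q sq; rewrite bracketE.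
rewrite (_ : (fun q => _) = (fun q => (-1) * Y q (fun q => X q f) + X q (fun q => Y q f))).
  by apply: csmooth_nearZ; do 2 apply: csmooth_near_vfield => //.
by apply: funext => q; rewrite mulN1r addrC.
Qed.

(** The products of first derivatives that Leibniz produces are symmetric in [X] and [Y] and cancel,
    so the bracket is again a derivation; the case distinction in [bracket] provides the last clause
    of [tangent]. *)
Lemma vfield_on_bracket X Y : vfield_on A U X -> vfield_on A U Y ->
  vfield_on A U (bracket A X Y).
Proof.
move=> vX vY; have [tX sX] := vX; have [tY sY] := vY; split=> [p Up|W f oW WU sf].
- have tXp := tX p Up; have tYp := tY p Up.
  have [lX mX eX _] := tXp; have [lY mY eY _] := tYp.
  have nU := near_U Up.
  split.
  + move=> a f g sf sg; have sfg := csmooth_nearZ a sf sg; rewrite !bracketE //.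
    have lin Z : vfield_on A U Z ->
        \forall q \near p, Z q (fun q => a * f q + g q) = a * Z q f + Z q g.
      move=> [tZ _]; apply: filterS3 nU (near_csmooth sf) (near_csmooth sg) => q Uq sfq sgq.
      by have [l _ _ _] := tZ q Uq; exact: l.
    rewrite (eX _ _ _ _ (lin _ vY)) ?(eY _ _ _ _ (lin _ vX));
      do ?[apply: csmooth_near_vfield => //|apply: csmooth_nearZ => //].
    by rewrite lX ?lY; [ring|apply: csmooth_near_vfield => //..].
  + move=> f g sf sg; have sfg := csmooth_nearM sf sg; rewrite !bracketE //.
    have lei Z : vfield_on A U Z ->
        \forall q \near p, Z q (fun q => f q * g q) = f q * Z q g + g q * Z q f.
      move=> [tZ _]; apply: filterS3 nU (near_csmooth sf) (near_csmooth sg) => q Uq sfq sgq.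
      by have [_ l _ _] := tZ q Uq; exact: l.
    rewrite (eX _ _ _ _ (lei _ vY)) ?(eY _ _ _ _ (lei _ vX));
      do ?[apply: csmooth_near_vfield => //|apply: csmooth_nearD|apply: csmooth_nearM => //].
    rewrite (tangentD tXp) ?(tangentD tYp) ?mX ?mY //;
      do ?[apply: csmooth_near_vfield => //|apply: csmooth_nearM => //].
    by ring.
  + move=> f g sf sg fg; rewrite !bracketE //.
    rewrite (eX _ _ _ _ (near_vfield_eq vY Up sf sg fg));
      try by apply: csmooth_near_vfield.
    rewrite (eY _ _ _ _ (near_vfield_eq vX Up sf sg fg)) //;
      by apply: csmooth_near_vfield.
  + by move=> f sf; rewrite /bracket asboolF.
- apply: (@csmooth_on_eq _ _ _ _ _ (fun q => X q (fun q => Y q f) + - Y q (fun q => X q f))) => //.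
    by move=> q Wq; rewrite bracketE //; exists W.
  apply: csmooth_onD => //; last apply: csmooth_onN => //.
    by apply: sX => //; exact: sY.
  by apply: sY => //; exact: sX.
Qed.

(** On functions that are not smooth near [p] every bracket is 0 by convention, so the identity
    holds between functionals; elsewhere the twelve triple derivatives cancel in pairs. *)
Lemma bracket_jacobi X Y Z p : vfield_on A U X -> vfield_on A U Y -> vfield_on A U Z -> U p ->
  vlin 1 (bracket A X (bracket A Y Z) p)
    (vlin 1 (bracket A Y (bracket A Z X) p) (bracket A Z (bracket A X Y) p))
  = @vzero R M.
Proof.
move=> vX vY vZ Up; apply: funext => f; rewrite /vlin /vzero.
have [sf|nsf] := pselect (csmooth_near A p f); last first.
  by rewrite /bracket asboolF // !mul1r !addr0.
have key X1 X2 X3 : vfield_on A U X1 -> vfield_on A U X2 -> vfield_on A U X3 ->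
   bracket A X1 (bracket A X2 X3) p f =
     X1 p (fun q => X2 q (fun q => X3 q f)) - X1 p (fun q => X3 q (fun q => X2 q f))
     - X2 p (fun q => X3 q (fun q => X1 q f)) + X3 p (fun q => X2 q (fun q => X1 q f)).
  move=> v1 v2 v3; have [t1 _] := v1; have [_ _ e1 _] := t1 _ Up.
  rewrite bracketE // bracketE; last exact: csmooth_near_vfield.
  (* The inner bracket can be unfolded only where [f] is smooth, that is near [p]; locality of the
     tangent vector [X1 p] permits the replacement under it. *)
  rewrite (e1 (fun q => bracket A X2 X3 q f)
     (fun q => X2 q (fun q => X3 q f) - X3 q (fun q => X2 q f))).
  - rewrite (tangentB (t1 _ Up)); first by ring.
    + by do 2 apply: csmooth_near_vfield => //.
    + by do 2 apply: csmooth_near_vfield => //.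
  - exact: csmooth_near_bracket.
  - apply: csmooth_near_eq (csmooth_near_bracket v2 v3 Up sf).
    by apply: filterS (near_csmooth sf) => q sq; rewrite bracketE.
  - by apply: filterS (near_csmooth sf) => q sq; rewrite bracketE.
by rewrite !key //; ring.
Qed.

End Bracket.

(** * Calculus in a unitary frame *)

Section SumLemmas.
Variables (S : comPzRingType) (n : nat).
Implicit Types F G : 'I_n -> S.

Lemma sum_deltal F b : \sum_a (a == b)%:R * F a = F b.
Proof.
rewrite (bigD1 b) //= eqxx mul1r big1 ?addr0 // => a /negbTE ->.
by rewrite mul0r.
Qed.

Lemma sum_deltar F b : \sum_a (b == a)%:R * F a = F b.
Proof.
by rewrite -[RHS]sum_deltal; apply: eq_bigr => a _; rewrite eq_sym.
Qed.

Lemma sum_sum_mul (F : 'I_n -> S) (G : 'I_n -> 'I_n -> S) (H : 'I_n -> S) :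
  \sum_c F c * (\sum_e G c e * H e) = \sum_e (\sum_c F c * G c e) * H e.
Proof.
under eq_bigr do rewrite mulr_sumr.
rewrite exchange_big; apply: eq_bigr => e _; rewrite mulr_suml.
by apply: eq_bigr => c _; rewrite mulrA.
Qed.

End SumLemmas.

(* Abstract calculus of a unitary frame [Z_a] of T_{1,0}: [cfun] stands for the
   smooth complex functions on the domain of the frame, [cfld] for its complex
   vector fields; [th], [co], [om], [tau] are theta, theta^a, omega_a^b, tau^b. *)
Record crFrame (n : nat) := CRFrame {
  cfun : comPzRingType ;
  cfld : Type ;
  der : cfld -> {additive cfun -> cfun} ;
  brk : cfld -> cfld -> cfld ;
  cjf : {rmorphism cfun -> cfun} ;
  cjv : cfld -> cfld ;
  im : cfun ;
  Zf : 'I_n -> cfld ;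
  Tf : cfld ;
  th : cfld -> cfun ;
  co : 'I_n -> cfld -> cfun ;
  om : 'I_n -> 'I_n -> cfld -> cfun ;
  tau : 'I_n -> cfld -> cfun ;
  tensorial := fun L : cfld -> cfun => forall X, L X =
    th X * L Tf + \sum_a co a X * L (Zf a)
    + \sum_a cjf (co a (cjv X)) * L (cjv (Zf a)) ;
  derM : forall X f g, der X (f * g) = f * der X g + g * der X f ;
  der_brk : forall X Y f, der (brk X Y) f = der X (der Y f) - der Y (der X f) ;
  cjfK : involutive cjf ;
  cjvK : involutive cjv ;
  cjf_der : forall X f, cjf (der X f) = der (cjv X) (cjf f) ;
  cjv_brk : forall X Y, cjv (brk X Y) = brk (cjv X) (cjv Y) ;
  cjv_T : cjv Tf = Tf ;
  cjf_th : forall X, cjf (th X) = th (cjv X) ;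
  der_im : forall X, der X im = 0 ;
  cjf_im : cjf im = - im ;
  der_tensorial : forall f, tensorial (fun X => der X f) ;
  om_tensorial : forall a b, tensorial (om a b) ;
  tau_tensorial : forall a, tensorial (tau a) ;
  th_Z : forall a, th (Zf a) = 0 ;
  th_T : th Tf = 1 ;
  co_Z : forall a b, co a (Zf b) = (a == b)%:R ;
  co_Zb : forall a b, co a (cjv (Zf b)) = 0 ;
  co_T : forall a, co a Tf = 0 ;
  th_brkC : forall X Y, th (brk X Y) = - th (brk Y X) ;
  th_brkTZ : forall a, th (brk Tf (Zf a)) = 0 ;
  th_brkZZ : forall a b, th (brk (Zf a) (Zf b)) = 0 ;
  th_brkZZb : forall a b, th (brk (Zf a) (cjv (Zf b))) = - (im * (a == b)%:R) ;
  co_brkZbZb : forall c a b, co c (brk (cjv (Zf a)) (cjv (Zf b))) = 0 ;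
  structureE : forall b X Y, der X (co b Y) - der Y (co b X) - co b (brk X Y)
    = \sum_a (co a X * om a b Y - co a Y * om a b X)
      + (th X * tau b Y - th Y * tau b X) ;
  co_jacobi : forall b X Y W, co b (brk X (brk Y W)) + co b (brk Y (brk W X))
    + co b (brk W (brk X Y)) = 0 ;
  om_skew : forall a b X, cjf (om a b X) = - om b a (cjv X) ;
  tau_Z : forall a b, tau a (Zf b) = 0 ;
  tau_T : forall a, tau a Tf = 0 ;
  tau_Zb_sym : forall a b, tau a (cjv (Zf b)) = tau b (cjv (Zf a)) }.

Arguments der {n} _ _.
Arguments cfun {n} _.
Arguments cjf {n} _.
Arguments im {n} _.
Arguments Tf {n} _.
Arguments Zf {n} _ _.

(** * Connection, curvature and commutators of the frame *)

Section Calculus.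
Variables (n : nat) (F : crFrame n).
Implicit Types (X Y W : cfld F) (f g h : cfun F) (u v : 'I_n -> cfun F).
Implicit Types (w : 'I_n -> 'I_n -> cfld F -> cfun F).

Local Notation d := (der F).
Local Notation i := (im F).
Local Notation T := (Tf F).
Local Notation Z := (Zf F).
Local Notation Zb a := (cjv (Zf F a)).
Local Notation om := (@om n F).
Local Notation tau := (@tau n F).

Lemma der1 X : d X 1 = 0.
Proof.
have := derM X 1 1; rewrite mulr1 mul1r => /(canLR (addrK _)).
by rewrite subrr.
Qed.

Lemma der_nat X k : d X k%:R = 0.
Proof. by rewrite raddfMn der1 mul0rn. Qed.

Lemma th_Zb a : th (Zb a) = 0.
Proof. by rewrite -cjf_th th_Z rmorph0. Qed.

(** The matrix [w] is left arbitrary so that the Ricci identity and tensoriality serve both omega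
    and its dual, minus the transpose. *)
Definition nabla w X u (a : 'I_n) := d X (u a) - \sum_c w a c X * u c.

(** The 2-form d w - w /\ w evaluated on (X, Y), with the sign convention of the curvature form of
    the Tanaka-Webster connection. *)
Definition curvature w (a b : 'I_n) X Y :=
  d X (w a b Y) - d Y (w a b X) - w a b (brk X Y)
  - \sum_c (w a c X * w c b Y - w a c Y * w c b X).

(** The terms with one derivative of [u] and one connection form are symmetric in [X] and [Y] and
    drop out. No torsion is visible because the derivatives are iterated along fields; it enters
    when [brk X Y] is expanded in the frame. *)
Lemma ricci_identity w X Y u a :
  nabla w X (nabla w Y u) a - nabla w Y (nabla w X u) a
  = nabla w (brk X Y) u a - \sum_c curvature w a c X Y * u c.
Proof.
have E1 X1 Y1 : d X1 (nabla w Y1 u a) = d X1 (d Y1 (u a))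
    - (\sum_c w a c Y1 * d X1 (u c) + \sum_c u c * d X1 (w a c Y1)).
  rewrite /nabla raddfB raddf_sum /= -big_split /=; congr (_ - _).
  by apply: eq_bigr => c _; rewrite derM.
have E2 X1 Y1 : \sum_c w a c X1 * nabla w Y1 u c = \sum_c w a c X1 * d Y1 (u c)
    - \sum_e (\sum_c w a c X1 * w c e Y1) * u e.
  by rewrite -sum_sum_mul -sumrB; apply: eq_bigr => c _; rewrite mulrBr.
have E3 X1 Y1 : nabla w X1 (nabla w Y1 u) a =
    d X1 (nabla w Y1 u a) - \sum_c w a c X1 * nabla w Y1 u c by [].
rewrite !E3 !E1 !E2 /nabla der_brk.
have -> : \sum_c curvature w a c X Y * u c =
  \sum_c u c * d X (w a c Y) - \sum_c u c * d Y (w a c X)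
  - \sum_c w a c (brk X Y) * u c
  - (\sum_e (\sum_c w a c X * w c e Y) * u e - \sum_e (\sum_c w a c Y * w c e X) * u e).
  rewrite -!sumrB; apply: eq_bigr => c _; rewrite /curvature sumrB; ring.
ring.
Qed.

(* [nab] acts on the components u_a of a (1,0)-form, [nabb] on those of a
   (0,1)-form, whose connection forms are - omega_c^a as omega is skew-Hermitian. *)
Definition nab := nabla om.
Definition nabb := nabla (fun a b X => - om b a X).
Definition Om := curvature om.

Lemma nabbE X u a : nabb X u a = d X (u a) + \sum_c om c a X * u c.
Proof.
rewrite /nabb /nabla; congr (_ + _); rewrite -sumrN.
by apply: eq_bigr => c _; rewrite mulNr opprK.
Qed.

Lemma nab_commute X Y u a : nab X (nab Y u) a - nab Y (nab X u) a
  = nab (brk X Y) u a - \sum_c Om a c X Y * u c.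
Proof. exact: ricci_identity. Qed.

(** The curvature of the dual connection is minus the transpose of [Om]; hence the exchanged indices
    and the sign. *)
Lemma nabb_commute X Y u a : nabb X (nabb Y u) a - nabb Y (nabb X u) a
  = nabb (brk X Y) u a + \sum_c Om c a X Y * u c.
Proof.
rewrite [LHS]ricci_identity; congr (_ + _); rewrite -sumrN; apply: eq_bigr => c _.
rewrite -mulNr; congr (_ * _); rewrite /Om /curvature !raddfN /= !sumrB.
under eq_bigr do rewrite mulrNN mulrC.
under [X in _ - (_ - X)]eq_bigr do rewrite mulrNN mulrC.
ring.
Qed.

(** The connections on (1,0) and (0,1) components are dual to each other, so the connection forms
    cancel in the pairing. *)
Lemma der_pairing X u v : d X (\sum_a u a * v a)
  = \sum_a (nab X u a * v a + u a * nabb X v a).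
Proof.
rewrite raddf_sum /= !big_split /=.
under eq_bigr do rewrite derM.
under [X in _ = X + _]eq_bigr do rewrite /nab /nabla mulrBl.
under [X in _ = _ + X]eq_bigr do rewrite nabbE mulrDr.
rewrite !big_split /= sumrN.
have -> : \sum_a (\sum_c om a c X * u c) * v a = \sum_a u a * (\sum_c om c a X * v c).
  rewrite (sum_sum_mul u (fun a c => om c a X) v).
  apply: eq_bigr => a _; congr (_ * _).
  by apply: eq_bigr => c _; rewrite mulrC.
under [X in _ = X - _ + _]eq_bigr do rewrite mulrC.
ring.
Qed.

Lemma cjf_nab X u a : cjf F (nab X u a) = nabb (cjv X) (fun c => cjf F (u c)) a.
Proof.
rewrite nabbE /nab /nabla rmorphB rmorph_sum /= cjf_der; congr (_ + _).
by rewrite -sumrN; apply: eq_bigr => c _; rewrite rmorphM /= om_skew mulNr opprK.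
Qed.

Lemma cjf_nabb X u a : cjf F (nabb X u a) = nab (cjv X) (fun c => cjf F (u c)) a.
Proof.
rewrite nabbE /nab /nabla rmorphD rmorph_sum /= cjf_der; congr (_ + _).
by rewrite -sumrN; apply: eq_bigr => c _; rewrite rmorphM /= om_skew mulNr.
Qed.

Lemma eq_nab X u v a : u =1 v -> nab X u a = nab X v a.
Proof.
by move=> uv; rewrite /nab /nabla uv; congr (_ - _); apply: eq_bigr => c _; rewrite uv.
Qed.

Lemma eq_nabb X u v a : u =1 v -> nabb X u a = nabb X v a.
Proof.
by move=> uv; rewrite !nabbE uv; congr (_ + _); apply: eq_bigr => c _; rewrite uv.
Qed.

(** This is what allows a covariant derivative along a bracket to be expanded by the commutator
    formulas [brk_ZZb], [brk_ZZ] and [brk_TZb]. *)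
Lemma nabla_tensorial w u a : (forall a b, tensorial (w a b)) ->
  tensorial (fun X => nabla w X u a).
Proof.
move=> tw X; rewrite /nabla [d X _]der_tensorial.
under [X in _ - X = _]eq_bigr do rewrite tw !mulrDl -mulrA !mulr_suml.
rewrite !big_split /= -!mulr_sumr.
rewrite [X in _ - (_ + X + _)]exchange_big [X in _ - (_ + _ + X)]exchange_big /=.
under [X in _ - (_ + X + _)]eq_bigr => b _.
  under eq_bigr do rewrite -mulrA.
  rewrite -mulr_sumr; over.
under [X in _ - (_ + _ + X)]eq_bigr => b _.
  under eq_bigr do rewrite -mulrA.
  rewrite -mulr_sumr; over.
rewrite /=.
under [X in _ = _ + X + _]eq_bigr do rewrite mulrBr.
under [X in _ = _ + _ + X]eq_bigr do rewrite mulrBr.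
by rewrite !sumrB; ring.
Qed.

Lemma nab_tensorial u a : tensorial (fun X => nab X u a).
Proof. by apply: nabla_tensorial => *; exact: om_tensorial. Qed.

Lemma nabb_tensorial u a : tensorial (fun X => nabb X u a).
Proof.
apply: nabla_tensorial => b c X; rewrite om_tensorial !opprD -!sumrN mulrN.
by congr (_ + _ + _); apply: eq_bigr => e _; rewrite mulrN.
Qed.

(** The component A_{ab}: in a unitary frame the lowered form tau_a is the conjugate of tau^a, so
    its value on Z_b is the conjugate of tau^a on the conjugate of Z_b. In [dtorsion] both indices
    are of type (1,0), hence two connection terms of the same sign. *)
Definition torsion a b := cjf F (tau a (Zb b)).
Definition dtorsion a b X := d X (torsion a b)
  - \sum_c om a c X * torsion c b - \sum_c om b c X * torsion a c.

Lemma torsionC a b : torsion a b = torsion b a.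
Proof. by rewrite /torsion tau_Zb_sym. Qed.

Lemma dtorsionC a b X : dtorsion a b X = dtorsion b a X.
Proof.
rewrite /dtorsion torsionC; under eq_bigr do rewrite torsionC.
under [X in _ - _ - X = _]eq_bigr do rewrite torsionC.
by ring.
Qed.

(** For such fields the structure equation loses its derivatives of coefficients and gives the
    theta^b component of a bracket algebraically ([co_brk]). *)
Definition constant_field X :=
  (forall Y a, d Y (co a X) = 0) /\ (forall Y, d Y (th X) = 0).

Lemma constant_Z a : constant_field (Z a).
Proof.
by split=> [Y b|Y]; rewrite ?co_Z ?der_nat // th_Z raddf0.
Qed.

Lemma constant_Zb a : constant_field (Zb a).
Proof.
by split=> [Y b|Y]; rewrite ?co_Zb ?th_Zb raddf0.
Qed.

Lemma constant_T : constant_field T.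
Proof. by split=> [Y b|Y]; rewrite ?co_T ?raddf0 // th_T der1. Qed.

Lemma co_brk X Y b : constant_field X -> constant_field Y ->
  co b (brk X Y) = \sum_a (co a Y * om a b X - co a X * om a b Y)
    + (th Y * tau b X - th X * tau b Y).
Proof.
move=> [cX _] [cY _]; have := structureE b X Y.
rewrite cX cY subrr sub0r => /(canRL (@opprK _)) ->.
rewrite opprD -sumrN opprB; congr (_ + _).
by apply: eq_bigr => a _; rewrite opprB.
Qed.

(** Sum of the structure equations for (X, Y) and (Y, X), whose right-hand sides are opposite. *)
Lemma co_brkC X Y b : co b (brk X Y) = - co b (brk Y X).
Proof.
have := structureE b X Y; have := structureE b Y X.
have -> : \sum_a (co a Y * om a b X - co a X * om a b Y) =
  - \sum_a (co a X * om a b Y - co a Y * om a b X).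
  by rewrite -sumrN; apply: eq_bigr => a _; rewrite opprB.
move: (\sum_a _) => s e1 e2.
apply/eqP; rewrite -addr_eq0; apply/eqP.
transitivity (- ((d X (co b Y) - d Y (co b X) - co b (brk X Y)) +
  (d Y (co b X) - d X (co b Y) - co b (brk Y X)))); first by ring.
by rewrite e1 e2; ring.
Qed.

Lemma tensorial_brkC (L : cfld F -> cfun F) X Y : tensorial L ->
  L (brk X Y) = - L (brk Y X).
Proof.
move=> tL; rewrite [LHS]tL [in RHS]tL th_brkC !opprD -!sumrN mulNr.
congr (_ + _ + _); apply: eq_bigr => a _; rewrite -mulNr; congr (_ * _).
  exact: co_brkC.
by rewrite !cjv_brk -rmorphN; congr (cjf F _); exact: co_brkC.
Qed.

Lemma OmC a b X Y : Om a b X Y = - Om a b Y X.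
Proof.
rewrite /Om /curvature (tensorial_brkC X Y (om_tensorial a b)) !sumrB; ring.
Qed.

(** The Levi form gives the T component, the structure equation the Z components, and conjugating
    the bracket the remaining ones. Stating it under a tensorial [L] makes one formula usable for
    derivatives of functions, covariant derivatives and tau. *)
Lemma brk_ZZb (L : cfld F -> cfun F) r s : tensorial L ->
  L (brk (Z r) (Zb s)) = - (i * (r == s)%:R * L T)
    - \sum_a om r a (Zb s) * L (Z a) - \sum_a om a s (Z r) * L (Zb a).
Proof.
move=> tL; rewrite [LHS]tL th_brkZZb cjv_brk !cjvK mulNr -!sumrN.
congr (_ + _ + _); apply: eq_bigr => a _; rewrite -mulNr; congr (_ * _);
  rewrite co_brk; try solve [exact: constant_Z|exact: constant_Zb];
  rewrite th_Z th_Zb !mul0r subrr addr0.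
  under eq_bigr do rewrite co_Zb co_Z mul0r sub0r.
  by rewrite sumrN sum_deltal.
under eq_bigr do rewrite co_Zb co_Z mul0r subr0.
by rewrite sum_deltal om_skew cjvK.
Qed.

(** Integrability removes the components along T and along the conjugate fields. *)
Lemma brk_ZZ (L : cfld F -> cfun F) r s : tensorial L ->
  L (brk (Z r) (Z s)) = \sum_a om s a (Z r) * L (Z a) - \sum_a om r a (Z s) * L (Z a).
Proof.
move=> tL; rewrite [LHS]tL th_brkZZ mul0r add0r -sumrB [X in _ + X]big1 ?addr0; last first.
  by move=> a _; rewrite cjv_brk co_brkZbZb rmorph0 mul0r.
apply: eq_bigr => a _; rewrite -mulrBl; congr (_ * _).
rewrite co_brk; try exact: constant_Z.
rewrite !th_Z !mul0r subrr addr0 sumrB.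
by under eq_bigr do rewrite co_Z; under [X in _ - X]eq_bigr do rewrite co_Z;
  rewrite !sum_deltal.
Qed.

Lemma co_brk_TZ r a : co a (brk T (Z r)) = om r a T.
Proof.
rewrite co_brk; [|exact: constant_T|exact: constant_Z].
rewrite th_Z tau_Z mul0r mulr0 subrr addr0.
under eq_bigr do rewrite co_T co_Z mul0r subr0.
by rewrite sum_deltal.
Qed.

Lemma co_brk_TZb s a : co a (brk T (Zb s)) = - cjf F (torsion a s).
Proof.
rewrite co_brk; [|exact: constant_T|exact: constant_Zb].
rewrite th_Zb th_T mul1r mul0r sub0r big1 ?add0r; last first.
  by move=> b _; rewrite co_T co_Zb !mul0r subrr.
by rewrite /torsion cjfK.
Qed.

Lemma th_brk_TZb s : th (brk T (Zb s)) = 0.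
Proof. by rewrite -[T](cjv_T F) -cjv_brk -cjf_th th_brkTZ rmorph0. Qed.

(** Torsion is exactly the (0,1) part of the bracket of T with a (1,0) frame field. *)
Lemma brk_TZ (L : cfld F -> cfun F) r : tensorial L ->
  L (brk T (Z r)) = \sum_a om r a T * L (Z a) - \sum_a torsion a r * L (Zb a).
Proof.
move=> tL; rewrite [LHS]tL th_brkTZ mul0r add0r cjv_brk cjv_T -sumrN.
congr (_ + _); apply: eq_bigr => a _; first by rewrite co_brk_TZ.
by rewrite co_brk_TZb rmorphN /= cjfK mulNr.
Qed.

Lemma brk_TZb (L : cfld F -> cfun F) s : tensorial L ->
  L (brk T (Zb s)) = - \sum_a cjf F (torsion a s) * L (Z a) - \sum_a om a s T * L (Zb a).
Proof.
move=> tL; rewrite [LHS]tL th_brk_TZb mul0r add0r cjv_brk cjv_T cjvK -!sumrN.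
congr (_ + _); apply: eq_bigr => a _; first by rewrite co_brk_TZb mulNr.
by rewrite co_brk_TZ om_skew cjv_T mulNr.
Qed.

(** The covariant exterior derivative d tau^b - tau^a /\ omega_a^b on (X, Y). *)
Definition Dtau b X Y := d X (tau b Y) - d Y (tau b X) - tau b (brk X Y)
  + \sum_a (tau a Y * om a b X - tau a X * om a b Y).

(* d (d theta^b) = 0: the Jacobi identity evaluated on theta^b, where [Om] and
   [Dtau] collect the derivatives of omega and tau. *)
Lemma bianchi b X Y W : constant_field X -> constant_field Y -> constant_field W ->
  let term X Y W := \sum_a co a X * Om a b Y W + th X * Dtau b Y W + th (brk Y W) * tau b X in
  term X Y W + term Y W X + term W X Y = 0.
Proof.
move=> kX kY kW term.
(* The outer bracket needs the full structure equation, since [brk Y1 W1] need not have constant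
   components; [co_brk] then resolves the inner one. *)
have E X1 Y1 W1 : constant_field X1 -> constant_field Y1 -> constant_field W1 ->
    co b (brk X1 (brk Y1 W1)) =
    (\sum_a co a W1 * d X1 (om a b Y1) - \sum_a co a Y1 * d X1 (om a b W1)
      + th W1 * d X1 (tau b Y1) - th Y1 * d X1 (tau b W1))
    - \sum_a co a X1 * om a b (brk Y1 W1)
    + (\sum_a (\sum_c co c W1 * om c a Y1) * om a b X1
       - \sum_a (\sum_c co c Y1 * om c a W1) * om a b X1
       + th W1 * (\sum_a tau a Y1 * om a b X1)
       - th Y1 * (\sum_a tau a W1 * om a b X1))
    - th X1 * tau b (brk Y1 W1) + th (brk Y1 W1) * tau b X1.
  move=> k1 k2 k3; have := structureE b X1 (brk Y1 W1).
  rewrite k1.1 subr0 => /(canRL (subrK _)) /esym /(canRL (addKr _)) ->.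
  have -> : d X1 (co b (brk Y1 W1)) =
      \sum_a co a W1 * d X1 (om a b Y1) - \sum_a co a Y1 * d X1 (om a b W1)
      + th W1 * d X1 (tau b Y1) - th Y1 * d X1 (tau b W1).
    rewrite co_brk // raddfD raddfB !derM k2.2 k3.2 !mulr0 !addr0 raddf_sum /=.
    rewrite -sumrB -addrA; congr (_ + _); apply: eq_bigr => a _.
    by rewrite raddfB !derM k2.1 k3.1 !mulr0 !addr0.
  have -> : \sum_a (co a X1 * om a b (brk Y1 W1) - co a (brk Y1 W1) * om a b X1) =
      \sum_a co a X1 * om a b (brk Y1 W1)
      - (\sum_a (\sum_c co c W1 * om c a Y1) * om a b X1
         - \sum_a (\sum_c co c Y1 * om c a W1) * om a b X1
         + th W1 * (\sum_a tau a Y1 * om a b X1)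
         - th Y1 * (\sum_a tau a W1 * om a b X1)).
    rewrite !mulr_sumr -!(sumrB, big_split) /=; apply: eq_bigr => a _.
    by rewrite co_brk // sumrB; ring.
  ring.
rewrite /term /=.
have Ecs X1 Y1 W1 : \sum_a co a X1 * Om a b Y1 W1 =
   \sum_a co a X1 * d Y1 (om a b W1) - \sum_a co a X1 * d W1 (om a b Y1)
   - \sum_a co a X1 * om a b (brk Y1 W1)
   - (\sum_a (\sum_c co c X1 * om c a Y1) * om a b W1
     - \sum_a (\sum_c co c X1 * om c a W1) * om a b Y1).
  rewrite -!sum_sum_mul -!sumrB; apply: eq_bigr => a _.
  by rewrite /Om /curvature sumrB; ring.
have Et X1 Y1 : Dtau b X1 Y1 = d X1 (tau b Y1) - d Y1 (tau b X1) - tau b (brk X1 Y1)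
  + (\sum_a tau a Y1 * om a b X1 - \sum_a tau a X1 * om a b Y1).
  by rewrite /Dtau sumrB.
have := co_jacobi b X Y W; rewrite !E // => J.
by rewrite !Ecs !Et -[RHS]J; ring.
Qed.


Lemma tau_Zb a b : tau a (Zb b) = cjf F (torsion a b).
Proof. by rewrite /torsion cjfK. Qed.

Lemma cjf_Om a b X Y : cjf F (Om a b X Y) = - Om b a (cjv X) (cjv Y).
Proof.
have E X1 Y1 : cjf F (\sum_c om a c X1 * om c b Y1) =
    \sum_c om b c (cjv Y1) * om c a (cjv X1).
  rewrite rmorph_sum; apply: eq_bigr => c _.
  by rewrite rmorphM /= !om_skew mulrNN mulrC.
rewrite /Om /curvature !sumrB !rmorphB /= !cjf_der !E !om_skew cjv_brk !raddfN /=; ring.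
Qed.

(** Bianchi on (Z_r, Z_s, Zb_t): tau vanishes on the two (1,0) fields, and its value on Zb_t is
    multiplied by theta of the bracket of Z_r and Z_s, which is 0. *)
Lemma Om_ZZb_sym r s t b : Om r b (Z s) (Zb t) = Om s b (Z r) (Zb t).
Proof.
have := bianchi b (constant_Z r) (constant_Z s) (constant_Zb t) => /=.
rewrite !th_Z !th_Zb !tau_Z th_brkZZ !mul0r !mulr0 !addr0.
under eq_bigr do rewrite co_Z.
under [X in _ + X + _]eq_bigr do rewrite co_Z.
rewrite [X in _ + X]big1 => [|a _]; last by rewrite co_Zb mul0r.
rewrite !sum_deltal addr0 [Om s b (Zb t) _]OmC => /eqP.
by rewrite subr_eq0 => /eqP.
Qed.

(** In the Bianchi identity on (Z_r, Zb_s, Zb_t) the Levi form multiplies tau. The (0,2) curvature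
    is thus pure torsion, the term i theta_b /\ tau^a of the curvature form. *)
Lemma Om_ZbZb r b s t : Om r b (Zb s) (Zb t) =
  i * (r == s)%:R * cjf F (torsion b t) - i * (r == t)%:R * cjf F (torsion b s).
Proof.
have := bianchi b (constant_Z r) (constant_Zb s) (constant_Zb t) => /=.
rewrite !th_Z !th_Zb !tau_Z !mul0r mulr0 !addr0 [th (brk (Zb t) _)]th_brkC !th_brkZZb opprK !tau_Zb.
under eq_bigr do rewrite co_Z.
rewrite [X in _ + (X + _) + _]big1 => [|a _]; last by rewrite co_Zb mul0r.
rewrite [X in _ + _ + (X + _)]big1 => [|a _]; last by rewrite co_Zb mul0r.
rewrite sum_deltal !add0r => /eqP; rewrite -addrA addr_eq0 => /eqP ->.
by ring.
Qed.

Lemma Om_ZZ r b s t : Om r b (Z s) (Z t) =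
  i * (b == s)%:R * torsion r t - i * (b == t)%:R * torsion r s.
Proof.
rewrite -[LHS](@cjfK _ F) cjf_Om Om_ZbZb !(rmorphN, rmorphB, rmorphM) /= !cjfK cjf_im.
by rewrite !rmorph_nat; ring.
Qed.

Lemma cjf_dtorsion b s X : cjf F (dtorsion b s X) = d (cjv X) (cjf F (torsion b s))
  + \sum_c om c b (cjv X) * cjf F (torsion c s)
  + \sum_c om c s (cjv X) * cjf F (torsion b c).
Proof.
rewrite /dtorsion !rmorphB !rmorph_sum /= cjf_der -!sumrN.
by congr (_ + _ + _); apply: eq_bigr => c _; rewrite rmorphM /= om_skew mulNr opprK.
Qed.

(** Bianchi on (T, Z_r, Zb_s): the part of the curvature containing theta is a covariant derivative
    of the torsion. This is one source of the divergence of A in the commutator with T. *)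
Lemma Om_TZb r b s : Om r b T (Zb s) = cjf F (dtorsion b s (Zb r)).
Proof.
have := bianchi b constant_T (constant_Z r) (constant_Zb s) => /=.
rewrite th_T !th_Z !th_Zb tau_T tau_Z th_brkTZ !mul0r !mulr0 mul1r !addr0.
rewrite [X in X + _ + _ + _]big1 => [|a _]; last by rewrite co_T mul0r.
rewrite [X in _ + X]big1 => [|a _]; last by rewrite co_Zb mul0r.
under eq_bigr do rewrite co_Z.
rewrite sum_deltal addr0 add0r OmC => /eqP; rewrite subr_eq0 => /eqP <-.
rewrite cjf_dtorsion cjvK /Dtau tau_Z raddf0 subr0 (brk_ZZb _ _ (tau_tensorial b)).
rewrite tau_T mulr0 oppr0 sub0r [X in - (- X - _)]big1 => [|a _]; last by rewrite tau_Z mulr0.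
rewrite oppr0 sub0r opprK tau_Zb addrAC; congr (_ + _ + _); apply: eq_bigr => a _.
  by rewrite tau_Z mul0r subr0 tau_Zb mulrC.
by rewrite tau_Zb.
Qed.

(* [lap1 h] and [lap2 h] are the sums of h_{c cbar} and h_{cbar c}; [rlap1 u a] and
   [rlap2 u a] those of u_{a,c cbar} and u_{a,cbar c}. *)
Definition lap1 h := \sum_c nab (Zb c) (fun a => d (Z a) h) c.
Definition lap2 h := \sum_c nabb (Z c) (fun a => d (Zb a) h) c.
Definition lap h := lap1 h + lap2 h.

Definition rlap1 u a := \sum_c (nab (Zb c) (nab (Z c) u) a
  - \sum_e om c e (Zb c) * nab (Z e) u a).
Definition rlap2 u a := \sum_c (nab (Z c) (nab (Zb c) u) a
  + \sum_e om e c (Z c) * nab (Zb e) u a).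
Definition rlap1b v a := \sum_c (nabb (Zb c) (nabb (Z c) v) a
  - \sum_e om c e (Zb c) * nabb (Z e) v a).
Definition rlap2b v a := \sum_c (nabb (Z c) (nabb (Zb c) v) a
  + \sum_e om e c (Z c) * nabb (Zb e) v a).

Lemma cjf_rlap1 u a : cjf F (rlap1 u a) = rlap2b (fun c => cjf F (u c)) a.
Proof.
rewrite /rlap1 rmorph_sum; apply: eq_bigr => c _.
rewrite rmorphB rmorph_sum /= cjf_nab cjvK; congr (_ + _).
  by apply: eq_nabb => e; rewrite cjf_nab.
by rewrite -sumrN; apply: eq_bigr => e _; rewrite rmorphM /= om_skew cjf_nab cjvK mulNr opprK.
Qed.

Lemma cjf_rlap2 u a : cjf F (rlap2 u a) = rlap1b (fun c => cjf F (u c)) a.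
Proof.
rewrite /rlap2 rmorph_sum; apply: eq_bigr => c _.
rewrite rmorphD rmorph_sum /= cjf_nab; congr (_ + _).
  by apply: eq_nabb => e; rewrite cjf_nab cjvK.
by rewrite -sumrN; apply: eq_bigr => e _; rewrite rmorphM /= om_skew cjf_nab cjvK mulNr.
Qed.

(** [der_pairing] twice: the connection correction in the trace is itself a combination of first
    derivatives, so it distributes over the pairing and joins the rough Laplacians. *)
Lemma lap1_pairing u v : lap1 (\sum_a u a * v a) =
  \sum_a (rlap1 u a * v a + u a * rlap1b v a)
  + \sum_a \sum_c (nab (Z c) u a * nabb (Zb c) v a + nab (Zb c) u a * nabb (Z c) v a).
Proof.
have -> h : lap1 h = \sum_c (d (Zb c) (d (Z c) h) - \sum_e om c e (Zb c) * d (Z e) h) by [].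
have E c : \sum_e om c e (Zb c) * d (Z e) (\sum_a u a * v a) =
  \sum_a ((\sum_e om c e (Zb c) * nab (Z e) u a) * v a
          + u a * (\sum_e om c e (Zb c) * nabb (Z e) v a)).
  under eq_bigr do rewrite der_pairing mulr_sumr.
  rewrite exchange_big; apply: eq_bigr => a _.
  rewrite mulr_suml mulr_sumr -big_split; apply: eq_bigr => e _ /=; ring.
under eq_bigr do rewrite E der_pairing big_split /= raddfD /= !der_pairing -!big_split -sumrB.
rewrite exchange_big -big_split; apply: eq_bigr => a _ /=.
rewrite /rlap1 /rlap1b mulr_suml mulr_sumr -!big_split; apply: eq_bigr => c _ /=.
set s := \sum_(e < n) om c e (Zb c) * nab (Z e) u a.
set t := \sum_(e < n) om c e (Zb c) * nabb (Z e) v a.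
ring.
Qed.

Lemma lap2_pairing u v : lap2 (\sum_a u a * v a) =
  \sum_a (rlap2 u a * v a + u a * rlap2b v a)
  + \sum_a \sum_c (nab (Z c) u a * nabb (Zb c) v a + nab (Zb c) u a * nabb (Z c) v a).
Proof.
rewrite /lap2; under eq_bigr do rewrite nabbE.
have E c : \sum_e om e c (Z c) * d (Zb e) (\sum_a u a * v a) =
  \sum_a ((\sum_e om e c (Z c) * nab (Zb e) u a) * v a
          + u a * (\sum_e om e c (Z c) * nabb (Zb e) v a)).
  under eq_bigr do rewrite der_pairing mulr_sumr.
  rewrite exchange_big; apply: eq_bigr => a _.
  rewrite mulr_suml mulr_sumr -big_split; apply: eq_bigr => e _ /=; ring.
under eq_bigr do rewrite E der_pairing big_split /= raddfD /= !der_pairing -!big_split /=.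
rewrite exchange_big -big_split; apply: eq_bigr => a _ /=.
rewrite /rlap2 /rlap2b mulr_suml mulr_sumr -!big_split; apply: eq_bigr => c _ /=.
set s := \sum_(e < n) om e c (Z c) * nab (Zb e) u a.
set t := \sum_(e < n) om e c (Z c) * nabb (Zb e) v a.
ring.
Qed.

(** * Second and third covariant derivatives of a real function *)

Section Function.
Variable f : cfun F.
Hypothesis f_real : cjf F f = f.

Local Notation u := (fun a => d (Z a) f).
Local Notation v := (fun a => d (Zb a) f).
Local Notation g := (d T f).

Lemma cjf_grad a : cjf F (d (Z a) f) = d (Zb a) f.
Proof. by rewrite cjf_der f_real. Qed.

Lemma cjf_gradb a : cjf F (d (Zb a) f) = d (Z a) f.
Proof. by rewrite cjf_der f_real cjvK. Qed.

Lemma cjf_derT : cjf F g = g.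
Proof. by rewrite cjf_der cjv_T f_real. Qed.

Lemma cjf_hess X a : cjf F (nab X u a) = nabb (cjv X) v a.
Proof. by rewrite cjf_nab; apply: eq_nabb => c; rewrite cjf_grad. Qed.

Lemma cjf_hessb X a : cjf F (nabb X v a) = nab (cjv X) u a.
Proof. by rewrite cjf_nabb; apply: eq_nab => c; rewrite cjf_gradb. Qed.

(** The bracket of two (1,0) frame fields has only (1,0) components, and these are absorbed by the
    connection terms. *)
Lemma hess_sym a c : nab (Z c) u a = nab (Z a) u c.
Proof.
have := brk_ZZ a c (der_tensorial f); rewrite der_brk /nab /nabla.
by move=> /(canRL (subrK _)) ->; ring.
Qed.

(** The extra term is the T component of the bracket of Z_a with the conjugate of Z_c; at a = c it
    is what eventually bounds f_0 by the Hessian. *)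
Lemma hess_mixed a c : nab (Zb c) u a = nabb (Z a) v c + i * (a == c)%:R * g.
Proof.
have := brk_ZZb a c (der_tensorial f); rewrite der_brk nabbE /nab /nabla.
move: (\sum_e _) (\sum_e _) => s t /(canRL (subrK _)) ->; ring.
Qed.

Lemma grad_derT c : d (Z c) g = nab T u c + \sum_a torsion c a * v a.
Proof.
have := brk_TZ c (der_tensorial f); rewrite der_brk /nab /nabla.
under [X in _ = _ - X]eq_bigr do rewrite torsionC.
move: (\sum_e _) (\sum_e _) => s t /(canRL (subrK _)) ->; ring.
Qed.

(** The free index is moved to the front by symmetry of the Hessian, then Z_a is commuted with Zb_c:
    the Levi form yields f_{a0} and the Ricci identity the curvature. *)
Lemma rlap1_grad a : rlap1 u a = d (Z a) (lap1 f) + i * nab T u a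
  + \sum_c \sum_e Om c e (Z a) (Zb c) * u e.
Proof.
(* Symmetry of the (2,0) Hessian exchanges the free index [a] with the summed index [c], also in the
   connection terms. *)
have -> : rlap1 u a = \sum_c (nab (Zb c) (nab (Z a) u) c
    - \sum_e om a e (Zb c) * nab (Z e) u c).
  apply: eq_bigr => c _; rewrite {1 3}/nab /nabla -!/(nab _ _ _) hess_sym.
  rewrite -[LHS]addrA -[RHS]addrA; congr (_ + _); rewrite -!opprD addrC.
  congr (- (_ + _)); apply: eq_bigr => e _; by rewrite hess_sym.
have E c : nab (Zb c) (nab (Z a) u) c - \sum_e om a e (Zb c) * nab (Z e) u c =
   d (Z a) (nab (Zb c) u c) + (c == a)%:R * (i * nab T u c)
   + \sum_e Om c e (Z a) (Zb c) * u e
   + (\sum_e om e c (Z a) * nab (Zb e) u c - \sum_e om c e (Z a) * nab (Zb c) u e).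
  have := nab_commute (Z a) (Zb c) u c.
  rewrite (brk_ZZb _ _ (nab_tensorial _ _)) => H.
  rewrite (_ : nab (Zb c) (nab (Z a) u) c = nab (Z a) (nab (Zb c) u) c -
    (nab (Z a) (nab (Zb c) u) c - nab (Zb c) (nab (Z a) u) c)); last by ring.
  rewrite {}H [nab (Z a) (nab (Zb c) u) c]/nab /nabla -/(nab _ _ _) [a == c]eq_sym.
  ring.
rewrite (eq_bigr _ (fun c _ => E c)) !big_split /= sum_deltal sumrN.
(* The leftover connection terms in direction Z_a cancel only after the double summation: taking the
   trace commutes with covariant differentiation. *)
rewrite [X in _ + (X - _)]exchange_big /= subrr addr0 /lap1 raddf_sum.
by [].
Qed.

(** [hess_mixed] reverses the order of the mixed Hessian at the price of a derivative of f_0; then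
    two (1,0) directions are commuted, so the curvature left is of type (2,0), which is torsion. *)
Lemma rlap2_grad a : rlap2 u a = d (Z a) (lap2 f) + i * d (Z a) g
  + \sum_c \sum_e Om e c (Z c) (Z a) * v e.
Proof.
have Dd X c : d X (i * (a == c)%:R * g) = i * (a == c)%:R * d X g.
  by rewrite !derM der_im der_nat; ring.
have E c : nab (Z c) (nab (Zb c) u) a + \sum_e om e c (Z c) * nab (Zb e) u a =
   nabb (Z c) (nabb (Z a) v) c - \sum_e om a e (Z c) * nabb (Z e) v c
   + (a == c)%:R * (i * d (Z c) g).
  have A1 : \sum_e om a e (Z c) * nab (Zb c) u e =
      \sum_e om a e (Z c) * nabb (Z e) v c + om a c (Z c) * (i * g).
    rewrite -[X in _ = _ + X](sum_deltal (fun e => om a e (Z c) * (i * g))) -big_split.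
    by apply: eq_bigr => e _ /=; rewrite hess_mixed; ring.
  have A2 : \sum_e om e c (Z c) * nab (Zb e) u a =
      \sum_e om e c (Z c) * nabb (Z a) v e + om a c (Z c) * (i * g).
    rewrite -[X in _ = _ + X](sum_deltar (fun e => om e c (Z c) * (i * g))) -big_split.
    by apply: eq_bigr => e _ /=; rewrite hess_mixed; ring.
  rewrite [nab (Z c) _ a]/nab /nabla -/(nab _ _ _) A1 A2 hess_mixed raddfD /= Dd.
  rewrite [nabb (Z c) _ c]nabbE.
  move: (\sum_e om a e _ * _) (\sum_e om e c _ * _) => s t; ring.
have E2 c : nabb (Z c) (nabb (Z a) v) c - \sum_e om a e (Z c) * nabb (Z e) v c =
   d (Z a) (nabb (Z c) v c) + \sum_e Om e c (Z c) (Z a) * v e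
   + (\sum_e om e c (Z a) * nabb (Z c) v e - \sum_e om c e (Z a) * nabb (Z e) v c).
  have := nabb_commute (Z c) (Z a) v c.
  rewrite (brk_ZZ _ _ (nabb_tensorial _ _)) [nabb (Z a) (nabb (Z c) v) c]nabbE => H.
  rewrite -[nabb (Z c) (nabb (Z a) v) c](subrK
    (d (Z a) (nabb (Z c) v c) + \sum_e om e c (Z a) * nabb (Z c) v e)) {}H.
  ring.
rewrite /rlap2 (eq_bigr _ (fun c _ => E c)) big_split /= sum_deltar.
rewrite (eq_bigr _ (fun c _ => E2 c)) !big_split /= sumrN.
rewrite [X in _ + (X - _) + _]exchange_big /= subrr addr0 /lap2 raddf_sum /=.
ring.
Qed.

(** [Om_ZZb_sym] exchanges two unbarred indices; between two conjugations it exchanges barred ones,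
    which turns this trace into the Ricci trace. *)
Lemma sum_Om_ricci a e : \sum_c Om c e (Z a) (Zb c) = \sum_c Om c c (Z a) (Zb e).
Proof.
apply: eq_bigr => c _; rewrite -[LHS](@cjfK _ F) cjf_Om cjvK.
rewrite [Om e c _ _]OmC opprK [Om e c _ _]Om_ZZb_sym cjf_Om cjvK.
by rewrite OmC opprK.
Qed.

(** The first Kronecker delta of [Om_ZZ] is summed over its diagonal and gives n; the second selects
    a single term and gives -1. *)
Lemma sum_Om_torsion a e : \sum_c Om e c (Z c) (Z a) = i * (n%:R - 1) * torsion a e.
Proof.
under eq_bigr do rewrite Om_ZZ eqxx mulr1.
rewrite sumrB sumr_const card_ord.
under eq_bigr do rewrite -mulrA mulrCA.
by rewrite sum_deltal -mulr_natl torsionC; ring.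
Qed.

Definition ricci a b := \sum_c Om c c (Z a) (Zb b).

(** The factor n - 2 arises as n - 1 from [sum_Om_torsion] and -1 from rewriting f_{a0} as f_{0a}
    minus a torsion term by [grad_derT]. *)
Lemma rough_laplacian_grad a : rlap1 u a + rlap2 u a =
  d (Z a) (lap f) + 2 * i * d (Z a) g + \sum_e ricci a e * u e
  + i * (n%:R - 2) * \sum_e torsion a e * v e.
Proof.
rewrite rlap1_grad rlap2_grad /lap raddfD /=.
rewrite exchange_big /=.
under eq_bigr do rewrite -mulr_suml sum_Om_ricci -/(ricci _ _).
rewrite [X in _ + (_ + X)]exchange_big /=.
under [X in _ + (_ + X)]eq_bigr do rewrite -mulr_suml sum_Om_torsion -mulrA.
rewrite -mulr_sumr (_ : nab T u a = d (Z a) g - \sum_e torsion a e * v e).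
  by ring.
by rewrite grad_derT addrK.
Qed.

Lemma cjf_lap1 : cjf F (lap1 f) = lap2 f.
Proof.
by rewrite /lap1 /lap2 rmorph_sum; apply: eq_bigr => c _; rewrite cjf_hess cjvK.
Qed.

Lemma cjf_lap2 : cjf F (lap2 f) = lap1 f.
Proof.
by rewrite /lap1 /lap2 rmorph_sum; apply: eq_bigr => c _; rewrite cjf_hessb.
Qed.

Lemma cjf_lap : cjf F (lap f) = lap f.
Proof. by rewrite /lap rmorphD /= cjf_lap1 cjf_lap2 addrC. Qed.

Lemma bochner : lap (\sum_a u a * v a)
    - \sum_a (v a * d (Z a) (lap f) + u a * d (Zb a) (lap f)) =
  \sum_a \sum_c 2 * (nab (Z c) u a * nabb (Zb c) v a + nab (Zb c) u a * nabb (Z c) v a)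
  + 2 * i * \sum_a (v a * d (Z a) g - u a * d (Zb a) g)
  + \sum_a \sum_b (ricci a b * v a * u b + cjf F (ricci a b) * u a * v b)
  + i * (n%:R - 2) * \sum_a \sum_b (torsion a b * v a * v b
      - cjf F (torsion a b) * u a * u b).
Proof.
(* As [f] is real, the equation for its (0,1) gradient is the conjugate of the (1,0) one;
   conjugation exchanges the two orders of the trace. *)
have E a : rlap1b v a + rlap2b v a = d (Zb a) (lap f) - 2 * i * d (Zb a) g
   + \sum_e cjf F (ricci a e) * v e
   - i * (n%:R - 2) * \sum_e cjf F (torsion a e) * u e.
  have := congr1 (cjf F) (rough_laplacian_grad a).
  have cu : (fun c => cjf F (u c)) = v by apply: funext => c; exact: cjf_grad.
  rewrite !rmorphD /= cjf_rlap1 cjf_rlap2 !cu addrC => ->.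
  rewrite !rmorphM /= !rmorphB /= cjf_im !rmorph_nat !rmorph_sum /= !cjf_der.
  rewrite cjf_lap cjv_T f_real.
  under eq_bigr do rewrite rmorphM /= cjf_grad.
  under [X in _ + _ * X]eq_bigr do rewrite rmorphM /= cjf_gradb.
  by ring.
rewrite [lap (\sum_a _)]/lap lap1_pairing lap2_pairing.
have S1 : \sum_a (rlap1 u a * v a + u a * rlap1b v a) +
   \sum_a (rlap2 u a * v a + u a * rlap2b v a) =
   \sum_a ((rlap1 u a + rlap2 u a) * v a + u a * (rlap1b v a + rlap2b v a)).
  by rewrite -big_split; apply: eq_bigr => a _ /=; ring.
have S2 : \sum_a \sum_c 2 * (nab (Z c) u a * nabb (Zb c) v a + nab (Zb c) u a * nabb (Z c) v a) =
  2 * \sum_a \sum_c (nab (Z c) u a * nabb (Zb c) v a + nab (Zb c) u a * nabb (Z c) v a).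
  by rewrite mulr_sumr; apply: eq_bigr => a _; rewrite mulr_sumr.
rewrite S2 addrACA S1; set hh := \sum_a \sum_c _.
have hh2 (x y : cfun F) : x + (hh + hh) - y = 2 * hh + (x - y) by ring.
rewrite hh2.
rewrite -!addrA; congr (_ + _).
rewrite !mulr_sumr -sumrB -![in RHS]big_split; apply: eq_bigr => a _ /=.
rewrite rough_laplacian_grad E.
have R1 : \sum_b (ricci a b * v a * u b + cjf F (ricci a b) * u a * v b) =
    (\sum_b ricci a b * u b) * v a + u a * \sum_b cjf F (ricci a b) * v b.
  by rewrite mulr_suml mulr_sumr -big_split; apply: eq_bigr => b _ /=; ring.
have R2 : \sum_b (torsion a b * v a * v b - cjf F (torsion a b) * u a * u b) =
    (\sum_b torsion a b * v b) * v a - u a * \sum_b cjf F (torsion a b) * u b.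
  by rewrite mulr_suml mulr_sumr -sumrB; apply: eq_bigr => b _ /=; ring.
rewrite R1 R2; move: (\sum_b _) (\sum_b _) (\sum_b _) (\sum_b _) => s1 s2 s3 s4; ring.
Qed.

Lemma nabD X (u1 u2 : 'I_n -> cfun F) a :
  nab X (fun c => u1 c + u2 c) a = nab X u1 a + nab X u2 a.
Proof.
rewrite /nab /nabla raddfD /=; under eq_bigr do rewrite mulrDr.
by rewrite big_split /=; ring.
Qed.

Lemma nab_torsion X (w : 'I_n -> cfun F) a : nab X (fun c => \sum_b torsion c b * w b) a
  = \sum_b (dtorsion a b X * w b + torsion a b * nabb X w b).
Proof.
have -> : \sum_b (dtorsion a b X * w b + torsion a b * nabb X w b) =
  \sum_b (d X (torsion a b * w b) - (\sum_c om a c X * torsion c b) * w b)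
  + (\sum_b torsion a b * (\sum_c om c b X * w c)
     - \sum_b (\sum_c torsion a c * om b c X) * w b).
  rewrite -sumrB -big_split; apply: eq_bigr => b _ /=.
  rewrite /dtorsion nabbE derM.
  rewrite (_ : \sum_c torsion a c * om b c X = \sum_c om b c X * torsion a c); last first.
    by apply: eq_bigr => c _; rewrite mulrC.
  ring.
rewrite (sum_sum_mul (torsion a) (fun b c => om c b X) w) subrr addr0.
by rewrite /nab /nabla raddf_sum sum_sum_mul sumrB.
Qed.

(** Torsion times Hessian comes once from the bracket of T with Zb_c and once from f_{0a} - f_{a0};
    the divergence of A comes once from the curvature [Om_TZb] and once from differentiating A in
    [nab_torsion]. *)
Lemma lap1_derT : lap1 g = d T (lap1 f)
  + \sum_a \sum_c (cjf F (torsion a c) * nab (Z c) u a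
                  + torsion a c * nabb (Zb c) v a)
  + \sum_a \sum_c (cjf F (dtorsion a c (Zb c)) * u a + dtorsion a c (Zb c) * v a).
Proof.
have Ew c : nab (Zb c) (fun a => d (Z a) g) c = nab (Zb c) (nab T u) c
  + \sum_a (dtorsion c a (Zb c) * v a + torsion c a * nabb (Zb c) v a).
  by rewrite (eq_nab _ _ grad_derT) nabD nab_torsion.
have E c : nab (Zb c) (nab T u) c = d T (nab (Zb c) u c)
   + \sum_a cjf F (torsion a c) * nab (Z a) u c
   + \sum_e cjf F (dtorsion e c (Zb c)) * u e
   + (\sum_a om a c T * nab (Zb a) u c - \sum_e om c e T * nab (Zb c) u e).
  have := nab_commute T (Zb c) u c.
  rewrite (brk_TZb _ (nab_tensorial _ _)) [nab T (nab (Zb c) u) c]/nab /nabla -/(nab _ _ _).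
  under [X in _ = _ - X -> _]eq_bigr do rewrite Om_TZb.
  move=> H; rewrite -[nab (Zb c) (nab T u) c](subKr
    (d T (nab (Zb c) u c) - \sum_e om c e T * nab (Zb c) u e)) {}H.
  ring.
rewrite [LHS](eq_bigr _ (fun c _ => Ew c)) big_split /= (eq_bigr _ (fun c _ => E c)).
rewrite !big_split /= sumrN [X in _ + (X - _) + _]exchange_big /= subrr addr0.
have swap (G H : 'I_n -> 'I_n -> cfun F) : \sum_a \sum_c (G a c + H a c) =
    \sum_c \sum_a G a c + \sum_c \sum_a H a c.
  by rewrite exchange_big -big_split; apply: eq_bigr => c _; rewrite big_split.
rewrite ![in RHS]swap -raddf_sum -!addrA; congr (_ + _).
have -> : \sum_c \sum_a cjf F (torsion a c) * nab (Z a) u c =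
    \sum_c \sum_a cjf F (torsion a c) * nab (Z c) u a.
  by apply: eq_bigr => c _; apply: eq_bigr => a _; rewrite hess_sym.
have -> : \sum_c \sum_a (dtorsion c a (Zb c) * v a + torsion c a * nabb (Zb c) v a) =
    \sum_c \sum_a dtorsion a c (Zb c) * v a
    + \sum_c \sum_a torsion a c * nabb (Zb c) v a.
  rewrite -big_split; apply: eq_bigr => c _; rewrite -big_split; apply: eq_bigr => a _ /=.
  by rewrite dtorsionC torsionC.
ring.
Qed.

End Function.

Lemma lapM f h : lap (f * h) = f * lap h + h * lap f
  + 2 * \sum_a (d (Z a) f * d (Zb a) h + d (Zb a) f * d (Z a) h).
Proof.
have E1 : lap1 (f * h) = f * lap1 h + h * lap1 f
    + \sum_a (d (Z a) f * d (Zb a) h + d (Zb a) f * d (Z a) h).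
  rewrite /lap1 !mulr_sumr -!big_split; apply: eq_bigr => c _ /=.
  rewrite /nab /nabla !derM raddfD /= !derM.
  rewrite (_ : \sum_e om c e (Zb c) * d (Z e) (f * h) =
    f * \sum_e om c e (Zb c) * d (Z e) h + h * \sum_e om c e (Zb c) * d (Z e) f).
    move: (\sum_e _) (\sum_e _) => s t; ring.
  by rewrite !mulr_sumr -big_split; apply: eq_bigr => e _ /=; rewrite derM; ring.
have E2 : lap2 (f * h) = f * lap2 h + h * lap2 f
    + \sum_a (d (Z a) f * d (Zb a) h + d (Zb a) f * d (Z a) h).
  rewrite /lap2 !mulr_sumr -!big_split; apply: eq_bigr => c _ /=.
  rewrite !nabbE !derM raddfD /= !derM.
  rewrite (_ : \sum_e om e c (Z c) * d (Zb e) (f * h) =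
    f * \sum_e om e c (Z c) * d (Zb e) h + h * \sum_e om e c (Z c) * d (Zb e) f).
    move: (\sum_e _) (\sum_e _) => s t; ring.
  by rewrite !mulr_sumr -big_split; apply: eq_bigr => e _ /=; rewrite derM; ring.
by rewrite /lap E1 E2; ring.
Qed.

End Calculus.

(** * The ring of smooth functions on an open set *)

(* Functions smooth on [U], made canonical by the value 0 outside [U]. *)
Record smooth_fun (R : realType) (d : nat) (M : topologicalType)
    (A : smooth_atlas R d M) (U : set M) (oU : open U) := SmoothFun {
  smooth_val :> M -> R[i] ;
  smooth_valP : csmooth_on A U smooth_val ;
  smooth_val0 : forall p, ~ U p -> smooth_val p = 0 }.

(** Unlike functions, fields are not normalized outside [U]: the equalities needed between them
    ([vf_conjK], [vf_conj_bracket], [vf_conj_reeb]) hold at all points of [M]. *)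
Record vector_field (R : realType) (d : nat) (M : topologicalType)
    (A : smooth_atlas R d M) (U : set M) := VectorField {
  vector_val :> M -> cvec R M ;
  vector_valP : vfield_on A U vector_val }.

Section SmoothRing.
Variables (R : realType) (d : nat) (M : topologicalType) (A : smooth_atlas R d M).
Variables (U : set M) (oU : open U).
Local Notation SF := (smooth_fun A oU).
Local Notation VF := (vector_field A U).
Implicit Types (f g h : SF) (p : M) (X Y W : VF).

HB.instance Definition _ := gen_eqMixin SF.
HB.instance Definition _ := gen_choiceMixin SF.

Lemma smooth_funP f g : (forall p, U p -> f p = g p) -> f = g.
Proof.
case: f g => [f sf f0] [g sg g0] /= fg.
have E : f = g.
  by apply: funext => p; have [/fg//|nU] := pselect (U p); rewrite f0 // g0.
by rewrite E in sf f0 *; congr SmoothFun; exact: Prop_irrelevance.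
Qed.

Definition extend0 (f : M -> R[i]) p := if `[< U p >] then f p else 0.

Lemma extend0_csmooth (f : M -> R[i]) : csmooth_on A U f -> csmooth_on A U (extend0 f).
Proof. by apply: csmooth_on_eq => // p Up; rewrite /extend0 asboolT. Qed.

Lemma extend0_out (f : M -> R[i]) p : ~ U p -> extend0 f p = 0.
Proof. by move=> nU; rewrite /extend0 asboolF. Qed.

(* junk value 0 when [f] is not smooth on [U] *)
Definition to_smooth (f : M -> R[i]) : SF :=
  match pselect (csmooth_on A U f) with
  | left sf => SmoothFun oU (extend0_csmooth sf) (@extend0_out f)
  | right _ => SmoothFun oU (extend0_csmooth (csmooth_on_cst A U 0)) (@extend0_out _)
  end.

Lemma to_smoothE (f : M -> R[i]) p : csmooth_on A U f -> U p -> to_smooth f p = f p.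
Proof.
by move=> sf Up; rewrite /to_smooth; case: pselect => //= sf'; rewrite /extend0 asboolT.
Qed.

Definition sf_add f g := to_smooth (fun p => f p + g p).
Definition sf_opp f := to_smooth (fun p => - f p).
Definition sf_mul f g := to_smooth (fun p => f p * g p).
Definition sf_cst (c : R[i]) := to_smooth (fun=> c).

Lemma sf_addE f g p : U p -> sf_add f g p = f p + g p.
Proof. by apply: to_smoothE; apply: csmooth_onD => //; exact: smooth_valP. Qed.

Lemma sf_oppE f p : U p -> sf_opp f p = - f p.
Proof. by apply: to_smoothE; apply: csmooth_onN => //; exact: smooth_valP. Qed.

Lemma sf_mulE f g p : U p -> sf_mul f g p = f p * g p.
Proof. by apply: to_smoothE; apply: csmooth_onM => //; exact: smooth_valP. Qed.

Lemma sf_cstE c p : U p -> sf_cst c p = c.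
Proof. by apply: to_smoothE; exact: csmooth_on_cst. Qed.

Definition sfE := (sf_addE, sf_oppE, sf_mulE, sf_cstE).

Lemma sf_addA : associative sf_add.
Proof. by move=> f g h; apply: smooth_funP => p Up; rewrite !sfE // addrA. Qed.
Lemma sf_addC : commutative sf_add.
Proof. by move=> f g; apply: smooth_funP => p Up; rewrite !sfE // addrC. Qed.
Lemma sf_add0 : left_id (sf_cst 0) sf_add.
Proof. by move=> f; apply: smooth_funP => p Up; rewrite !sfE // add0r. Qed.
Lemma sf_addN : left_inverse (sf_cst 0) sf_opp sf_add.
Proof. by move=> f; apply: smooth_funP => p Up; rewrite !sfE // addNr. Qed.
HB.instance Definition _ := GRing.isZmodule.Build SF sf_addA sf_addC sf_add0 sf_addN.

Lemma sf_mulA : associative sf_mul.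
Proof. by move=> f g h; apply: smooth_funP => p Up; rewrite !sfE // mulrA. Qed.
Lemma sf_mulC : commutative sf_mul.
Proof. by move=> f g; apply: smooth_funP => p Up; rewrite !sfE // mulrC. Qed.
Lemma sf_mul1 : left_id (sf_cst 1) sf_mul.
Proof. by move=> f; apply: smooth_funP => p Up; rewrite !sfE // mul1r. Qed.
Lemma sf_mulDl : left_distributive sf_mul sf_add.
Proof. by move=> f g h; apply: smooth_funP => p Up; rewrite !sfE // mulrDl. Qed.
HB.instance Definition _ :=
  GRing.Zmodule_isComPzRing.Build SF sf_mulA sf_mulC sf_mul1 sf_mulDl.

Section Evaluation.
Variables (p : M) (Up : U p).

Lemma val_add f g : (f + g) p = f p + g p. Proof. exact: sf_addE. Qed.
Lemma val_opp f : (- f) p = - f p. Proof. exact: sf_oppE. Qed.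
Lemma val_sub f g : (f - g) p = f p - g p. Proof. by rewrite val_add val_opp. Qed.
Lemma val_mul f g : (f * g) p = f p * g p. Proof. exact: sf_mulE. Qed.
Lemma val_zero : (0 : SF) p = 0. Proof. exact: sf_cstE. Qed.
Lemma val_cst c : sf_cst c p = c. Proof. exact: sf_cstE. Qed.
Lemma val_one : (1 : SF) p = 1. Proof. exact: sf_cstE. Qed.

Lemma val_natmul k f : (f *+ k) p = f p *+ k.
Proof. by elim: k => [|k IH]; rewrite ?mulr0n ?val_zero // !mulrS val_add IH. Qed.

Lemma val_nat k : (k%:R : SF) p = k%:R.
Proof. by rewrite val_natmul val_one. Qed.

Lemma val_sum (I : Type) (r : seq I) (P : pred I) (G : I -> SF) :
  (\sum_(i <- r | P i) G i) p = \sum_(i <- r | P i) G i p.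
Proof. by apply: (big_morph (fun f : SF => f p)); [exact: val_add|exact: val_zero]. Qed.

Definition valE := (val_add, val_opp, val_mul, val_zero, val_one, val_nat, val_sum, val_cst).

End Evaluation.

Definition sf_conj f := to_smooth (fun p => (f p)^*).

Lemma sf_conjE f p : U p -> sf_conj f p = (f p)^*.
Proof. by apply: to_smoothE; apply: csmooth_on_conj => //; exact: smooth_valP. Qed.

Lemma sf_conj_zmod_morphism : zmod_morphism sf_conj.
Proof.
by move=> f g; apply: smooth_funP => p Up; rewrite val_sub // !sf_conjE // val_sub // rmorphB.
Qed.
HB.instance Definition _ := GRing.isZmodMorphism.Build SF SF sf_conj sf_conj_zmod_morphism.

Lemma sf_conj_monoid_morphism : monoid_morphism sf_conj.
Proof.
split=> [|f g]; apply: smooth_funP => p Up.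
  by rewrite sf_conjE // !val_one // rmorph1.
by rewrite val_mul // !sf_conjE // val_mul // rmorphM.
Qed.
HB.instance Definition _ := GRing.isMonoidMorphism.Build SF SF sf_conj sf_conj_monoid_morphism.

Lemma sf_conjK : involutive sf_conj.
Proof. by move=> f; apply: smooth_funP => p Up; rewrite !sf_conjE // conjCK. Qed.

Lemma near_smooth (h : M -> R[i]) p : csmooth_on A U h -> U p -> csmooth_near A p h.
Proof. by exists U. Qed.

Lemma near_smooth_val f p : U p -> csmooth_near A p f.
Proof. by move=> Up; apply: near_smooth => //; exact: smooth_valP. Qed.

Lemma vector_tangent X p : U p -> tangent A p (X p).
Proof. by case: (vector_valP X) => tX _; exact: tX. Qed.

(** A ring element agrees with the function it encodes only on [U]; as [U] is open, derivatives at
    its points cannot distinguish them. *)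
Lemma vector_local X p (h k : M -> R[i]) : U p -> csmooth_on A U h ->
  (forall q, U q -> h q = k q) -> X p h = X p k.
Proof.
move=> Up sh hk; have [_ _ e _] := vector_tangent X Up; apply: e.
- exact: near_smooth.
- by apply: near_smooth => //; exact: csmooth_on_eq sh.
- by apply: filterS (near_U oU Up) => q /hk.
Qed.

Definition sf_der X f := to_smooth (fun p => X p f).

Lemma sf_derE X f p : U p -> sf_der X f p = X p f.
Proof.
apply: to_smoothE; have [_ sX] := vector_valP X.
by apply: sX => //; exact: smooth_valP.
Qed.

Lemma sf_der_zmod_morphism X : zmod_morphism (sf_der X).
Proof.
move=> f g; apply: smooth_funP => p Up; rewrite val_sub // !sf_derE //.
rewrite -(tangentB (vector_tangent X Up)); try exact: near_smooth_val.
apply: vector_local => //; first exact: smooth_valP.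
by move=> q Uq; rewrite val_sub.
Qed.
HB.instance Definition _ X :=
  GRing.isZmodMorphism.Build SF SF (sf_der X) (sf_der_zmod_morphism X).

Lemma sf_derM X f g : sf_der X (f * g) = f * sf_der X g + g * sf_der X f.
Proof.
apply: smooth_funP => p Up; rewrite val_add // !val_mul // !sf_derE //.
have [_ leib _ _] := vector_tangent X Up; rewrite -leib; try exact: near_smooth_val.
apply: vector_local => //; first exact: smooth_valP.
by move=> q Uq; rewrite val_mul.
Qed.

Lemma sf_der_cst X c : sf_der X (sf_cst c) = 0.
Proof.
apply: smooth_funP => p Up; rewrite val_zero // sf_derE //.
rewrite -(tangent_cst c (vector_tangent X Up)).
by apply: vector_local => //; [exact: smooth_valP|move=> q Uq; rewrite sf_cstE].
Qed.

Definition vf_bracket X Y : VF :=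
  VectorField (vfield_on_bracket oU (vector_valP X) (vector_valP Y)).

Definition vf_conj X : VF := VectorField (vfield_on_conj (vector_valP X)).

Lemma vector_fieldP X Y : (forall p, X p = Y p) -> X = Y.
Proof.
case: X Y => [X vX] [Y vY] /= XY; have E : X = Y by apply: funext.
by rewrite E in vX *; congr VectorField; exact: Prop_irrelevance.
Qed.

Lemma vf_conjK : involutive vf_conj.
Proof. by move=> X; apply: vector_fieldP => p; exact: conjvK. Qed.

Lemma sf_conj_der X f : sf_conj (sf_der X f) = sf_der (vf_conj X) (sf_conj f).
Proof.
apply: smooth_funP => p Up; rewrite sf_conjE // !sf_derE //; congr (_^*).
apply: vector_local => //; first exact: smooth_valP.
by move=> q Uq; rewrite sf_conjE // conjCK.
Qed.

Lemma sf_der_bracket X Y f :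
  sf_der (vf_bracket X Y) f = sf_der X (sf_der Y f) - sf_der Y (sf_der X f).
Proof.
apply: smooth_funP => p Up; rewrite val_sub // !sf_derE // [LHS]bracketE.
  by congr (_ - _); apply: vector_local => //; try (move=> q Uq; rewrite sf_derE //);
   (have [_ sm] := vector_valP X; have [_ sm'] := vector_valP Y);
   (try apply: sm => //); (try apply: sm' => //); exact: smooth_valP.
exact: near_smooth_val.
Qed.

Lemma vf_conj_bracket X Y : vf_conj (vf_bracket X Y) = vf_bracket (vf_conj X) (vf_conj Y).
Proof.
apply: vector_fieldP => p; apply: funext => f /=; rewrite /conjF /conjv /bracket.
have [sf|nsf] := pselect (csmooth_near A p f).
  rewrite !asboolT //; last exact: csmooth_near_conj.
  rewrite rmorphB /=; congr (_^* - _^*);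
    by congr (vector_val _ _ _); apply: funext => q; rewrite conjCK.
rewrite !asboolF ?rmorph0 // => /csmooth_near_conjE; exact: nsf.
Qed.

Definition sf_form (eta : cform R M) X := to_smooth (fun p => eta p (X p)).

Section Forms.
Variable eta : cform R M.
Hypothesis form_eta : form_on A U eta.

Lemma form_csmooth X : csmooth_on A U (fun p => eta p (X p)).
Proof. by case: form_eta => _ sm; apply: sm => //; exact: vector_valP. Qed.

Lemma sf_formE X p : U p -> sf_form eta X p = eta p (X p).
Proof. by apply: to_smoothE; exact: form_csmooth. Qed.

Lemma sf_der_form X Y p : U p -> sf_der X (sf_form eta Y) p = X p (fun q => eta q (Y q)).
Proof.
move=> Up; rewrite sf_derE //; apply: vector_local => //; first exact: smooth_valP.
by move=> q Uq; rewrite sf_formE.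
Qed.

Lemma sf_extd X Y p : U p -> (sf_der X (sf_form eta Y) - sf_der Y (sf_form eta X)
   - sf_form eta (vf_bracket X Y)) p = extd A eta X Y p.
Proof. by move=> Up; rewrite !val_sub // !sf_der_form // sf_formE. Qed.

Lemma form_vzero p : U p -> eta p (@vzero R M) = 0.
Proof.
move=> Up; have [lin _] := form_eta.
have t0 := tangent_vzero A p; have := lin p (-1) _ _ Up t0 t0.
rewrite (_ : vlin _ _ _ = @vzero R M); first by rewrite mulN1r addNr.
by apply: funext => f; rewrite /vlin /vzero mulr0 addr0.
Qed.

Lemma sf_form_jacobi X Y W : sf_form eta (vf_bracket X (vf_bracket Y W))
  + sf_form eta (vf_bracket Y (vf_bracket W X))
  + sf_form eta (vf_bracket W (vf_bracket X Y)) = 0.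
Proof.
apply: smooth_funP => p Up; rewrite !val_add // val_zero // !sf_formE //.
have [lin _] := form_eta; rewrite -(form_vzero Up).
rewrite -(bracket_jacobi oU (vector_valP X) (vector_valP Y) (vector_valP W) Up).
have tb X1 Y1 := vector_tangent (vf_bracket X1 Y1) Up.
rewrite !lin //; try exact: (tb _ (vf_bracket _ _)).
  by rewrite !mul1r addrA.
by apply: tangent_vlin; exact: (tb _ (vf_bracket _ _)).
Qed.

Lemma sf_form_bracketC X Y :
  sf_form eta (vf_bracket X Y) = - sf_form eta (vf_bracket Y X).
Proof.
apply: smooth_funP => p Up; rewrite val_opp // !sf_formE //.
have [lin _] := form_eta.
have := lin p (-1) _ _ Up (vector_tangent (vf_bracket Y X) Up) (tangent_vzero A p).
rewrite form_vzero // addr0 mulN1r => <-; congr (eta p _); apply: funext => f.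
by rewrite /vlin /vzero addr0 mulN1r /= /bracket; case: asbool; rewrite ?opprB ?oppr0.
Qed.

End Forms.

Lemma tangent_sum (I : Type) (s : seq I) p (c : I -> R[i]) (w : I -> cvec R M) :
  (forall a, tangent A p (w a)) -> tangent A p (fun phi => \sum_(a <- s) c a * w a phi).
Proof.
move=> tw; elim: s => [|a s IH].
  rewrite (_ : (fun _ => _) = @vzero R M); first exact: tangent_vzero.
  by apply: funext => f; rewrite big_nil.
rewrite (_ : (fun _ => _) = vlin (c a) (w a) (fun phi => \sum_(a <- s) c a * w a phi)).
  by apply: tangent_vlin.
by apply: funext => f; rewrite big_cons.
Qed.

Lemma form_sum eta (I : Type) (s : seq I) p (c : I -> R[i]) (w : I -> cvec R M) :
  form_on A U eta -> U p -> (forall a, tangent A p (w a)) ->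
  eta p (fun phi => \sum_(a <- s) c a * w a phi) = \sum_(a <- s) c a * eta p (w a).
Proof.
move=> feta Up tw; have [lin _] := feta; elim: s => [|a s IH].
  rewrite big_nil -[RHS](form_vzero feta Up); congr (eta p _).
  by apply: funext => f; rewrite big_nil.
rewrite big_cons -IH -lin //; last exact: tangent_sum.
by congr (eta p _); apply: funext => f; rewrite big_cons.
Qed.

End SmoothRing.

(** * The frame of a pseudohermitian manifold *)

Section FrameOfData.
Variables (R : realType) (n : nat) (M : topologicalType) (P : pseudohermitian R n M).
Variables (T : cfield R M) (T_reeb : is_reeb P T) (D : tw_data R n M).
Hypothesis tw : tw_frame P T D.

Local Notation U := (fr_dom D).
Local Notation th := (ph_theta P).
Local Notation A := (ph_atlas P).
Let oU : open U := tw_open tw.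
Local Notation SF := (smooth_fun A oU).
Local Notation VF := (vector_field A U).

Lemma reeb_vfield : vfield_on A U T.
Proof. by case: T_reeb => vT _ _ _; apply: vfield_onS vT. Qed.

Definition vf_reeb : VF := VectorField reeb_vfield.
Definition vf_Z a : VF := VectorField (tw_section tw a).1.

Lemma theta_form : form_on A U th.
Proof. by case: (ph_contact P) => fth _ _ _; apply: form_onS fth. Qed.

Lemma theta_conj p v : tangent A p v -> th p (conjv v) = (th p v)^*.
Proof. by case: (ph_contact P) => _ + _ _; apply. Qed.

Lemma T10_theta p v : in_T10 A th (ph_J P) p v -> th p v = 0.
Proof. by case=> -[]. Qed.

Lemma theta_Z a p : U p -> th p (fr_Z D a p) = 0.
Proof. by move=> Up; apply: T10_theta; exact: (tw_section tw a).2. Qed.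

Lemma theta_T p : th p (T p) = 1.
Proof. by case: T_reeb. Qed.

Lemma conjv_T p : conjv (T p) = T p.
Proof. by case: T_reeb. Qed.

Lemma tangent_Z a p : U p -> tangent A p (fr_Z D a p).
Proof. exact: (vector_tangent (vf_Z a)). Qed.

Lemma tangent_T p : U p -> tangent A p (T p).
Proof. exact: (vector_tangent vf_reeb). Qed.

Definition span3 p (t : R[i]) (c e : 'I_n -> R[i]) : cvec R M :=
  vlin t (T p) (vlin 1 (fun phi => \sum_a c a * fr_Z D a p phi)
                       (fun phi => \sum_a e a * conjv (fr_Z D a p) phi)).

Lemma form_span3 eta p t c e : form_on A U eta -> U p ->
  eta p (span3 p t c e) = t * eta p (T p) + \sum_a c a * eta p (fr_Z D a p)
    + \sum_a e a * eta p (conjv (fr_Z D a p)).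
Proof.
move=> feta Up; have [lin _] := feta.
have tZ a := tangent_Z a Up; have tZb a := tangent_conj (tZ a).
rewrite /span3 lin //; [|exact: tangent_T|by apply: tangent_vlin; exact: tangent_sum].
rewrite lin //; [|exact: tangent_sum..].
by rewrite !(form_sum _ _ feta Up) // mul1r addrA.
Qed.

(** The vector v - i J v is twice the (1,0) projection of v, since J squares to -1. *)
Lemma T10_part p v : in_xi A th p v ->
  in_T10 A th (ph_J P) p (vlin (- 'i) (ph_J P p v) v).
Proof.
move=> xv; have [Jxi Jlin _ JJ _] := ph_almost_complex P.
have xJ := Jxi _ _ xv; have [tv thv] := xv; have [tJ thJ] := xJ; split.
  split; first exact: tangent_vlin.
  have [[lin _] _ _ _] := ph_contact P.
  by rewrite lin // thv thJ mulr0 addr0.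
rewrite Jlin // JJ //; apply: funext => f; rewrite /vlin /vzero.
have := sqrCi R[i]; rewrite expr2 => ii.
rewrite !addr0 (_ : 'i * _ = - ('i * 'i) * ph_J P p v f + 'i * v f); last by ring.
by rewrite ii; ring.
Qed.

(** After removing the T component, J splits the rest [w]. Its (0,1) part is reached by applying the
    (1,0) projection to the conjugate of [w] and conjugating back. *)
Lemma tangent_span3 p v : U p -> tangent A p v -> exists t c e, v = span3 p t c e.
Proof.
move=> Up tv; have [lin _] := theta_form.
have tT := tangent_T Up.
pose w := vlin (- th p v) (T p) v.
have xw : in_xi A th p w.
  by split; [exact: tangent_vlin|rewrite lin // theta_T mulr1 addNr].
have xw' : in_xi A th p (conjv w).
  split; first exact/tangent_conj/xw.1.
  by rewrite theta_conj ?xw.2 ?rmorph0 //; exact: xw.1.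
have [_ _ Jc _ _] := ph_almost_complex P.
have [c Ec] := tw_span tw Up (T10_part xw).
have [e Ee] := tw_span tw Up (T10_part xw').
(* The halves compensate for [T10_part] giving twice the projection. *)
exists (th p v), (fun a => c a / 2), (fun a => (e a)^* / 2).
apply: funext => f; rewrite /span3 /vlin mul1r.
have -> : v f = th p v * T p f + w f by rewrite /w /vlin; ring.
congr (_ + _).
have E1 : \sum_a c a / 2 * fr_Z D a p f = (- 'i * ph_J P p w f + w f) / 2.
  rewrite -[- 'i * _ + _]/(vlin (- 'i) (ph_J P p w) w f) Ec mulr_suml.
  by apply: eq_bigr => a _; ring.
have E2 : \sum_a (e a)^* / 2 * conjv (fr_Z D a p) f = ('i * ph_J P p w f + w f) / 2.
  have := congr1 (fun u : cvec R M => (u (fun q => (f q)^*))^*) Ee.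
  rewrite /vlin (Jc _ _ xw) rmorphD rmorphM /= rmorphN /= conjCi opprK.
  have cf u : (conjv u (fun q => (f q)^*))^* = u f :> R[i].
    by rewrite -[u in RHS](@conjvK R M).
  rewrite !cf => ->; rewrite rmorph_sum mulr_suml.
  by apply: eq_bigr => a _; rewrite rmorphM /= -mulrA mulrC -!mulrA /conjv; ring.
by rewrite E1 E2; field.
Qed.

Lemma tangent_decomp p v : U p -> tangent A p v ->
  v = span3 p (th p v) (fun a => fr_co D a p v) (fun a => conjform (fr_co D a) p v).
Proof.
move=> Up tv; have [t [c [e Ev]]] := tangent_span3 Up tv.
have Et : th p v = t.
  rewrite Ev (form_span3 _ _ _ theta_form Up) theta_T mulr1.
  rewrite !big1 ?addr0 // => a _; last by rewrite theta_Z // mulr0.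
  by rewrite theta_conj ?theta_Z ?rmorph0 ?mulr0 //; exact: tangent_Z.
have Ec a : fr_co D a p v = c a.
  rewrite Ev (form_span3 _ _ _ (tw_co_form tw a) Up) (tw_co_T tw) // mulr0 add0r.
  rewrite [X in _ + X]big1 ?addr0 => [|b _]; last by rewrite (tw_co_Zbar tw) // mulr0.
  under eq_bigr do rewrite (tw_co_Z tw) // mulrC.
  by rewrite sum_deltar.
have Ee a : conjform (fr_co D a) p v = e a.
  rewrite Ev (form_span3 _ _ _ (form_on_conj (tw_co_form tw a)) Up).
  rewrite /conjform conjv_T (tw_co_T tw) // rmorph0 mulr0 add0r.
  rewrite [X in X + _]big1 ?add0r => [|b _]; last first.
    by rewrite (tw_co_Zbar tw) // rmorph0 mulr0.
  under eq_bigr do rewrite conjvK (tw_co_Z tw) // rmorph_nat mulrC.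
  by rewrite sum_deltar.
by rewrite {1}Ev Et; congr (span3 _ _ _ _); apply: funext => a; rewrite ?Ec ?Ee.
Qed.

Local Notation ev := (@sf_form R n.*2.+1 M A U oU).

Definition sf_tensorial (L : VF -> SF) := forall X, L X =
    ev th X * L vf_reeb + \sum_a ev (fr_co D a) X * L (vf_Z a)
    + \sum_a sf_conj (ev (fr_co D a) (vf_conj X)) * L (vf_conj (vf_Z a)).

Lemma sf_conj_form eta X : form_on A U eta ->
  sf_conj (ev eta X) = ev (conjform eta) (vf_conj X).
Proof.
move=> feta; apply: smooth_funP => p Up.
rewrite sf_conjE // !sf_formE //; last exact: form_on_conj.
by rewrite /conjform /= /conjF conjvK.
Qed.

Lemma sf_form_tensorial eta : form_on A U eta -> sf_tensorial (ev eta).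
Proof.
move=> feta X; apply: smooth_funP => p Up; have tX := vector_tangent X Up.
rewrite !valE // sf_formE // {1}(tangent_decomp Up tX) form_span3 //.
rewrite !sf_formE //; last exact: theta_form.
congr (_ + _ + _); apply: eq_bigr => a _; rewrite valE // !sf_formE //.
  exact: (tw_co_form tw a).
rewrite sf_conj_form; last exact: (tw_co_form tw a).
rewrite sf_formE //; last exact/form_on_conj/(tw_co_form tw a).
by rewrite vf_conjK.
Qed.

Lemma sf_der_tensorial (f : SF) : sf_tensorial (fun X => sf_der X f).
Proof.
move=> X; apply: smooth_funP => p Up; have tX := vector_tangent X Up.
rewrite !valE // !sf_derE // {1}(tangent_decomp Up tX) /span3 /vlin mul1r addrA.
rewrite sf_formE //; last exact: theta_form.
congr (_ + _ + _); apply: eq_bigr => a _; rewrite valE // sf_derE // .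
  by rewrite sf_formE //; exact: (tw_co_form tw a).
rewrite sf_conj_form; last exact: (tw_co_form tw a).
rewrite sf_formE //; last exact/form_on_conj/(tw_co_form tw a).
by rewrite vf_conjK.
Qed.

Let fth := theta_form.
Let fco := tw_co_form tw.

Lemma sf_th_Z a : ev th (vf_Z a) = 0.
Proof. by apply: smooth_funP => p Up; rewrite sf_formE // valE //= theta_Z. Qed.

Lemma sf_th_Zb a : ev th (vf_conj (vf_Z a)) = 0.
Proof.
apply: smooth_funP => p Up; rewrite sf_formE // valE //= /conjF theta_conj.
  by rewrite theta_Z // rmorph0.
exact: tangent_Z.
Qed.

Lemma sf_th_T : ev th vf_reeb = 1.
Proof. by apply: smooth_funP => p Up; rewrite sf_formE // valE //= theta_T. Qed.

Lemma vf_conj_reeb : vf_conj vf_reeb = vf_reeb.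
Proof. by apply: vector_fieldP => p /=; rewrite /conjF conjv_T. Qed.

Lemma sf_der_one (X : VF) : sf_der X 1 = 0 :> SF.
Proof. exact: sf_der_cst. Qed.

(** When theta(X) and theta(Y) are constant, only the bracket term of d theta survives. This
    transfers the Reeb condition and the Levi form to brackets. *)
Lemma sf_th_bracket X Y : (forall Z, sf_der Z (ev th X) = 0) ->
  (forall Z, sf_der Z (ev th Y) = 0) -> forall p, U p ->
  ev th (vf_bracket oU X Y) p = - extd A th X Y p.
Proof.
by move=> cX cY p Up; rewrite -(sf_extd oU fth X Y Up) cX cY subrr sub0r val_opp // opprK.
Qed.

Lemma bracket_ZZ_T10 a b p : U p ->
  in_T10 A th (ph_J P) p (bracket A (fr_Z D a) (fr_Z D b) p).
Proof. by apply: (ph_integrable oU (tw_section tw a) (tw_section tw b)).2. Qed.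

(** By integrability this bracket is the conjugate of a combination of the Z fields, and theta^c
    kills their conjugates. *)
Lemma sf_co_bracket_ZbZb c a b :
  ev (fr_co D c) (vf_bracket oU (vf_conj (vf_Z a)) (vf_conj (vf_Z b))) = 0.
Proof.
rewrite -vf_conj_bracket; apply: smooth_funP => p Up.
rewrite sf_formE // valE //=.
have [e E] := tw_span tw Up (bracket_ZZ_T10 a b Up).
rewrite /conjF /= E -[LHS]conjCK -/(conjform (fr_co D c) p _).
rewrite (form_sum _ _ (form_on_conj (fco c)) Up); last by move=> i; exact: tangent_Z.
rewrite big1 ?rmorph0 // => i _.
by rewrite /conjform (tw_co_Zbar tw) // rmorph0 mulr0.
Qed.

Lemma sf_structure b (X Y : VF) :
  sf_der X (ev (fr_co D b) Y) - sf_der Y (ev (fr_co D b) X) - ev (fr_co D b) (vf_bracket oU X Y)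
  = \sum_a (ev (fr_co D a) X * ev (fr_om D a b) Y - ev (fr_co D a) Y * ev (fr_om D a b) X)
    + (ev th X * ev (fr_tau D b) Y - ev th Y * ev (fr_tau D b) X).
Proof.
apply: smooth_funP => p Up; rewrite sf_extd //.
rewrite (tw_structure tw b oU (@subset_refl _ U) (vector_valP X) (vector_valP Y) Up).
rewrite valE // [X in _ = X + _]valE //; congr (_ + _).
  apply: eq_bigr => a _; rewrite val_sub // !val_mul // !sf_formE //; exact: (tw_om_form tw).
by rewrite val_sub // !val_mul // !sf_formE //; exact: (tw_tau_form tw).
Qed.

(** In the torsion identity on (Zb_b, Z_a) the coframe leaves only tau_a on Zb_b, the conjugate of
    tau^a on Z_b. The pairs (T, Z_a) and (Z_b, Z_a) give the next two facts in the same way. *)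
Lemma tau_low_Zb a b p : U p -> fr_tau D a p (fr_Z D b p) = 0.
Proof.
move=> Up; have := tw_torsion tw oU (@subset_refl _ U) (vector_valP (vf_conj (vf_Z b)))
  (vector_valP (vf_Z a)) Up.
rewrite /wedge sumrB /= /conjF.
under eq_bigr do rewrite (tw_co_Z tw) // mulrC.
rewrite sum_deltal big1 ?subr0 => [|c _]; last by rewrite (tw_co_Zbar tw) // mulr0.
rewrite /tau_low /conjform conjvK => /(congr1 Num.conj).
by rewrite conjCK rmorph0.
Qed.

Lemma tau_reeb a p : U p -> fr_tau D a p (T p) = 0.
Proof.
move=> Up; have := tw_torsion tw oU (@subset_refl _ U) (vector_valP vf_reeb)
  (vector_valP (vf_Z a)) Up.
rewrite /wedge sumrB /=.
under eq_bigr do rewrite (tw_co_Z tw) // mulrC.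
rewrite sum_deltal big1 ?subr0 => [|c _]; last by rewrite (tw_co_T tw) // mulr0.
rewrite /tau_low /conjform conjv_T => /(congr1 Num.conj).
by rewrite conjCK rmorph0.
Qed.

Lemma tau_sym a b p : U p ->
  fr_tau D a p (conjv (fr_Z D b p)) = fr_tau D b p (conjv (fr_Z D a p)).
Proof.
move=> Up; have := tw_torsion tw oU (@subset_refl _ U) (vector_valP (vf_Z b))
  (vector_valP (vf_Z a)) Up.
rewrite /wedge sumrB /=.
under eq_bigr do rewrite (tw_co_Z tw) // mulrC.
under [X in _ - X]eq_bigr do rewrite (tw_co_Z tw) // mulrC.
rewrite !sum_deltal /tau_low /conjform => /eqP; rewrite subr_eq0 => /eqP.
by move=> /(congr1 Num.conj); rewrite !conjCK.
Qed.

Lemma sf_conj_theta X : sf_conj (ev th X) = ev th (vf_conj X).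
Proof.
apply: smooth_funP => p Up; rewrite sf_conjE // !sf_formE //= /conjF theta_conj //.
exact: vector_tangent.
Qed.

Lemma sf_conj_im : sf_conj (sf_cst A oU 'i) = - sf_cst A oU 'i.
Proof. by apply: smooth_funP => p Up; rewrite sf_conjE // !valE // conjCi. Qed.

Lemma sf_co_Z a b : ev (fr_co D a) (vf_Z b) = (a == b)%:R.
Proof.
by apply: smooth_funP => p Up; rewrite sf_formE // val_nat //= (tw_co_Z tw).
Qed.

Lemma sf_co_Zb a b : ev (fr_co D a) (vf_conj (vf_Z b)) = 0.
Proof.
by apply: smooth_funP => p Up; rewrite sf_formE // val_zero //= /conjF (tw_co_Zbar tw).
Qed.

Lemma sf_co_T a : ev (fr_co D a) vf_reeb = 0.
Proof.
by apply: smooth_funP => p Up; rewrite sf_formE // val_zero //= (tw_co_T tw).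
Qed.

Lemma sf_th_bracketTZ a : ev th (vf_bracket oU vf_reeb (vf_Z a)) = 0.
Proof.
apply: smooth_funP => p Up; rewrite sf_th_bracket //; last first.
- by move=> X; rewrite sf_th_Z raddf0.
- by move=> X; rewrite sf_th_T sf_der_one.
have [_ _ _ dT] := T_reeb.
by rewrite (dT _ _ _ oU (vector_valP (vf_Z a)) Up) oppr0 val_zero.
Qed.

Lemma sf_th_bracketZZ a b : ev th (vf_bracket oU (vf_Z a) (vf_Z b)) = 0.
Proof.
apply: smooth_funP => p Up; rewrite sf_formE // val_zero //.
by apply: T10_theta; exact: bracket_ZZ_T10.
Qed.

Lemma sf_th_bracketZZb a b : ev th (vf_bracket oU (vf_Z a) (vf_conj (vf_Z b)))
  = - (sf_cst A oU 'i * (a == b)%:R).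
Proof.
apply: smooth_funP => p Up; rewrite sf_th_bracket //; last first.
- by move=> X; rewrite sf_th_Zb raddf0.
- by move=> X; rewrite sf_th_Z raddf0.
rewrite !valE //; congr (- _); rewrite -(tw_unitary tw a b Up) /levi mulrA mulrN.
by rewrite -expr2 sqrCi opprK mul1r.
Qed.

Lemma sf_om_skew a b X :
  sf_conj (ev (fr_om D a b) X) = - ev (fr_om D b a) (vf_conj X).
Proof.
apply: smooth_funP => p Up; rewrite sf_conjE // valE //.
rewrite !sf_formE //; try exact: (tw_om_form tw).
apply/eqP; rewrite -addr_eq0 addrC; apply/eqP.
rewrite -[RHS](tw_skew tw b a Up (vector_tangent (vf_conj X) Up)) /conjform /=.
by rewrite /conjF conjvK.
Qed.

Lemma sf_tau_Z a b : ev (fr_tau D a) (vf_Z b) = 0.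
Proof.
apply: smooth_funP => p Up; rewrite sf_formE ?val_zero //=; last exact: (tw_tau_form tw).
exact: tau_low_Zb.
Qed.

Lemma sf_tau_T a : ev (fr_tau D a) vf_reeb = 0.
Proof.
apply: smooth_funP => p Up; rewrite sf_formE ?val_zero //=; last exact: (tw_tau_form tw).
exact: tau_reeb.
Qed.

Lemma sf_tau_sym a b :
  ev (fr_tau D a) (vf_conj (vf_Z b)) = ev (fr_tau D b) (vf_conj (vf_Z a)).
Proof.
apply: smooth_funP => p Up; rewrite !sf_formE //=; try exact: (tw_tau_form tw).
exact: tau_sym.
Qed.

Definition frame_of : crFrame n :=
  @CRFrame n SF VF (fun X => sf_der X) (@vf_bracket _ _ _ A _ oU)
  (@sf_conj _ _ _ A U oU) (@vf_conj _ _ _ A U) (sf_cst A oU 'i) vf_Z vf_reeb (ev th)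
  (fun a => ev (fr_co D a)) (fun a b => ev (fr_om D a b)) (fun a => ev (fr_tau D a))
  (@sf_derM _ _ _ _ _ oU) (@sf_der_bracket _ _ _ _ _ oU) (@sf_conjK _ _ _ _ _ oU)
  (@vf_conjK _ _ _ _ _) (@sf_conj_der _ _ _ _ _ oU) (@vf_conj_bracket _ _ _ _ _ oU)
  vf_conj_reeb sf_conj_theta (fun X => sf_der_cst oU X 'i) sf_conj_im
  sf_der_tensorial (fun a b => sf_form_tensorial (tw_om_form tw a b))
  (fun a => sf_form_tensorial (tw_tau_form tw a))
  sf_th_Z sf_th_T sf_co_Z sf_co_Zb sf_co_T (sf_form_bracketC oU fth)
  sf_th_bracketTZ sf_th_bracketZZ sf_th_bracketZZb sf_co_bracket_ZbZb
  sf_structure (fun b => sf_form_jacobi oU (fco b)) sf_om_skew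
  sf_tau_Z sf_tau_T sf_tau_sym.

End FrameOfData.

(** * The operators of the curvature-dimension inequality as elements of the ring *)

Section Operators.
Variables (R : realType) (n : nat) (M : topologicalType) (P : pseudohermitian R n M).
Variables (T : cfield R M) (T_reeb : is_reeb P T) (D : tw_data R n M).
Hypothesis tw : tw_frame P T D.

Local Notation U := (fr_dom D).
Local Notation A := (ph_atlas P).
Let oU : open U := tw_open tw.
Local Notation F := (frame_of T_reeb tw).
Local Notation Z := (Zf F).
Local Notation Zb a := (cjv (Zf F a)).

(** The membership proof is an argument because sums and products are computed pointwise on [U];
    carrying it lets evaluation be declared a ring morphism. *)
Definition evalp p (Up : U p) (h : cfun F) : R[i] := smooth_val h p.

Section Point.
Variables (p : M) (Up : U p).
Lemma evalp_zmod_morphism : zmod_morphism (evalp Up).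
Proof. by move=> h k; exact: val_sub. Qed.
HB.instance Definition _ :=
  GRing.isZmodMorphism.Build (cfun F) R[i] (evalp Up) evalp_zmod_morphism.
Lemma evalp_monoid_morphism : monoid_morphism (evalp Up).
Proof. by split=> [|h k]; [exact: val_one|exact: val_mul]. Qed.
HB.instance Definition _ :=
  GRing.isMonoidMorphism.Build (cfun F) R[i] (evalp Up) evalp_monoid_morphism.

Lemma evalp_cjf h : evalp Up (cjf F h) = (evalp Up h)^*.
Proof. exact: sf_conjE. Qed.

Lemma evalp_im : evalp Up (im F) = 'i.
Proof. exact: sf_cstE. Qed.
End Point.

(** Bridge from the operators, defined on arbitrary functions, to the ring. Since it only looks at
    [U], the operators can be composed without discussing the smoothness of their values
    elsewhere. *)
Definition represents (h : M -> R) (H : cfun F) :=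
  forall p (Up : U p), (h p)%:C = evalp Up H.

Lemma represents_real h H : represents h H -> cjf F H = H.
Proof.
move=> hH; apply: smooth_funP => p Up.
rewrite -[LHS]/(evalp Up (cjf F H)) evalp_cjf -[RHS]/(evalp Up H) -hH.
by rewrite conj_complexE /= oppr0.
Qed.

Lemma field_represents h H (X : cfld F) p (Up : U p) : represents h H ->
  vector_val X p (fun q => (h q)%:C) = evalp Up (der F X H).
Proof.
move=> hH; rewrite /evalp [RHS]sf_derE //; symmetry.
by apply: (vector_local oU) => //; [exact: smooth_valP|move=> q Uq; rewrite (hH q Uq)].
Qed.

Lemma field2_represents h H (X Y : cfld F) p (Up : U p) : represents h H ->
  vector_val X p (fun q => vector_val Y q (fun q' => (h q')%:C))
  = evalp Up (der F X (der F Y H)).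
Proof.
move=> hH; rewrite /evalp [RHS]sf_derE //; symmetry.
apply: (vector_local oU) => //; first exact: smooth_valP.
by move=> q Uq; rewrite (field_represents Y Uq hH).
Qed.

Lemma real_of_conj (z : R[i]) : z^* = z -> (complex.Re z)%:C = z.
Proof.
case: z => a b; rewrite conj_complexE /= => -[/eqP].
rewrite -subr_eq0 -opprD oppr_eq0 -mulr2n mulrn_eq0 /= => /eqP ->.
by [].
Qed.

Lemma represents_T h H : represents h H -> represents (act T h) (der F (Tf F) H).
Proof.
move=> hH p Up; rewrite /act -[T p]/(vector_val (Tf F) p) (field_represents _ Up hH).
by rewrite real_of_conj // -evalp_cjf cjf_derT // (represents_real hH).
Qed.

Lemma represents_sublaplacian h H :
  represents h H -> represents (sublaplacian D h) (lap H).
Proof.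
move=> hH p Up; have Hr := represents_real hH.
rewrite /sublaplacian -[RHS]real_of_conj -?evalp_cjf ?cjf_lap //.
congr ((complex.Re _)%:C); rewrite big_split /lap rmorphD !rmorph_sum /=.
congr (_ + _); apply: eq_bigr => a _.
  rewrite /nab /nabla rmorphB rmorph_sum /= /hess_zzbar.
  rewrite -(field2_represents (Zb a) (Z a) Up hH); congr (_ - _).
  apply: eq_bigr => c _; rewrite rmorphM /= -(field_represents (Z c) Up hH).
  by congr (_ * _); rewrite /evalp /= sf_formE //; exact: (tw_om_form tw).
rewrite nabbE rmorphD rmorph_sum /= /hess_zbarz.
rewrite -(field2_represents (Z a) (Zb a) Up hH); congr (_ + _).
rewrite -sumrN; apply: eq_bigr => c _; rewrite rmorphM /=.
rewrite -(field_represents (Zb c) Up hH).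
(* [hess_zbarz] uses the conjugate connection form, [nabb] minus the transposed one; omega being
   skew-Hermitian identifies them. *)
have -> : conjform (fr_om D a c) p (fr_Z D a p) = - evalp Up (om c a (Z a)).
  transitivity ((evalp Up (@om _ F a c (Zb a)))^*).
    by rewrite /evalp /= sf_formE //; exact: (tw_om_form tw).
  by rewrite -evalp_cjf om_skew rmorphN cjvK.
by rewrite mulNr opprK.
Qed.

Lemma represents_mulnat h H k : represents h H ->
  represents (fun q => k%:R * h q) (k%:R * H).
Proof. by move=> hH p Up; rewrite rmorphM /= rmorph_nat (hH p Up) rmorphM /= rmorph_nat. Qed.

Lemma represents_mul h H k K : represents h H -> represents k K ->
  represents (fun q => h q * k q) (H * K).
Proof. by move=> hH hK p Up; rewrite rmorphM /= (hH p Up) (hK p Up) rmorphM. Qed.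

Lemma complex_ReD (x y : R[i]) : complex.Re (x + y) = complex.Re x + complex.Re y.
Proof. by case: x y => a b []. Qed.

(** The real fields are Z + Zb and i (Z - Zb): in the sum of the two products the terms of pure type
    cancel and the mixed ones double. *)
Lemma represents_Gamma h H k K : represents h H -> represents k K ->
  represents (cd_Gamma D h k)
    (2 * \sum_a (der F (Z a) H * der F (Zb a) K + der F (Zb a) H * der F (Z a) K)).
Proof.
move=> hH hK p Up; rewrite /cd_Gamma big_split_ord /= rmorphD !rmorph_sum /= -big_split /=.
rewrite rmorphM rmorph_nat rmorph_sum mulr_sumr; apply: eq_bigr => a _ /=.
rewrite /act /real_frame.
case: splitP => [b /= /ord_inj <-|b /= ab]; last first.
  by have := ltn_ord a; rewrite ab ltnNge leq_addr.
case: splitP => [c /= ac|c /= /addnI /ord_inj <-].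
  by have := ltn_ord c; rewrite -ac ltnNge leq_addr.
rewrite rmorphD !rmorphM /=.
have E h1 H1 : represents h1 H1 ->
    fr_Z D a p (fun q => (h1 q)%:C) = evalp Up (der F (Z a) H1) /\
    conjv (fr_Z D a p) (fun q => (h1 q)%:C) = (evalp Up (der F (Z a) H1))^*.
  move=> r1; split; first exact: (field_represents (Z a) Up r1).
  rewrite -evalp_cjf cjf_der (represents_real r1).
  exact: (field_represents (Zb a) Up r1).
have Eb h1 H1 : represents h1 H1 -> evalp Up (der F (Zb a) H1) =
    (evalp Up (der F (Z a) H1))^*.
  by move=> r1; rewrite -evalp_cjf cjf_der (represents_real r1).
rewrite !(E _ _ hH).1 !(E _ _ hH).2 !(E _ _ hK).1 !(E _ _ hK).2 (Eb _ _ hH) (Eb _ _ hK).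
move: (evalp _ _) (evalp _ _) => -[x1 y1] [x2 y2]; rewrite !conj_complexE /=.
apply/eqP; rewrite eq_complex /=; apply/andP; split; apply/eqP; ring.
Qed.

End Operators.

(** * Completing squares *)

Section RealInequalities.
Variable R : realFieldType.

Lemma sum_sqr_ge (n : nat) (x : 'I_n -> R) : (0 < n)%N ->
  n%:R^-1 * (\sum_a x a) ^+ 2 <= \sum_a x a ^+ 2.
Proof.
move=> n_gt0; set s := \sum_a x a; have nR : 0 < n%:R :> R by rewrite ltr0n.
(* The squared deviations from the mean add up to exactly the difference of the two sides. *)
have : 0 <= \sum_a (x a - s / n%:R) ^+ 2 by apply: sumr_ge0 => a _; exact: sqr_ge0.
have -> : \sum_a (x a - s / n%:R) ^+ 2 =
    \sum_a x a ^+ 2 - 2 * (s / n%:R) * s + (s / n%:R) ^+ 2 * n%:R.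
  have -> : (s / n%:R) ^+ 2 * n%:R = \sum_(a < n) (s / n%:R) ^+ 2.
    by rewrite sumr_const card_ord mulr_natr.
  by rewrite /s mulr_sumr -sumrB -big_split; apply: eq_bigr => a _ /=; ring.
rewrite (_ : _ + _ = \sum_a x a ^+ 2 - n%:R^-1 * s ^+ 2) ?subr_ge0 //.
by field; rewrite gt_eqF.
Qed.

(* [SU], [SG], [SH], [SK] are the sums of |f_a|^2, |f_{0a}|^2, |f_ac|^2 and
   |f_{a cbar}|^2; [X], [SAH], [SBU] are the cross terms of the Bochner formulas,
   [rt] the Ricci-torsion term, [g] = f_0 and [l] the sublaplacian of f. *)
Lemma cd_combination (n k Ab Bb m eps N nu SU SG SH SK X rt SAH SBU g l : R) :
  0 < n -> 1 < m -> 0 < eps -> 0 < nu -> nu <= N ->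
  0 <= SU -> 0 <= SH -> 0 <= SK ->
  0 <= 4 * nu * SG + 8 * X + 16 / nu * SU ->
  - k * SU <= rt ->
  0 <= 8 * ((m - 1) / m) * SH + 4 * nu * g * SAH
       + 2 * nu ^+ 2 * g ^+ 2 * n ^+ 2 * Ab ^+ 2 * (m / (m - 1)) ->
  0 <= 8 * nu * eps * n * Bb ^+ 2 * SU + 4 * nu * g * SBU + 2 * n ^+ 2 * nu / eps * g ^+ 2 ->
  2 / n * l ^+ 2 + 2 * n * g ^+ 2 <= 8 * SK ->
  (2 * m * n)^-1 * (2 * l) ^+ 2 + (- k - 2 * n * N * eps * Bb ^+ 2 - 4 / nu) * (4 * SU)
   + (2 * n / m - 2 * n ^+ 2 * N / eps - 2 * m * n ^+ 2 * N ^+ 2 * Ab ^+ 2 / (m - 1)) * g ^+ 2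
  <= 8 * SH + 8 * SK + 8 * X + 4 * rt + nu * (4 * SG + 4 * g * (SAH + SBU)).
Proof.
move=> n0 m1 e0 nu0 nuN SU0 SH0 SK0 h1 h2 h3 h4 h5.
have m0 : 0 < m by lra.
have mm : 0 < m - 1 by lra.
rewrite -subr_ge0.
(* The difference is split into the quantities of the hypotheses and nonnegative remainders. Both
   Hessian parts are divided in the ratio 1/m to (m - 1)/m: the share 1/m of [SK] receives the trace
   bound, the share (m - 1)/m of [SH] the torsion term. The factors [N - nu] and [N + nu] account
   for replacing nu by N in the constants. *)
have -> : 8 * SH + 8 * SK + 8 * X + 4 * rt + nu * (4 * SG + 4 * g * (SAH + SBU)) -
  ((2 * m * n)^-1 * (2 * l) ^+ 2 + (- k - 2 * n * N * eps * Bb ^+ 2 - 4 / nu) * (4 * SU)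
   + (2 * n / m - 2 * n ^+ 2 * N / eps - 2 * m * n ^+ 2 * N ^+ 2 * Ab ^+ 2 / (m - 1)) * g ^+ 2)
  = (4 * nu * SG + 8 * X + 16 / nu * SU) + 4 * (rt - - k * SU)
   + (8 * ((m - 1) / m) * SH + 4 * nu * g * SAH
       + 2 * nu ^+ 2 * g ^+ 2 * n ^+ 2 * Ab ^+ 2 * (m / (m - 1)))
   + (8 * nu * eps * n * Bb ^+ 2 * SU + 4 * nu * g * SBU + 2 * n ^+ 2 * nu / eps * g ^+ 2)
   + m^-1 * (8 * SK - (2 / n * l ^+ 2 + 2 * n * g ^+ 2))
   + (m - 1) / m * (8 * SK) + m^-1 * (8 * SH)
   + 2 * g ^+ 2 * n ^+ 2 * Ab ^+ 2 * (m / (m - 1)) * ((N - nu) * (N + nu))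
   + 8 * eps * n * Bb ^+ 2 * SU * (N - nu) + 2 * n ^+ 2 / eps * g ^+ 2 * (N - nu).
  by field; rewrite !gt_eqF.
have mi0 : 0 <= m^-1 by rewrite invr_ge0 ltW.
have mm0 : 0 <= (m - 1)^-1 by rewrite invr_ge0 ltW.
have mw : 0 <= m by exact: ltW.
have N0 : 0 <= N - nu by lra.
have N1 : 0 <= N + nu by lra.
have e1 : 0 <= eps by exact: ltW.
have ei : 0 <= eps^-1 by rewrite invr_ge0.
have n1 : 0 <= n by exact: ltW.
do ?[apply: addr_ge0 => //].
- by rewrite mulr_ge0 // subr_ge0.
- by rewrite mulr_ge0 // subr_ge0.
- by rewrite !mulr_ge0 // ltW.
- by rewrite !mulr_ge0.
- by rewrite ?(sqr_ge0, mulr_ge0).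
- by rewrite ?(sqr_ge0, mulr_ge0).
- by rewrite ?(sqr_ge0, mulr_ge0).
Qed.

End RealInequalities.

(** * Squares absorbing the three kinds of cross terms *)

Section ComplexParts.
Variable R : realType.
Implicit Types z w : R[i].

Definition nq z : R := complex.Re z ^+ 2 + complex.Im z ^+ 2.

Lemma nq_ge0 z : 0 <= nq z.
Proof. by rewrite addr_ge0 ?sqr_ge0. Qed.

Lemma nqE z : z * z^* = (nq z)%:C.
Proof.
case: z => a b; rewrite conj_complexE; apply/eqP; rewrite eq_complex /= /nq /=.
by apply/andP; split; apply/eqP; ring.
Qed.

Lemma nq_le z (b : R) : `|z| <= b%:C -> nq z <= b ^+ 2.
Proof.
move=> zb; rewrite -lecR -nqE -normCK rmorphXn /=.
by rewrite ler_pXn2r ?nnegrE ?normr_ge0 // (le_trans (normr_ge0 z) zb).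
Qed.

Lemma complex_Re_sum (I : Type) (r : seq I) (Q : pred I) (f : I -> R[i]) :
  complex.Re (\sum_(i <- r | Q i) f i) = \sum_(i <- r | Q i) complex.Re (f i).
Proof. by apply: (big_morph (@complex.Re R)) => // -[a b] []. Qed.

Lemma complex_ReMr (x : R) z : complex.Re (x%:C * z) = x * complex.Re z.
Proof. by case: z => a b /=; ring. Qed.

Lemma complex_Re_conj z : complex.Re z^* = complex.Re z.
Proof. by rewrite conj_complexE. Qed.

Lemma nat_complex (k : nat) : (k%:R : R[i]) = (k%:R : R)%:C.
Proof. by rewrite rmorph_nat. Qed.

Lemma reeb_cross (nu : R) z w : 0 < nu -> 0 <= 4 * nu * nq w
  + 8 * complex.Re ('i * (z^* * w - z * w^*)) + 16 / nu * nq z.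
Proof.
move=> nu0; case: z w => a b [c e]; rewrite !conj_complexE /nq /=.
set x := (X in 0 <= X).
(* This is 4 nu |w - (2 i / nu) z|^2. Its last coefficient 16 / nu becomes kappa / nu with kappa =
   4, because Gamma(f,f) is 4 times the sum of |f_a|^2. *)
suff -> : x = 4 * nu * ((c + 2 * b / nu) ^+ 2 + (e - 2 * a / nu) ^+ 2).
  by rewrite !mulr_ge0 ?addr_ge0 ?sqr_ge0 // ltW.
by rewrite /x; field; rewrite gt_eqF.
Qed.

Lemma torsion_cross (lam nu g Ab : R) z w : 0 < lam -> nq z <= Ab ^+ 2 ->
  0 <= 8 * lam * nq w + 4 * nu * g * complex.Re (z^* * w + z * w^*)
       + 2 * nu ^+ 2 * g ^+ 2 * Ab ^+ 2 / lam.
Proof.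
move=> lam0 zA; set x := (X in 0 <= X).
(* The square of |w + (nu g / (2 lam)) z|, plus the slack in the bound on z; it is used with lam =
   (m - 1)/m. *)
have -> : x = 8 * lam * ((complex.Re w + nu * g / (2 * lam) * complex.Re z) ^+ 2
    + (complex.Im w + nu * g / (2 * lam) * complex.Im z) ^+ 2)
  + 2 * nu ^+ 2 * g ^+ 2 / lam * (Ab ^+ 2 - nq z).
  rewrite /x; case: z w {zA x} => a b [c e]; rewrite !conj_complexE /nq /=.
  by field; rewrite gt_eqF.
rewrite addr_ge0 //; first by rewrite !mulr_ge0 ?addr_ge0 ?sqr_ge0 // ltW.
by rewrite !(sqr_ge0, mulr_ge0, invr_ge0, subr_ge0) // ltW.
Qed.

Lemma dtorsion_cross (eps nu g Bb : R) z w : 0 < eps -> 0 < nu -> nq z <= Bb ^+ 2 ->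
  0 <= 8 * nu * eps * Bb ^+ 2 * nq w + 4 * nu * g * complex.Re (z^* * w + z * w^*)
       + 2 * nu / eps * g ^+ 2.
Proof.
move=> e0 nu0 zB; set x := (X in 0 <= X).
(* The two squares are the real and imaginary parts of g + 2 eps conj(z) w; here g is completed
   rather than w, leaving the weight eps on |w|^2. *)
have -> : x = 2 * nu / eps *
   ((g + 2 * eps * (complex.Re z * complex.Re w + complex.Im z * complex.Im w)) ^+ 2
    + (2 * eps * (complex.Re z * complex.Im w - complex.Im z * complex.Re w)) ^+ 2)
  + 8 * nu * eps * nq w * (Bb ^+ 2 - nq z).
  rewrite /x; case: z w {zB x} => a b [c e]; rewrite !conj_complexE /nq /=.
  by field; rewrite gt_eqF.
rewrite addr_ge0 //; first by rewrite !(sqr_ge0, mulr_ge0, addr_ge0, invr_ge0) // ltW.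
by rewrite !(nq_ge0, mulr_ge0, subr_ge0) // ltW.
Qed.

Lemma sum_reeb_cross (n : nat) (nu : R) (u w : 'I_n -> R[i]) : 0 < nu ->
  0 <= 4 * nu * (\sum_a nq (w a))
    + 8 * (\sum_a complex.Re ('i * ((u a)^* * w a - u a * (w a)^*)))
    + 16 / nu * (\sum_a nq (u a)).
Proof.
move=> nu0; rewrite !mulr_sumr -!big_split; apply: sumr_ge0 => a _.
exact: reeb_cross.
Qed.

(** The factor n^2 counts the pairs (a, c), each of which receives its own square. *)
Lemma sum_torsion_cross (n : nat) (m nu g Ab : R) (z w : 'I_n -> 'I_n -> R[i]) :
  1 < m -> (forall a c, nq (z a c) <= Ab ^+ 2) ->
  0 <= 8 * ((m - 1) / m) * (\sum_a \sum_c nq (w a c))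
    + 4 * nu * g * (\sum_a \sum_c complex.Re ((z a c)^* * w a c + z a c * (w a c)^*))
    + 2 * nu ^+ 2 * g ^+ 2 * n%:R ^+ 2 * Ab ^+ 2 * (m / (m - 1)).
Proof.
move=> m1 zA; have lam0 : 0 < (m - 1) / m by rewrite divr_gt0; lra.
have -> : 2 * nu ^+ 2 * g ^+ 2 * n%:R ^+ 2 * Ab ^+ 2 * (m / (m - 1)) =
    \sum_(a < n) \sum_(c < n) 2 * nu ^+ 2 * g ^+ 2 * Ab ^+ 2 / ((m - 1) / m).
  by rewrite !sumr_const card_ord -mulr_natr -mulr_natr; field; rewrite !gt_eqF; lra.
rewrite !mulr_sumr -!big_split; apply: sumr_ge0 => a _ /=.
rewrite !mulr_sumr -!big_split; apply: sumr_ge0 => c _ /=.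
exact: torsion_cross.
Qed.

(** Each u_a is used once for every c, whence n in front of the gradient; the term in g is used for
    all pairs, whence n^2. *)
Lemma sum_dtorsion_cross (n : nat) (eps nu g Bb : R) (z : 'I_n -> 'I_n -> R[i])
    (u : 'I_n -> R[i]) :
  0 < eps -> 0 < nu -> (forall a c, nq (z a c) <= Bb ^+ 2) ->
  0 <= 8 * nu * eps * n%:R * Bb ^+ 2 * (\sum_a nq (u a))
    + 4 * nu * g * (\sum_a \sum_c complex.Re ((z a c)^* * u a + z a c * (u a)^*))
    + 2 * n%:R ^+ 2 * nu / eps * g ^+ 2.
Proof.
move=> e0 nu0 zB.
have -> : 8 * nu * eps * n%:R * Bb ^+ 2 * (\sum_a nq (u a)) =
    \sum_a \sum_(c < n) 8 * nu * eps * Bb ^+ 2 * nq (u a).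
  rewrite mulr_sumr; apply: eq_bigr => a _.
  by rewrite sumr_const card_ord -mulr_natr; ring.
have -> : 2 * n%:R ^+ 2 * nu / eps * g ^+ 2 =
    \sum_(a < n) \sum_(c < n) 2 * nu / eps * g ^+ 2.
  by rewrite !sumr_const card_ord -mulr_natr -mulr_natr; field; rewrite gt_eqF.
rewrite mulr_sumr -!big_split; apply: sumr_ge0 => a _ /=.
rewrite mulr_sumr -!big_split; apply: sumr_ge0 => c _ /=.
exact: dtorsion_cross.
Qed.

End ComplexParts.

(** * Sections of T_{1,0} with constant coefficients in the frame *)

Section ConstantCoefficients.
Variables (R : realType) (n : nat) (M : topologicalType) (P : pseudohermitian R n M).
Variables (T : cfield R M) (T_reeb : is_reeb P T) (D : tw_data R n M).
Hypothesis tw : tw_frame P T D.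

Local Notation U := (fr_dom D).
Local Notation A := (ph_atlas P).
Local Notation th := (ph_theta P).
Local Notation T10 := (in_T10 A th (ph_J P)).
Let oU : open U := tw_open tw.

Lemma in_T10_vlin p a v w : T10 p v -> T10 p w -> T10 p (vlin a v w).
Proof.
move=> [xv Jv] [xw Jw]; have [_ Jlin _ _ _] := ph_almost_complex P.
have [[lin _] _ _ _] := ph_contact P.
have [tv thv] := xv; have [tw' thw] := xw; split.
  by split; [exact: tangent_vlin|rewrite lin // thv thw mulr0 addr0].
rewrite Jlin // Jv Jw; apply: funext => f; rewrite /vlin /vzero; ring.
Qed.

Lemma in_T10_vzero p : T10 p (@vzero R M).
Proof.
have [_ Jlin _ _ _] := ph_almost_complex P; have [[lin _] _ _ _] := ph_contact P.
have t0 := tangent_vzero A p.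
have v0 : vlin (-1) (@vzero R M) (@vzero R M) = @vzero R M.
  by apply: funext => f; rewrite /vlin /vzero mulr0 addr0.
have x0 : in_xi A th p (@vzero R M).
  by split=> //; rewrite -v0 lin // mulN1r addNr.
split=> //; rewrite -{1}v0 Jlin //; apply: funext => f; rewrite /vlin /vzero; ring.
Qed.

Lemma T10_section_sum (I : Type) (s : seq I) (c : I -> R[i]) (X : I -> cfield R M) :
  (forall a, T10_section A th (ph_J P) U (X a)) ->
  T10_section A th (ph_J P) U (fun q phi => \sum_(a <- s) c a * X a q phi).
Proof.
move=> tX; elim: s => [|a s [vIH tIH]].
  have -> : (fun q phi => \sum_(a <- [::]) c a * X a q phi) = fun=> @vzero R M.
    by apply: funext => q; apply: funext => f; rewrite big_nil.
  split=> [|q Uq]; last exact: in_T10_vzero.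
  by split=> [q Uq|W f oW WU sf]; [exact: tangent_vzero|exact: csmooth_on_cst].
have -> : (fun q phi => \sum_(b <- a :: s) c b * X b q phi) =
    fun q => vlin (c a) (X a q) (fun phi => \sum_(b <- s) c b * X b q phi).
  by apply: funext => q; apply: funext => f; rewrite big_cons.
have [vXa tXa] := tX a; split=> [|q Uq]; first exact: vfield_on_vlin.
by apply: in_T10_vlin; [exact: tXa|exact: tIH].
Qed.

Lemma tangent_comb (I : Type) (s : seq I) p (v : cvec R M) (c : I -> R[i])
    (h : I -> M -> R[i]) :
  tangent A p v -> (forall b, csmooth_near A p (h b)) ->
  v (fun q => \sum_(b <- s) c b * h b q) = \sum_(b <- s) c b * v (h b).
Proof.
move=> tv sh; have [lin _ _ _] := tv.
suff: csmooth_near A p (fun q => \sum_(b <- s) c b * h b q) /\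
  v (fun q => \sum_(b <- s) c b * h b q) = \sum_(b <- s) c b * v (h b) by case.
elim: s => [|b s [sIH IH]].
  have -> : (fun q => \sum_(b <- [::]) c b * h b q) = fun=> 0.
    by apply: funext => q; rewrite big_nil.
  by split; [exact: csmooth_near_cst|rewrite big_nil (tangent0 tv)].
have -> : (fun q => \sum_(b' <- b :: s) c b' * h b' q) =
    fun q => c b * h b q + \sum_(b' <- s) c b' * h b' q.
  by apply: funext => q; rewrite big_cons.
by split; [exact: csmooth_nearZ|rewrite lin // big_cons IH].
Qed.

(** The coefficients are constants, so no derivative of them appears and the bracket is bilinear. *)
Lemma bracket_sum (I : finType) (c e : I -> R[i]) (X Y : I -> cfield R M) p : U p ->
  (forall a, vfield_on A U (X a)) -> (forall a, vfield_on A U (Y a)) ->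
  bracket A (fun q phi => \sum_a c a * X a q phi) (fun q phi => \sum_a e a * Y a q phi) p
  = fun phi => \sum_a c a * \sum_b e b * bracket A (X a) (Y b) p phi.
Proof.
move=> Up vX vY; apply: funext => f.
have [sf|nsf] := pselect (csmooth_near A p f); last first.
  rewrite {1}/bracket asboolF // big1 // => a _; rewrite big1 ?mulr0 // => b _.
  by rewrite /bracket asboolF // mulr0.
rewrite bracketE //.
have E (c1 e1 : I -> R[i]) (X1 Y1 : I -> cfield R M) : (forall a, vfield_on A U (X1 a)) ->
  (forall a, vfield_on A U (Y1 a)) ->
  \sum_a c1 a * X1 a p (fun q => \sum_b e1 b * Y1 b q f) =
  \sum_a \sum_b c1 a * e1 b * X1 a p (fun q => Y1 b q f).
  move=> v1 v2; apply: eq_bigr => a _; rewrite (@tangent_comb _ _ p).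
  - by rewrite mulr_sumr; apply: eq_bigr => b _; rewrite mulrA.
  - by case: (v1 a) => t _; exact: t.
  - by move=> b; exact: (csmooth_near_vfield oU (v2 b) Up sf).
rewrite /= (E c e X Y) // (E e c Y X) // [X in _ - X]exchange_big -sumrB; apply: eq_bigr => a _.
rewrite -sumrB mulr_sumr; apply: eq_bigr => b _ /=; rewrite bracketE //; ring.
Qed.

(** [levi] is defined by the exterior derivative on fields, not by values at [p]; theta vanishes on
    [Y] and its conjugate, so it reduces to theta of a bracket, which expands bilinearly in the
    unitary frame. *)
Lemma levi_sum (z : 'I_n -> R[i]) p : U p ->
  let Y := fun q phi => \sum_a z a * fr_Z D a q phi in
  levi A th Y Y p = \sum_a z a * (z a)^*.
Proof.
move=> Up Y.
have [vY tY] : T10_section A th (ph_J P) U Y.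
  by apply: T10_section_sum => a; exact: (tw_section tw).
pose Yv := VectorField vY.
have thY0 : sf_form oU th Yv = 0.
  by apply: smooth_funP => q Uq; rewrite sf_formE ?val_zero //;
    [case: (tY q Uq) => -[]|exact: theta_form].
have thYb0 : sf_form oU th (vf_conj Yv) = 0.
  apply: smooth_funP => q Uq; rewrite sf_formE ?val_zero //; last exact: theta_form.
  have [[tYq thYq] _] := tY q Uq.
  by rewrite /= /conjF theta_conj // thYq rmorph0.
have := @sf_th_bracket _ _ _ P _ _ tw Yv (vf_conj Yv).
rewrite thY0 thYb0 => /(_ (fun X => raddf0 _) (fun X => raddf0 _) p Up) /(canLR (@opprK _)) e.
rewrite /levi -[conjF Y]/(vector_val (vf_conj Yv)) -[Y]/(vector_val Yv) -{}e.
rewrite sf_formE //; last exact: theta_form.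
rewrite /= (_ : conjF Y = fun q phi => \sum_a (z a)^* * conjF (fr_Z D a) q phi); last first.
  apply: funext => q; apply: funext => f; rewrite /conjF /conjv rmorph_sum.
  by apply: eq_bigr => a _; rewrite rmorphM.
have vZ a : vfield_on A U (fr_Z D a) := (tw_section tw a).1.
have vZb a : vfield_on A U (conjF (fr_Z D a)) := vfield_on_conj (vZ a).
rewrite bracket_sum //.
have fth := theta_form P D.
have tb a b : tangent A p (bracket A (fr_Z D a) (conjF (fr_Z D b)) p).
  by have [t _] := vfield_on_bracket oU (vZ a) (vZb b); exact: t.
rewrite (form_sum _ _ fth Up); last by move=> a; exact: tangent_sum.
rewrite mulrNN mulr_sumr; apply: eq_bigr => a _.
rewrite (form_sum _ _ fth Up) //.
have E b : th p (bracket A (fr_Z D a) (conjF (fr_Z D b)) p) = - ('i * (a == b)%:R).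
  have := congr1 (fun h => smooth_val h p) (sf_th_bracketZZb tw a b).
  by rewrite /= sf_formE // !valE.
have -> : \sum_b (z b)^* * th p (bracket A (fr_Z D a) (conjF (fr_Z D b)) p)
    = - ('i * (z a)^*).
  rewrite -[RHS](sum_deltar (fun b => - ('i * (z b)^*))).
  by apply: eq_bigr => b _; rewrite E; ring.
rewrite (_ : _ * _ = - 'i ^+ 2 * (z a * (z a)^*)); last by ring.
by rewrite sqrCi opprK mul1r.
Qed.

End ConstantCoefficients.

(** * Bochner formulas at a point *)

Section LaplacianScaling.
Variables (n : nat) (F : crFrame n).

Lemma lap_nat k : lap (k%:R : cfun F) = 0.
Proof.
have d0 X : der F X k%:R = 0 by exact: der_nat.
rewrite /lap /lap1 /lap2 !big1 ?addr0 // => c _.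
  by rewrite nabbE d0 raddf0 big1 ?addr0 // => e _; rewrite d0 mulr0.
by rewrite /nab /nabla d0 raddf0 big1 ?subr0 // => e _; rewrite d0 mulr0.
Qed.

Lemma lap_mulnat k (h : cfun F) : lap (k%:R * h) = k%:R * lap h.
Proof.
rewrite lapM lap_nat mulr0 addr0 big1 ?mulr0 ?addr0 // => a _.
by rewrite !der_nat !mul0r addr0.
Qed.

Lemma der_mulnat X k (h : cfun F) : der F X (k%:R * h) = k%:R * der F X h.
Proof. by rewrite derM der_nat mulr0 addr0. Qed.

Section RealFunction.
Variable f : cfun F.
Local Notation Z := (Zf F).
Local Notation Zb a := (cjv (Zf F a)).
Local Notation d := (der F).
Local Notation g := (d (Tf F) f).

(** A quarter of Gamma_2(f,f), written as the left-hand side of [bochner]; the factor 4 comes from L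
    being twice the sublaplacian and Gamma(f,f) four times the sum of |f_a|^2. *)
Definition gammaE : cfun F := lap (\sum_a d (Z a) f * d (Zb a) f)
  - \sum_a (d (Zb a) f * d (Z a) (lap f) + d (Z a) f * d (Zb a) (lap f)).

(** Gamma_2^Z(f,f), arranged to exhibit the commutator of the sublaplacian with T. *)
Definition gammaZE : cfun F :=
  4 * (\sum_a d (Z a) g * d (Zb a) g) + 2 * g * (lap g - d (Tf F) (lap f)).

(** Stated doubled since [cfun F] is only a commutative ring; the factor 1/2 of [Gamma2] is applied
    after evaluation, in [half_represents]. *)
Lemma gamma_double :
  2 * lap (2 * \sum_a (d (Z a) f * d (Zb a) f + d (Zb a) f * d (Z a) f))
  - 2 * (2 * \sum_a (d (Z a) f * d (Zb a) (2 * lap f) + d (Zb a) f * d (Z a) (2 * lap f)))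
  = 2 * (4 * gammaE).
Proof.
rewrite (_ : \sum_a (d (Z a) f * d (Zb a) f + _) = 2 * \sum_a d (Z a) f * d (Zb a) f).
  rewrite (_ : \sum_a (_ + d (Zb a) f * d (Z a) (2 * _)) =
     2 * \sum_a (d (Zb a) f * d (Z a) (lap f) + d (Z a) f * d (Zb a) (lap f))).
    by rewrite !lap_mulnat /gammaE; ring.
  by rewrite mulr_sumr; apply: eq_bigr => a _; rewrite !der_mulnat; ring.
by rewrite mulr_sumr; apply: eq_bigr => a _; ring.
Qed.

Lemma gammaZ_double :
  2 * lap (g * g) - 2 * (g * d (Tf F) (2 * lap f)) = 2 * gammaZE.
Proof.
rewrite lapM der_mulnat (_ : \sum_a (_ + _) = 2 * \sum_a d (Z a) g * d (Zb a) g).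
  by rewrite /gammaZE; ring.
by rewrite mulr_sumr; apply: eq_bigr => a _; ring.
Qed.

End RealFunction.
End LaplacianScaling.

(** * Real parts of the Bochner formulas under an evaluation morphism *)

Section PointEvaluation.
Variables (R : realType) (n : nat) (F : crFrame n).
Variable ev : {rmorphism cfun F -> R[i]}.
Hypothesis ev_cjf : forall h, ev (cjf F h) = (ev h)^*.
Hypothesis ev_im : ev (im F) = 'i.
Variables (f : cfun F) (fr : cjf F f = f).
Variables (g l : R).
Local Notation Z := (Zf F).
Local Notation Zb a := (cjv (Zf F a)).
Local Notation d := (der F).
Hypothesis ev_T : ev (d (Tf F) f) = g%:C.
Hypothesis ev_lap : ev (lap f) = l%:C.

Local Notation z a := (ev (d (Z a) f)).
Local Notation H a c := (ev (nab (Z c) (fun b => d (Z b) f) a)).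
Local Notation K a c := (ev (nab (Zb c) (fun b => d (Z b) f) a)).
Local Notation gm a := (ev (d (Z a) (d (Tf F) f))).
Local Notation tor a c := (ev (torsion F a c)).
Local Notation dtor a c := (ev (dtorsion a c (Zb c))).
Local Notation ric a b := (ev (ricci F a b)).

Lemma ev_gradb a : ev (d (Zb a) f) = (z a)^*.
Proof. by rewrite -ev_cjf cjf_grad. Qed.

Lemma ev_gradTb a : ev (d (Zb a) (d (Tf F) f)) = (gm a)^*.
Proof. by rewrite -ev_cjf cjf_der cjf_derT. Qed.

Lemma ev_hessb a c : ev (nabb (Zb c) (fun b => d (Zb b) f) a) = (H a c)^*.
Proof. by rewrite -ev_cjf cjf_hess. Qed.

Lemma ev_hessb_mixed a c : ev (nabb (Z c) (fun b => d (Zb b) f) a) = (K a c)^*.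
Proof. by rewrite -ev_cjf cjf_hess // cjvK. Qed.

(** [ricS] and [torS] are Ric and Tor on the gradient vector, whose (1,0) components are Z^a =
    f_{abar}, the conjugates of [z a]. *)
Definition ricS := \sum_a \sum_b ric a b * (z a)^* * z b.
Definition torS := 'i * \sum_a \sum_b ((tor a b)^* * z a * z b - tor a b * (z a)^* * (z b)^*).

Lemma Re_gammaE : complex.Re (ev (4 * gammaE f)) =
  8 * (\sum_a \sum_c nq (H a c)) + 8 * (\sum_a \sum_c nq (K a c))
  + 8 * (\sum_a complex.Re ('i * ((z a)^* * gm a - z a * (gm a)^*)))
  + 4 * complex.Re (2 * ricS - (n%:R - 2) * torS).
Proof.
have E1 : ev (\sum_a \sum_c 2 * (nab (Z c) (fun b => d (Z b) f) a * nabb (Zb c) (fun b => d (Zb b) f) a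
     + nab (Zb c) (fun b => d (Z b) f) a * nabb (Z c) (fun b => d (Zb b) f) a))
   = (2 * (\sum_a \sum_c nq (H a c) + \sum_a \sum_c nq (K a c)))%:C.
  rewrite -big_split mulr_sumr !rmorph_sum; apply: eq_bigr => a _.
  rewrite /= -big_split mulr_sumr !rmorph_sum; apply: eq_bigr => c _ /=.
  have evE (x y x' y' : cfun F) :
      ev (2 * (x * y + x' * y')) = 2 * (ev x * ev y + ev x' * ev y').
    by rewrite rmorphM rmorph_nat rmorphD !rmorphM.
  have cE (x y : R) : (2 * (x + y))%:C = 2 * (x%:C + y%:C).
    by rewrite rmorphM rmorph_nat rmorphD.
  by rewrite evE cE ev_hessb ev_hessb_mixed !nqE.
have E2 : ev (\sum_a (d (Zb a) f * d (Z a) (d (Tf F) f) - d (Z a) f * d (Zb a) (d (Tf F) f)))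
   = \sum_a ((z a)^* * gm a - z a * (gm a)^*).
  rewrite rmorph_sum; apply: eq_bigr => a _.
  by rewrite rmorphB !rmorphM ev_gradb ev_gradTb.
have E3 : ev (\sum_a \sum_b (ricci F a b * d (Zb a) f * d (Z b) f
    + cjf F (ricci F a b) * d (Z a) f * d (Zb b) f)) = ricS + ricS^*.
  rewrite /ricS !rmorph_sum -big_split; apply: eq_bigr => a _.
  rewrite /= !rmorph_sum -big_split; apply: eq_bigr => b _ /=.
  by rewrite rmorphD !rmorphM /= !ev_gradb ev_cjf conjCK.
have E4 : ev (\sum_a \sum_b (torsion F a b * d (Zb a) f * d (Zb b) f
    - cjf F (torsion F a b) * d (Z a) f * d (Z b) f)) =
    \sum_a \sum_b (tor a b * (z a)^* * (z b)^* - (tor a b)^* * z a * z b).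
  rewrite !rmorph_sum; apply: eq_bigr => a _.
  rewrite /= !rmorph_sum; apply: eq_bigr => b _ /=.
  by rewrite rmorphB !rmorphM /= !ev_gradb (ev_cjf (torsion F a b)).
(* The torsion sum of [bochner] has the order of its two terms reversed with respect to Tor; this is
   the minus sign in front of (n - 2) Tor. *)
have E5 : torS = - 'i * \sum_a \sum_b (tor a b * (z a)^* * (z b)^* - (tor a b)^* * z a * z b).
  rewrite /torS mulNr -mulrN -sumrN; congr (_ * _); apply: eq_bigr => a _.
  by rewrite -sumrN; apply: eq_bigr => b _; rewrite opprB.
have evE (s1 s2 s3 s4 : cfun F) :
    ev (4 * (s1 + 2 * im F * s2 + s3 + im F * (n%:R - 2) * s4))
    = 4 * (ev s1 + 2 * 'i * ev s2 + ev s3 + 'i * (n%:R - 2) * ev s4).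
  rewrite rmorphM rmorph_nat; congr (_ * _).
  by rewrite 3!rmorphD 4!rmorphM rmorphB !rmorph_nat ev_im.
have ReE (x y : R) (s rs t : R[i]) :
    complex.Re (4 * ((2 * (x + y))%:C + 2 * 'i * s + (rs + rs^*) + 'i * (n%:R - 2) * t))
    = 8 * x + 8 * y + 8 * complex.Re ('i * s)
      + 4 * complex.Re (2 * rs - (n%:R - 2) * (- 'i * t)).
  rewrite (nat_complex _ n); case: s rs t => s1 s2 [r1 r2] [t1 t2].
  by rewrite conj_complexE /=; ring.
by rewrite /gammaE (bochner fr) evE E1 E2 E3 E4 ReE -E5 mulr_sumr complex_Re_sum.
Qed.

Lemma Re_gammaZE : complex.Re (ev (gammaZE f)) =
  4 * (\sum_a nq (gm a)) + 4 * g *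
   (\sum_a \sum_c complex.Re ((tor a c)^* * H a c + tor a c * (H a c)^*)
   + \sum_a \sum_c complex.Re ((dtor a c)^* * z a + dtor a c * (z a)^*)).
Proof.
have E1 : ev (\sum_a d (Z a) (d (Tf F) f) * d (Zb a) (d (Tf F) f)) = (\sum_a nq (gm a))%:C.
  by rewrite !rmorph_sum; apply: eq_bigr => a _; rewrite rmorphM /= ev_gradTb nqE.
set S1 := \sum_a \sum_c complex.Re (_^* * H _ _ + _).
set S2 := \sum_a \sum_c complex.Re (_^* * z _ + _).
have S1E : \sum_a \sum_c ((tor a c)^* * H a c + tor a c * (H a c)^*) = S1%:C.
  rewrite /S1 rmorph_sum; apply: eq_bigr => a _; rewrite rmorph_sum; apply: eq_bigr => c _.
  by rewrite /= real_of_conj // rmorphD !rmorphM /= !conjCK addrC.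
have S2E : \sum_a \sum_c ((dtor a c)^* * z a + dtor a c * (z a)^*) = S2%:C.
  rewrite /S2 rmorph_sum; apply: eq_bigr => a _; rewrite rmorph_sum; apply: eq_bigr => c _.
  by rewrite /= real_of_conj // rmorphD !rmorphM /= !conjCK addrC.
have El1 : ev (lap1 (d (Tf F) f)) = ev (d (Tf F) (lap1 f)) + (S1 + S2)%:C.
  rewrite lap1_derT 2!rmorphD [in RHS]rmorphD /= -addrA; congr (_ + (_ + _)).
    rewrite -S1E rmorph_sum; apply: eq_bigr => a _; rewrite rmorph_sum; apply: eq_bigr => c _.
    by rewrite rmorphD !rmorphM /= (ev_cjf (torsion F a c)) ev_hessb.
  rewrite -S2E rmorph_sum; apply: eq_bigr => a _; rewrite rmorph_sum; apply: eq_bigr => c _.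
  by rewrite rmorphD !rmorphM /= (ev_cjf (dtorsion a c (Zb c))) ev_gradb.
have fTr := cjf_derT fr.
(* The second half of the sublaplacian is the conjugate of the first, and the added term is real, so
   the commutator with T is twice it. *)
have El2 : ev (lap2 (d (Tf F) f)) = ev (d (Tf F) (lap2 f)) + (S1 + S2)%:C.
  rewrite -(cjf_lap1 fTr) ev_cjf El1 rmorphD /= -ev_cjf cjf_der cjv_T (cjf_lap1 fr).
  by rewrite conj_complexE /= oppr0.
have evE (x y1 y2 w : cfun F) :
    ev (4 * x + 2 * d (Tf F) f * (y1 + y2 - w)) =
    4 * ev x + 2 * g%:C * (ev y1 + ev y2 - ev w).
  by rewrite rmorphD 3!rmorphM !rmorph_nat rmorphB rmorphD ev_T.
rewrite /gammaZE evE E1 El1 El2 /lap raddfD (rmorphD ev) /=.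
move: (ev (d _ (lap1 f))) (ev (d _ (lap2 f))) => [x1 y1] [x2 y2].
by rewrite /=; ring.
Qed.

Lemma trace_bound : (0 < n)%N ->
  2 / n%:R * l ^+ 2 + 2 * n%:R * g ^+ 2 <= 8 * \sum_a \sum_c nq (K a c).
Proof.
move=> n0.
have Kim a : complex.Im (K a a) = g / 2.
  have := congr1 ev (hess_mixed f a a).
  have evE (x y : cfun F) : ev (x + im F * (a == a)%:R * y) = ev x + 'i * ev y.
    by rewrite eqxx mulr1 rmorphD rmorphM ev_im.
  rewrite evE ev_T ev_hessb_mixed.
  move: (K a a) => -[x y]; rewrite conj_complexE /= => -[_ e].
  have : 2 * y = g by move: e; lra.
  by move=> <-; field.
have Kre : l = 2 * \sum_a complex.Re (K a a).
  have := congr1 (@complex.Re R) ev_lap; rewrite /= => <-.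
  rewrite /lap /lap1 /lap2 rmorphD !rmorph_sum /= complex_ReD !complex_Re_sum mulr_sumr -big_split.
  by apply: eq_bigr => a _; rewrite /= ev_hessb_mixed complex_Re_conj; ring.
(* The off-diagonal mixed Hessian is discarded; trace and f_0 only see the diagonal. *)
have : \sum_a nq (K a a) <= \sum_a \sum_c nq (K a c).
  apply: ler_sum => a _; rewrite [leRHS](bigD1 a) //= lerDl.
  by apply: sumr_ge0 => c _; exact: nq_ge0.
have -> : \sum_a nq (K a a) = \sum_a complex.Re (K a a) ^+ 2 + n%:R * (g / 2) ^+ 2.
  rewrite /nq big_split /=; congr (_ + _).
  under eq_bigr do rewrite Kim.
  by rewrite sumr_const card_ord mulr_natl.
have := @sum_sqr_ge R n (fun a => complex.Re (K a a)) n0.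
rewrite {}Kre; move: (\sum_a _) (\sum_a _) (\sum_a _) => w x y h1 h2.
have -> : 2 / n%:R * (2 * x) ^+ 2 + 2 * n%:R * g ^+ 2
    = 8 * (n%:R^-1 * x ^+ 2 + n%:R * (g / 2) ^+ 2).
  by field; rewrite pnatr_eq0 -lt0n.
lra.
Qed.

End PointEvaluation.

(** * Evaluation at a point of the manifold *)

Section AtPoint.
Variables (R : realType) (n : nat) (M : topologicalType) (P : pseudohermitian R n M).
Variables (T : cfield R M) (T_reeb : is_reeb P T) (D : tw_data R n M).
Hypothesis tw : tw_frame P T D.

Local Notation U := (fr_dom D).
Local Notation A := (ph_atlas P).
Local Notation F := (frame_of T_reeb tw).
Local Notation Z := (Zf F).
Local Notation Zb a := (cjv (Zf F a)).
Local Notation d := (der F).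

Lemma represents_L h (H : cfun F) : represents h H -> represents (cd_L D h) (2 * lap H).
Proof. by move=> hH; apply: (represents_mulnat 2 (represents_sublaplacian hH)). Qed.

Variables (f : M -> R) (f_smooth : smooth_on A [set: M] f).
Variables (p : M) (Up : U p).

Definition lift_fun : cfun F := to_smooth A (tw_open tw) (fun q => (f q)%:C).
Local Notation fS := lift_fun.

Lemma lift_represents : represents f fS.
Proof.
move=> q Uq; rewrite /evalp to_smoothE //; apply: csmooth_on_real.
exact: smooth_onS f_smooth.
Qed.

Let r := lift_represents.
Let fr := represents_real r.
Local Notation ev := (evalp Up : {rmorphism cfun F -> R[i]}).

Lemma half_represents (x y w : cfun F) (a b : R) : x - 2 * y = 2 * w ->
  a%:C = ev x -> b%:C = ev y -> (2^-1 * (a - 2 * b))%:C = ev w.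
Proof.
move=> xyw ax bY; have -> : (2^-1 * (a - 2 * b))%:C = 2^-1 * (a%:C - 2 * b%:C).
  by rewrite rmorphM rmorphB rmorphM fmorphV !rmorph_nat.
rewrite ax bY; have := congr1 ev xyw.
rewrite rmorphB !rmorphM !rmorph_nat => ->.
by rewrite mulKf // pnatr_eq0.
Qed.

Lemma Gamma2_Gamma : Gamma2 (cd_L D) (cd_Gamma D) f p = complex.Re (ev (4 * gammaE fS)).
Proof.
rewrite -(half_represents (gamma_double fS) (represents_L (represents_Gamma r r) Up)
  (represents_Gamma r (represents_L r) Up)).
by [].
Qed.

Lemma Gamma2_GammaZ : Gamma2 (cd_L D) (cd_GammaZ T) f p = complex.Re (ev (gammaZE fS)).
Proof.
have rT := represents_T r.
rewrite -(half_represents (gammaZ_double fS) (represents_L (represents_mul rT rT) Up)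
  (represents_mul rT (represents_T (represents_L r)) Up)).
by [].
Qed.

Local Notation z a := (ev (d (Z a) fS)).

Lemma cd_GammaE : cd_Gamma D f f p = 4 * \sum_a nq (z a).
Proof.
apply: (@complexI R); rewrite (represents_Gamma r r Up).
have pw (x y : cfun F) : ev y = (ev x)^* -> 2 * ev (x * y + y * x) = (4 * nq (ev x))%:C.
  move=> e; rewrite rmorphD (rmorphM ev x y) (rmorphM ev y x) e [_^* * _]mulrC nqE.
  by rewrite [RHS]rmorphM [in RHS]rmorph_nat /=; ring.
rewrite rmorphM rmorph_nat rmorph_sum !mulr_sumr rmorph_sum; apply: eq_bigr => a _.
by apply: pw; exact: (ev_gradb (evalp_cjf Up) fr a).
Qed.

Lemma torsE a c q : U q -> tors D a c q = smooth_val (torsion F a c) q.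
Proof.
move=> Uq; rewrite [RHS]sf_conjE //= sf_formE //; exact: (tw_tau_form tw).
Qed.

(** The bounded components differentiate along the conjugate of their first index, the divergence in
    [lap1_derT] along that of its second; symmetry of the torsion matches the two. *)
Lemma tors_covE a c : tors_cov D a c a p = ev (dtorsion c a (Zb a)).
Proof.
rewrite dtorsionC /dtorsion !rmorphB !rmorph_sum /= /tors_cov; congr (_ - _ - _).
- rewrite /evalp [RHS]sf_derE //; symmetry.
  apply: (vector_local (tw_open tw)) => //; first exact: smooth_valP.
  by move=> q Uq; rewrite torsE.
- apply: eq_bigr => b _; rewrite rmorphM torsE //; congr (_ * _).
  by rewrite /evalp [RHS]sf_formE //; exact: (tw_om_form tw).
- apply: eq_bigr => b _; rewrite rmorphM torsE //; congr (_ * _).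
  by rewrite /evalp [RHS]sf_formE //; exact: (tw_om_form tw).
Qed.

Lemma tw_ricciE a b : tw_ricci P D a b p = ev (ricci F a b).
Proof.
rewrite /ricci rmorph_sum; apply: eq_bigr => c _.
rewrite /Om /curvature rmorphB rmorph_sum /= /tw_curv; congr (_ - _).
  symmetry; exact: (sf_extd (tw_open tw) (tw_om_form tw c c) (vf_Z tw a) (vf_conj (vf_Z tw b)) Up).
apply: eq_bigr => e _; rewrite rmorphB !rmorphM /wedge /=.
by rewrite /evalp /= !sf_formE //; exact: (tw_om_form tw).
Qed.

(* Constant coefficients in the frame, equal to the gradient of [f] at [p] only. *)
Definition gradient_field : cfield R M := fun q phi => \sum_a (z a)^* * fr_Z D a q phi.
Local Notation Y := gradient_field.

Lemma gradient_T10 : T10_section A (ph_theta P) (ph_J P) U Y.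
Proof. by apply: T10_section_sum => a; exact: (tw_section tw). Qed.

Lemma co_gradient a : fr_co D a p (Y p) = (z a)^*.
Proof.
rewrite (form_sum _ _ (tw_co_form tw a) Up); last first.
  by move=> b; exact: (tangent_Z tw).
under eq_bigr do rewrite (tw_co_Z tw) // mulrC.
by rewrite sum_deltar.
Qed.

Lemma Ric_gradient : Ric P D Y p = ricS ev fS.
Proof.
apply: eq_bigr => a _; apply: eq_bigr => b _.
by rewrite !co_gradient conjCK tw_ricciE.
Qed.

Lemma Tor_gradient : Tor D Y p = torS ev fS.
Proof.
rewrite /Tor /torS; congr (_ * _); apply: eq_bigr => a _; apply: eq_bigr => b _.
rewrite !co_gradient (conjCK (z a)) (conjCK (z b)).
rewrite (_ : tors D a b p = ev (torsion F a b)); last exact: torsE.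
by congr (_ - _); rewrite mulrAC.
Qed.

Lemma levi_gradient : levi A (ph_theta P) Y Y p = (\sum_a nq (z a))%:C.
Proof.
rewrite (levi_sum tw _ Up) rmorph_sum; apply: eq_bigr => a _ /=.
by rewrite conjCK mulrC nqE.
Qed.

End AtPoint.

Theorem lemma3p2 (R : realType) (n : nat) (n_gt0 : (0 < n)%N)
  (M : topologicalType) (M_closed : closed_manifold M)
  (P : pseudohermitian R n M) (T : cfield R M) (T_reeb : is_reeb P T)
  (k Abar Bbar m eps1 N : R)
  (k_ge0 : 0 <= k) (Abar_ge0 : 0 <= Abar) (Bbar_ge0 : 0 <= Bbar)
  (RicTor : forall F : tw_data R n M, tw_frame P T F ->
     forall (W : set M) (Z : cfield R M), open W -> W `<=` fr_dom F ->
     T10_section P (ph_theta P) (ph_J P) W Z -> forall p, W p ->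
     - k%:C * levi P (ph_theta P) Z Z p
     <= 2 * Ric P F Z p - (n%:R - 2) * Tor F Z p)
  (A_bound : forall F : tw_data R n M, tw_frame P T F ->
     forall p, fr_dom F p -> forall i j : 'I_n, `|tors F i j p| <= Abar%:C)
  (dA_bound : forall F : tw_data R n M, tw_frame P T F ->
     forall p, fr_dom F p -> forall i j : 'I_n, `|tors_cov F i j i p| <= Bbar%:C)
  (m_gt1 : 1 < m) (eps1_gt0 : 0 < eps1) (N_gt0 : 0 < N)
  (N_small : 0 < 2 * n%:R / m - 2 * n%:R ^+ 2 * N / eps1
                 - 2 * m * n%:R ^+ 2 * N ^+ 2 * Abar ^+ 2 / (m - 1)) :
  forall F : tw_data R n M, tw_frame P T F ->
    CD_on P T F
      (- k - 2 * n%:R * N * eps1 * Bbar ^+ 2)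
      (2 * n%:R / m - 2 * n%:R ^+ 2 * N / eps1
       - 2 * m * n%:R ^+ 2 * N ^+ 2 * Abar ^+ 2 / (m - 1))
      4 (2 * m * n%:R) N.
Proof.
move=> D tw L G GZ f f_smooth nu nu0 nuN p Up.
rewrite /L /G /GZ (cd_GammaE T_reeb tw f_smooth Up).
rewrite (Gamma2_Gamma T_reeb tw f_smooth Up) (Gamma2_GammaZ T_reeb tw f_smooth Up).
have r := lift_represents T_reeb tw f_smooth.
have fr := represents_real r.
have evc := @evalp_cjf _ _ _ _ _ T_reeb _ tw _ Up.
have evi := @evalp_im _ _ _ _ _ T_reeb _ tw _ Up.
have evT : evalp Up (der _ (Tf _) _) = (act T f p)%:C := esym (represents_T r Up).
have evL : evalp Up (lap _) = (sublaplacian D f p)%:C := esym (represents_sublaplacian r Up).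
rewrite (Re_gammaE evc evi fr) (Re_gammaZE evc fr evT).
rewrite /cd_L /cd_GammaZ -expr2.
apply: cd_combination => //; rewrite ?ltr0n //.
- by apply: sumr_ge0 => a _; exact: nq_ge0.
- by do 2 (apply: sumr_ge0 => ? _); exact: nq_ge0.
- by do 2 (apply: sumr_ge0 => ? _); exact: nq_ge0.
- exact: sum_reeb_cross.
(* The order of [R[i]] compares real parts and equates imaginary parts; [lecE] extracts the real
   inequality, tested on the constant-coefficient extension of the gradient. *)
- have := RicTor D tw _ _ (tw_open tw) (@subset_refl _ _) (gradient_T10 T_reeb tw f Up) p Up.
  rewrite levi_gradient // Ric_gradient // Tor_gradient // lecE => /andP[_ RT].
  by apply: le_trans RT; rewrite -rmorphN complex_ReMr.
- apply: sum_torsion_cross => // a c; apply: nq_le.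
  by have := A_bound D tw p Up a c; rewrite (torsE T_reeb tw).
- apply: sum_dtorsion_cross => // a c; apply: nq_le.
  by have := dA_bound D tw p Up c a; rewrite (tors_covE T_reeb tw Up).
- exact: trace_bound.
Qed.
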